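(* Let $A$ be an affine $\mathbb C$-algebra equipped with $\mathbb C$-linear derivations $\delta_1,\ldots,\delta_m$ (not necessarily commuting). If $A$ has infinitely many height one prime differential ideals, then there exists $f\in\operatorname{Frac}(A)\setminus\mathbb C$ with $\delta_i(f)=0$ for all $i=1,\ldots,m$.
   Context: An affine $\mathbb C$-algebra is a finitely generated commutative $\mathbb C$-algebra that is an integral domain. A differential ideal is an ideal $I$ with $\delta_i(I)\subseteq I$ for all $i$. The derivations are extended to $\operatorname{Frac}(A)$ by the quotient rule. *)

(* Defs.v *)
From HB Require Import structures.
From mathcomp Require Import all_boot all_order all_algebra.
From mathcomp Require Import complex.
From mathcomp Require Import Rstruct.
From Stdlib Require Import Rdefinitions.
Set Implicit Arguments. Unset Strict Implicit. Unset Printing Implicit Defensive.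
Import Order.TTheory GRing.Theory Num.Theory.
Local Open Scope ring_scope.

Definition CC : Type := complex R.
HB.instance Definition _ := GRing.Field.on CC.

(* A C-algebra structure on the domain A is a ring morphism iota : C -> A. *)

Inductive in_subalg (A : comNzRingType) (iota : CC -> A) (gens : seq A) : A -> Prop :=
  | sa_const c : in_subalg iota gens (iota c)
  | sa_gen g : g \in gens -> in_subalg iota gens g
  | sa_add x y : in_subalg iota gens x -> in_subalg iota gens y -> in_subalg iota gens (x + y)
  | sa_mul x y : in_subalg iota gens x -> in_subalg iota gens y -> in_subalg iota gens (x * y).

Definition finitely_generated (A : comNzRingType) (iota : CC -> A) : Prop :=
  exists gens : seq A, forall x : A, in_subalg iota gens x.

Definition is_C_derivation (A : comNzRingType) (iota : CC -> A) (d : A -> A) : Prop :=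
  (forall x y, d (x + y) = d x + d y) /\
  (forall c x, d (iota c * x) = iota c * d x) /\
  (forall x y, d (x * y) = x * d y + d x * y).

Definition is_ideal (A : comNzRingType) (I : A -> Prop) : Prop :=
  I 0 /\ (forall x y, I x -> I y -> I (x + y)) /\ (forall a x, I x -> I (a * x)).

Definition is_prime_ideal (A : comNzRingType) (I : A -> Prop) : Prop :=
  is_ideal I /\ ~ I 1 /\ (forall x y, I (x * y) -> I x \/ I y).

Definition same_set (A : Type) (I J : A -> Prop) : Prop := forall x, I x <-> J x.

Definition is_height_one_prime (A : comNzRingType) (P : A -> Prop) : Prop :=
  is_prime_ideal P /\ (exists x, P x /\ x <> 0) /\
  (forall Q : A -> Prop, is_prime_ideal Q -> (forall x, Q x -> P x) ->
     same_set Q (fun x => x = 0) \/ same_set Q P).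

Definition is_differential_ideal (A : comNzRingType) (m : nat)
  (delta : 'I_m -> A -> A) (I : A -> Prop) : Prop :=
  forall i x, I x -> I (delta i x).

Definition inf_many_h1_prime_diff_ideals (A : comNzRingType) (m : nat)
  (delta : 'I_m -> A -> A) : Prop :=
  forall L : seq (A -> Prop), exists P : A -> Prop,
    is_height_one_prime P /\ is_differential_ideal delta P /\
    (forall J, List.In J L -> ~ same_set P J).

Notation tofrac := (@FracField.tofrac _).

(* Extension of a derivation to Frac(A) by the quotient rule, applied to the
   chosen representative a/b of f:  d(a/b) = (d(a) b - a d(b)) / b^2. *)
Definition frac_deriv (A : idomainType) (d : A -> A) (f : {fraction A}) : {fraction A} :=
  let r := repr f in
  (tofrac (d \n_r * \d_r - \n_r * d \d_r) / tofrac (\d_r ^+ 2)).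

(* Main.v *)
(* After inverting one H in B = C[x_1, ..., x_n], the algebra A becomes B[y] with f(y) = 0 and
   f'(y) invertible. A height one prime P not containing H meets B in (q) with q irreducible, and
   there is a 1-form omega_P = \sum_l U_l / (f'(y) q) dx_l which near P is dq/q up to a regular form,
   has no pole at the other primes above q, and satisfies deg U_l <= deg q + constant: it is built
   from an idempotent of A/qA separating P from these primes, and the degree bound comes from
   Gauss's lemma and the additivity of weighted degrees. If P is stable under delta, the Lie
   derivative of omega_P along delta is regular, and it has bounded degree because the degrees of
   numerator and denominator compensate; so it lies in a finite-dimensional C-vector space
   independent of P. Taking enough primes P one finds more than n C-linearly independent
   combinations of the omega_P killed by all the Lie derivatives. They are linearly dependent over
   Frac(A), and the coefficients of a relation of minimal support, normalized to contain 1, are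
   killed by all the derivations but are not all in C. *)
Require Import Defs.
From HB Require Import structures.
From mathcomp Require Import all_boot all_order all_algebra.
From mathcomp Require Import separable complex Rstruct.
From mathcomp Require Import perm mpoly zify ring.
From Stdlib Require Import Classical_Prop Classical_Pred_Type IndefiniteDescription.
Set Implicit Arguments. Unset Strict Implicit. Unset Printing Implicit Defensive.
Import Order.TTheory GRing.Theory Num.Theory.
Local Open Scope ring_scope.

(** * Noetherian rings and primes of height one *)

(** The form dq/q itself would not do: q may have further prime divisors in A that are not stable,
    and the Lie derivative of dq/q has poles along them. Nor is A assumed normal or factorial, so P
    has no generator to use instead; after inverting H, divisibility by q is tested on coefficients
    in the basis 1, y, ..., y^r over the factorial ring B. The delicate point is the degree of U_l:
    the idempotent alone comes with no degree control, while q has unbounded degree. For a direction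
    w in which q keeps its degree, q(x + wT) is monic in T up to a constant, so B[T,Y]/(q(x + wT),
    f(x + wT, Y)) is free over B with explicit dual bases. The coordinates of the idempotent times
    the different are then traces of the idempotent against elements of known weight, and T = 0
    gives a numerator for the derivative of q along w. Count: if the Lie derivatives lie in spaces
    of dimension t over C, more than m t + n forms leave more than n combinations killed by all m
    operators, and n is the number of components of a form. *)

Lemma not_subset (T : Type) (P Q : T -> Prop) :
  ~ (forall x, Q x -> P x) -> exists x, Q x /\ ~ P x.
Proof.
move=> h; apply: NNPP => nex; apply: h => x Qx; apply: NNPP => nPx.
by apply: nex; exists x.
Qed.

Section Ideals.
Variable R : comNzRingType.
Implicit Types (I : R -> Prop) (l : seq R).

Lemma ideal0 I : is_ideal I -> I 0. Proof. by case. Qed.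
Lemma idealD I x y : is_ideal I -> I x -> I y -> I (x + y).
Proof. by case=> _ [h _]; apply: h. Qed.
Lemma idealMl I a x : is_ideal I -> I x -> I (a * x).
Proof. by case=> _ [_ h]; apply: h. Qed.
Lemma idealMr I a x : is_ideal I -> I x -> I (x * a).
Proof. by rewrite mulrC; apply: idealMl. Qed.
Lemma idealN I x : is_ideal I -> I x -> I (- x).
Proof. by move=> iI Ix; rewrite -mulN1r; apply: idealMl. Qed.
Lemma idealB I x y : is_ideal I -> I x -> I y -> I (x - y).
Proof. by move=> iI Ix Iy; apply: idealD => //; apply: idealN. Qed.
Lemma ideal_sum I (T : Type) (r : seq T) (Q : pred T) (G : T -> R) : is_ideal I ->
  (forall i, Q i -> I (G i)) -> I (\sum_(i <- r | Q i) G i).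
Proof.
by move=> iI h; apply: big_ind => //; [exact: ideal0 | move=> *; exact: idealD].
Qed.
Lemma idealDr I x y : is_ideal I -> I y -> I (x + y) -> I x.
Proof. by move=> iI Iy Ixy; rewrite -(addrK y x); apply: idealB. Qed.

Lemma primeM I x y : is_prime_ideal I -> I (x * y) -> I x \/ I y.
Proof. by case=> _ [_ h]; apply: h. Qed.
Lemma primeX I x n : is_prime_ideal I -> I (x ^+ n) -> I x.
Proof.
move=> pI; elim: n => [|n IH]; first by rewrite expr0; case: pI => _ [].
by rewrite exprS; case/(primeM pI).
Qed.

Fixpoint lspan l (x : R) : Prop :=
  if l is a :: l' then exists c, lspan l' (x - c * a) else x = 0.

Lemma lspan_ideal l : is_ideal (lspan l).
Proof.
elim: l => [|a l [h0 [hD hM]]] /=.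
  by split=> //; split=> [x y -> ->|b x ->]; rewrite ?addr0 ?mulr0.
split; first by exists 0; rewrite mul0r subr0.
split=> [x y [c hc] [d hd]|b x [c hc]].
  by exists (c + d); rewrite mulrDl opprD addrACA; apply: hD.
by exists (b * c); rewrite -mulrA -mulrBr; apply: hM.
Qed.

Lemma mem_lspan l a : a \in l -> lspan l a.
Proof.
elim: l => //= b l IH; rewrite inE => /orP[/eqP->|/IH h].
  by exists 1; rewrite mul1r subrr; apply: ideal0; apply: lspan_ideal.
by exists 0; rewrite mul0r subr0.
Qed.

Lemma lspan_sub I l x : is_ideal I -> (forall a, a \in l -> I a) -> lspan l x -> I x.
Proof.
move=> iI; elim: l x => [|a l IH] x hl /=; first by move=> ->; apply: ideal0.
case=> c hc; rewrite -(subrK (c * a) x); apply: idealD => //.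
  by apply: IH hc => b hb; apply: hl; rewrite inE hb orbT.
by apply: idealMl => //; apply: hl; rewrite mem_head.
Qed.

Definition noetherian := forall I, is_ideal I ->
  exists l, (forall a, a \in l -> I a) /\ (forall x, I x -> lspan l x).

End Ideals.

Lemma noetherian_surj (S R : comNzRingType) (phi : {rmorphism S -> R}) :
  (forall x, exists s, phi s = x) -> noetherian S -> noetherian R.
Proof.
move=> surj nS I iI.
have [|l [hl hs]] := nS (fun s => I (phi s)).
  split; first by rewrite rmorph0; exact: ideal0.
  by split=> [x y hx hy|a x hx]; rewrite ?rmorphD ?rmorphM; [exact: idealD|exact: idealMl].
exists (map phi l); split=> [a /mapP[s hs' ->]|x Ix]; first exact: hl.
have [s hsx] := surj x.
have : lspan l s by apply: hs; rewrite hsx.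
rewrite -hsx; elim: (l) (s) => [|a l' IH] s' /=; first by move=> ->; rewrite rmorph0.
by case=> c hc; exists (phi c); rewrite -rmorphM -rmorphB; apply: IH.
Qed.

Lemma noetherian_field (k : fieldType) : noetherian k.
Proof.
move=> I iI; have [[a [Ia na]]|h] := classic (exists a, I a /\ a <> 0).
  exists [:: a]; split=> [b|x _]; first by rewrite inE => /eqP->.
  by exists (x / a) => /=; rewrite divfK ?subrr //; apply/eqP.
exists [::]; split=> // x Ix /=; apply: NNPP => nx; apply: h; by exists x.
Qed.

(** * Hilbert's basis theorem and finitely generated algebras *)

Section HilbertBasis.
Variable R : comNzRingType.
Hypothesis noethR : noetherian R.

Section Coef.
Variable I : {poly R} -> Prop.
Hypothesis iI : is_ideal I.

(** The leading coefficients in degree [d]. Only an upper bound on the size is asked, so that 0 is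
    included and this is an ideal. *)
Let L d r := exists p, [/\ I p, (size p <= d.+1)%N & p`_d = r].

Local Lemma L_ideal d : is_ideal (L d).
Proof.
split; first by exists 0; split; rewrite ?size_poly0 ?coef0 //; apply: ideal0.
split=> [x y [p [Ip sp <-]] [q [Iq sq <-]]|a x [p [Ip sp <-]]].
  exists (p + q); split; rewrite ?coefD //; first exact: idealD.
  by rewrite (leq_trans (size_polyD _ _)) // geq_max sp.
exists (a%:P * p); split; rewrite ?coefCM //; first exact: idealMl.
by rewrite mul_polyC (leq_trans (size_scale_leq _ _)).
Qed.

Local Lemma L_mono d e r : (d <= e)%N -> L d r -> L e r.
Proof.
move=> le_de [p [Ip sp <-]]; exists (p * 'X^(e - d)); split.
- exact: idealMr.
- by rewrite (leq_trans (size_polyMleq _ _)) // size_polyXn addnS /= -(subnK le_de)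
    addnC -addnS addnK leq_add.
- by rewrite coefMXn ltnNge leq_subr /= subKn.
Qed.

Local Lemma L_gen d : exists G : seq {poly R},
  [/\ forall g, g \in G -> I g & forall r, L d r ->
    exists g, [/\ lspan G g, (size g <= d.+1)%N & g`_d = r]].
Proof.
have [l [hl hs]] := noethR (L_ideal d).
have [G [hG1 hG2 hG3]] : exists G : seq {poly R}, [/\ forall g, g \in G -> I g,
    forall g, g \in G -> (size g <= d.+1)%N & [seq g`_d | g : {poly R} <- G] = l].
  elim: l hl {hs} => [|a l IH] hl; first by exists [::].
  have [|G [h1 h2 h3]] := IH; first by move=> b hb; apply: hl; rewrite inE hb orbT.
  have [p [Ip sp ep]] := hl a (mem_head _ _).
  exists (p :: G); split=> /= [g|g|]; rewrite ?inE.
  - by case/orP=> [/eqP->|/h1].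
  - by case/orP=> [/eqP->|/h2].
  - by rewrite h3 ep.
exists G; split=> // r /hs; rewrite -hG3; elim: (G) hG2 r => [|g G' IH] hG2 r /=.
  by move=> ->; exists 0; rewrite size_poly0 coef0; split.
case=> c hc.
have [|g' [h1 h2 h3]] := IH _ _ hc; first by move=> a ha; apply: hG2; rewrite inE ha orbT.
exists (g' + c%:P * g); split.
- by exists c%:P; rewrite addrK.
- rewrite (leq_trans (size_polyD _ _)) // geq_max h2 mul_polyC.
  by rewrite (leq_trans (size_scale_leq _ _)) // hG2 // mem_head.
- by rewrite coefD coefCM h3 subrK.
Qed.

(** The [L d] increase with [d], so the finitely many generators of their union already lie in one
    of them. *)
Local Lemma L_stable : exists D, forall d r, L d r -> L D r.
Proof.
have iU : is_ideal (fun r => exists d, L d r).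
  split; first by exists 0%N; apply: ideal0; apply: L_ideal.
  split=> [x y [d hd] [e he]|a x [d hd]]; last first.
    by exists d; apply: idealMl => //; apply: L_ideal.
  exists (maxn d e); apply: idealD; first exact: L_ideal.
    by apply: L_mono hd; rewrite leq_maxl.
  by apply: L_mono he; rewrite leq_maxr.
have [l [hl hs]] := noethR iU.
have [D hD] : exists D, forall a, a \in l -> L D a.
  elim: l hl {hs} => [|a l IH] hl; first by exists 0%N.
  have [|D hD] := IH; first by move=> b hb; apply: hl; rewrite inE hb orbT.
  have [d hd] := hl a (mem_head _ _).
  exists (maxn d D) => b; rewrite inE => /orP[/eqP->|/hD h].
    by apply: L_mono hd; rewrite leq_maxl.
  by apply: L_mono h; rewrite leq_maxr.
exists D => d r hr; apply: (lspan_sub (L_ideal D) hD); apply: hs; by exists d.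
Qed.

(** Subtracting a combination of generators with the same leading term lowers the size. Generators
    are collected for the degrees up to [D]; in a higher degree, an element of degree [D] is shifted
    by a power of X. *)
Local Lemma hilbert_fg : exists l, (forall a, a \in l -> I a) /\ (forall x, I x -> lspan l x).
Proof.
have [D hD] := L_stable.
have [G [hG1 hG2]] : exists G : seq {poly R}, [/\ forall g, g \in G -> I g &
   forall d r, (d <= D)%N -> L d r ->
    exists g, [/\ lspan G g, (size g <= d.+1)%N & g`_d = r]].
  elim: (D) => [|n [G [h1 h2]]].
    have [G [h1 h2]] := L_gen 0; exists G; split=> // d r; rewrite leqn0 => /eqP->; exact: h2.
  have [G' [h1' h2']] := L_gen n.+1; exists (G ++ G'); split=> [g|d r].
    by rewrite mem_cat => /orP[/h1|/h1'].
  rewrite leq_eqVlt => /orP[/eqP->|]; first case/h2' => g [hg sg eg]; last first.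
    move=> le_d Ld; have [g [hg sg eg]] := h2 _ _ le_d Ld.
    exists g; split=> //; apply: lspan_sub hg; first exact: lspan_ideal.
    by move=> a ha; apply: mem_lspan; rewrite mem_cat ha.
  exists g; split=> //; apply: lspan_sub hg; first exact: lspan_ideal.
  by move=> a ha; apply: mem_lspan; rewrite mem_cat ha orbT.
exists G; split=> // x.
have iG := lspan_ideal G.
elim: {x}(size x).+1 {-2}x (ltnSn (size x)) => // n IH x; rewrite ltnS => sx Ix.
have [->|nx] := eqVneq x 0; first exact: ideal0.
have sx1 : size x = (size x).-1.+1 by rewrite prednK // size_poly_gt0.
set d := (size x).-1 in sx1.
have Ld : L d x`_d by exists x; rewrite -sx1.
have step g : lspan G g -> (size g <= d.+1)%N -> g`_d = x`_d -> lspan G x.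
  move=> hg sg eg; rewrite -(subrK g x); apply: idealD => //; apply: IH; last first.
    by apply: idealB => //; apply: lspan_sub hg.
  apply: leq_trans sx; rewrite sx1 ltnS; apply/leq_sizeP => j.
  rewrite leq_eqVlt => /orP[/eqP<-|lt_dj]; rewrite coefB; first by rewrite eg subrr.
  by rewrite !nth_default ?subrr // -?sx1 ?(leq_trans sg) // sx1.
have [le_dD|lt_Dd] := leqP d D.
  by have [g [hg sg eg]] := hG2 _ _ le_dD Ld; apply: (step g).
have [g [hg sg eg]] := hG2 _ _ (leqnn D) (hD _ _ Ld).
apply: (step (g * 'X^(d - D))).
- exact: idealMr.
- rewrite (leq_trans (size_polyMleq _ _)) // size_polyXn addnS /= -{2}(subnKC (ltnW lt_Dd)).
  by rewrite -addSn leq_add2r.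
- by rewrite coefMXn ltnNge leq_subr /= subKn // ltnW.
Qed.

End Coef.

Theorem hilbert_basis : noetherian {poly R}.
Proof. by move=> I; apply: hilbert_fg. Qed.

End HilbertBasis.

Lemma comm_rmorphism (S A : comNzRingType) (phi : {rmorphism S -> A}) (u : A) :
  commr_rmorph phi u.
Proof. by move=> s; apply: mulrC. Qed.

Definition hmorph (S A : comNzRingType) (phi : {rmorphism S -> A}) (u : A) :
  {rmorphism {poly S} -> A} := horner_morph (comm_rmorphism phi u).

Lemma hmorphC (S A : comNzRingType) (phi : {rmorphism S -> A}) u a :
  hmorph phi u a%:P = phi a.
Proof. exact: horner_morphC. Qed.

Lemma hmorphX (S A : comNzRingType) (phi : {rmorphism S -> A}) u : hmorph phi u 'X = u.
Proof. exact: horner_morphX. Qed.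

Lemma finitely_generated_noetherian (A : comNzRingType) (iota : {rmorphism CC -> A}) :
  finitely_generated iota -> noetherian A.
Proof.
case=> gens hgens.
suff [S [phi [nS hC hg]]] : exists (S : comNzRingType) (phi : {rmorphism S -> A}),
    [/\ noetherian S, forall c, exists s, phi s = iota c
      & forall g, g \in gens -> exists s, phi s = g].
  apply: (noetherian_surj (phi := phi)) => // x; elim: (hgens x) => {x} //.
    by move=> x y _ [s <-] _ [t <-]; exists (s + t); rewrite rmorphD.
  by move=> x y _ [s <-] _ [t <-]; exists (s * t); rewrite rmorphM.
elim: {hgens} gens => [|g gens [S [phi [nS hC hg]]]].
  exists CC, iota; split=> //; last by move=> c; exists c.
  exact: noetherian_field.
exists {poly S}, (hmorph phi g); split; first exact: hilbert_basis.
  by move=> c; have [s <-] := hC c; exists s%:P; rewrite hmorphC.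
move=> a; rewrite inE => /orP[/eqP->|/hg[s <-]]; first by exists 'X; rewrite hmorphX.
by exists s%:P; rewrite hmorphC.
Qed.

(** * Products of primes inside an ideal, and their use for primes of height one *)

Section PrimeProducts.
Variable R : comNzRingType.
Hypothesis noethR : noetherian R.
Implicit Types (I P Q : R -> Prop) (Qs : seq (R -> Prop)).

Fixpoint prods Qs (x : R) : Prop :=
  if Qs is Q :: Qs' then exists a y, [/\ Q a, prods Qs' y & x = a * y] else x = 1.

Lemma prods_cat Qs Qs' x : prods (Qs ++ Qs') x ->
  exists y z, [/\ prods Qs y, prods Qs' z & x = y * z].
Proof.
elim: Qs x => [|Q Qs IH] x /=; first by exists 1, x; rewrite mul1r.
case=> a [y [Qa /IH [u [v [hu hv ->]]] ->]].
by exists (a * u), v; rewrite mulrA; split=> //; exists a, u.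
Qed.

Lemma prime_prods P Qs : is_prime_ideal P -> (forall x, prods Qs x -> P x) ->
  exists Q, List.In Q Qs /\ forall x, Q x -> P x.
Proof.
move=> pP; elim: Qs => [|Q Qs IH] hP; first by case: pP => _ [[]]; apply: hP.
have [h|/not_subset[a [Qa nPa]]] := classic (forall x, Q x -> P x).
  by exists Q; split=> //; left.
have [|Q' [inQ' hQ']] := IH; last by exists Q'; split=> //; right.
move=> x hx; have /(primeM pP) [] // : P (a * x).
by apply: hP; exists a, x.
Qed.

Definition ideal_adjoin I a : R -> Prop := fun x => exists c, I (x - c * a).

Lemma ideal_adjoin_ideal I a : is_ideal I -> is_ideal (ideal_adjoin I a).
Proof.
move=> iI; split; first by exists 0; rewrite mul0r subr0; apply: ideal0.
split=> [x y [c hc] [d hd]|b x [c hc]].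
  by exists (c + d); rewrite mulrDl opprD addrACA; apply: idealD.
by exists (b * c); rewrite -mulrA -mulrBr; apply: idealMl.
Qed.

Lemma noetherian_chain (C : nat -> R -> Prop) :
  (forall n, is_ideal (C n)) -> (forall n x, C n x -> C n.+1 x) ->
  exists n, forall x, C n.+1 x -> C n x.
Proof.
move=> iC sC.
have mC m n x : (m <= n)%N -> C m x -> C n x.
  by move=> /subnK <-; elim: (n - m)%N => // d IH /IH; rewrite addSn; apply: sC.
have iU : is_ideal (fun x => exists n, C n x).
  split; first by exists 0%N; apply: ideal0.
  split=> [x y [m hm] [n hn]|a x [n hn]]; last by exists n; apply: idealMl.
  exists (maxn m n); apply: idealD => //.
    by apply: mC hm; rewrite leq_maxl.
  by apply: mC hn; rewrite leq_maxr.
have [l [hl hs]] := noethR iU.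
have [N hN] : exists N, forall a, a \in l -> C N a.
  elim: l hl {hs} => [|a l IH] hl; first by exists 0%N.
  have [|D hD] := IH; first by move=> b hb; apply: hl; rewrite inE hb orbT.
  have [d hd] := hl a (mem_head _ _).
  exists (maxn d D) => b; rewrite inE => /orP[/eqP->|/hD h].
    by apply: mC hd; rewrite leq_maxl.
  by apply: mC h; rewrite leq_maxr.
exists N => x Cx; apply: (lspan_sub (iC N) hN); apply: hs; by exists N.+1.
Qed.

(** A bad ideal [J] is proper and not prime, so [J] contains some a b with a and b outside. If J +
    (a) and J + (b) were both good, concatenating their lists would make [J] good, because (J +
    (a))(J + (b)) lies in [J]. So every bad ideal lies strictly in another bad one, and dependent
    choice gives an infinite strict chain. *)
Lemma prime_product I : is_ideal I ->
  exists Qs, (forall Q, List.In Q Qs -> is_prime_ideal Q /\ forall x, I x -> Q x)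
    /\ forall x, prods Qs x -> I x.
Proof.
pose good J := exists Qs,
  (forall Q, List.In Q Qs -> is_prime_ideal Q /\ forall x, J x -> Q x)
    /\ forall x, prods Qs x -> J x.
move=> iI; apply: NNPP => badI; rewrite -/(good I) in badI.
pose T := {J : R -> Prop | is_ideal J /\ ~ good J}.
have step (J : T) : exists J' : T,
    (forall x, sval J x -> sval J' x) /\ ~ (forall x, sval J' x -> sval J x).
  case: J => J [iJ bJ] /=.
  have n1 : ~ J 1 by move=> J1; apply: bJ; exists [::]; split=> // x ->.
  have [a [b [Jab nJa nJb]]] : exists a b, [/\ J (a * b), ~ J a & ~ J b].
    apply: NNPP => h; apply: bJ; exists [:: J]; split; last first.
      by move=> x [a [y [Ja -> ->]]]; rewrite mulr1.
    move=> Q [<-|[]]; split=> //; split=> //; split=> // x y Jxy.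
    apply: NNPP => /not_or_and[nx ny]; apply: h; by exists x, y.
  have sub c x : J x -> ideal_adjoin J c x by exists 0; rewrite mul0r subr0.
  have memA c : ideal_adjoin J c c by exists 1; rewrite mul1r subrr; apply: ideal0.
  have [[Qs [h1 h2]]|ba] := classic (good (ideal_adjoin J a)); last first.
    exists (exist (fun J => is_ideal J /\ ~ good J) _ (conj (ideal_adjoin_ideal a iJ) ba)); split; first exact: sub.
    by move=> h; exact: (nJa (h _ (memA a))).
  have [[Qs' [h1' h2']]|bb] := classic (good (ideal_adjoin J b)); last first.
    exists (exist (fun J => is_ideal J /\ ~ good J) _ (conj (ideal_adjoin_ideal b iJ) bb)); split; first exact: sub.
    by move=> h; exact: (nJb (h _ (memA b))).
  case: bJ; exists (Qs ++ Qs'); split.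
    move=> Q hQ; case: (List.in_app_or _ _ _ hQ) => [/h1|/h1'] [pQ sQ]; split=> // x Jx.
      by apply/sQ/sub.
    by apply/sQ/sub.
  move=> x /prods_cat[y [z [/h2 [c hc] /h2' [d hd] ->]]].
  have -> : y * z = (y - c * a) * z + (c * a) * (z - d * b) + c * d * (a * b) by ring.
  apply: idealD => //; last exact: idealMl.
  by apply: idealD => //; [exact: idealMr|exact: idealMl].
pose next J := sval (constructive_indefinite_description _ (step J)).
have nextP J : (forall x, sval J x -> sval (next J) x) /\
    ~ (forall x, sval (next J) x -> sval J x).
  by rewrite /next; case: constructive_indefinite_description.
pose C n : T := iter n next (exist _ I (conj iI badI)).
have [|n x|n hn] := @noetherian_chain (fun n => sval (C n)).
- by move=> n; case: (C n) => J [].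
- by case: (nextP (C n)) => h _; apply: h.
- by case: (nextP (C n)) => _; apply.
Qed.

End PrimeProducts.

Section HeightOne.
Variable A : idomainType.
Hypothesis noethA : noetherian A.

Definition multiple (R : comNzRingType) (a x : R) := exists c, x = c * a.

Lemma multiple_ideal (R : comNzRingType) (a : R) : is_ideal (multiple a).
Proof.
split; first by exists 0; rewrite mul0r.
split=> [x y [c ->] [d ->]|b x [c ->]]; first by exists (c + d); rewrite mulrDl.
by exists (b * c); rewrite mulrA.
Qed.

Lemma multiple_id (R : comNzRingType) (a : R) : multiple a a.
Proof. by exists 1; rewrite mul1r. Qed.

Lemma multiple_sub (R : comNzRingType) (a x : R) (I : R -> Prop) :
  is_ideal I -> I a -> multiple a x -> I x.
Proof. by move=> iI Ia [c ->]; apply: idealMl. Qed.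

Lemma height_one_eq (P Q : A -> Prop) a : is_height_one_prime P -> is_prime_ideal Q ->
  (forall x, Q x -> P x) -> Q a -> a <> 0 -> forall x, P x -> Q x.
Proof.
case=> _ [_ hP] pQ sQ Qa na x Px.
by case: (hP Q pQ sQ) => h; [case: na; apply/h | apply/h].
Qed.

(** A prime containing [a] contains a product of primes lying over [a], hence one of them; height
    one turns this inclusion into an equality. *)
Lemma height_one_finite (a : A) : a <> 0 ->
  exists L : seq (A -> Prop), forall P, is_height_one_prime P -> P a ->
    exists J, List.In J L /\ same_set P J.
Proof.
move=> na; have [Qs [h1 h2]] := prime_product noethA (multiple_ideal a).
exists Qs => P hP Pa; have [pP _] := hP; have [iP _] := pP.
have [|Q [inQ sQ]] := @prime_prods _ P Qs pP.
  by move=> x /h2; apply: multiple_sub.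
exists Q; split=> // x; split; last exact: sQ.
by have [pQ hQ] := h1 _ inQ; apply: (height_one_eq hP pQ sQ _ na); apply/hQ/multiple_id.
Qed.

(** In the local ring at [P] the maximal ideal is nilpotent modulo [q]. In a product of primes
    contained in (q), the factors inside [P] equal [P] and give the power of [z]; each other factor
    has an element outside [P], and [s] is the product of these. *)
Lemma height_one_local (P : A -> Prop) (q : A) : is_height_one_prime P -> P q -> q <> 0 ->
  exists s m, ~ P s /\ forall z, P z -> multiple q (s * z ^+ m).
Proof.
move=> hP Pq nq; have [Qs [h1 h2]] := prime_product noethA (multiple_ideal q).
have [pP _] := hP; have [iP [n1 _]] := pP.
suff [s [m [ns hs]]] : exists s m, ~ P s /\ forall z, P z -> prods Qs (s * z ^+ m).
  by exists s, m; split=> // z /hs/h2.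
elim: Qs h1 {h2} => [|Q Qs IH] h1; first by exists 1, 0%N; split=> // z _; rewrite mul1r.
have [|s [m [ns hs]]] := IH; first by move=> Q' hQ'; apply: h1; right.
have [sQ|/not_subset[b [Qb nPb]]] := classic (forall x, Q x -> P x).
  have [|pQ hQ] := h1 Q; first by left.
  exists s, m.+1; split=> // z Pz; exists z, (s * z ^+ m); split.
  - by apply: (height_one_eq hP pQ sQ _ nq) => //; apply/hQ/multiple_id.
  - exact: hs.
  - by rewrite exprS mulrCA.
exists (b * s), m; split; first by case/(primeM pP).
by move=> z Pz; exists b, (s * z ^+ m); rewrite mulrA; split=> //; apply: hs.
Qed.

End HeightOne.

(** * Factorial rings *)

Lemma nat_min (Q : nat -> Prop) : (exists n, Q n) -> exists n, Q n /\ forall m, (m < n)%N -> ~ Q m.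
Proof.
case=> n; elim: n {-2}n (leqnn n) => [|N IH] n le_nN Qn.
  by exists n; split=> // m; move: le_nN; rewrite leqn0 => /eqP->.
have [[m [lt_mn Qm]]|h] := classic (exists m, (m < n)%N /\ Q m).
  by apply: (IH m) => //; rewrite -ltnS (leq_trans lt_mn).
by exists n; split=> // m lt_mn Qm; apply: h; exists m.
Qed.

Section PolyIdeals.
Variable R : comNzRingType.
Implicit Types (P : R -> Prop).

Definition coef_in P (p : {poly R}) : Prop := forall i, P p`_i.

Lemma coef_in_ideal P : is_ideal P -> is_ideal (coef_in P).
Proof.
move=> iP; split; first by move=> i; rewrite coef0; apply: ideal0.
split=> [p q hp hq|p q hq] i; first by rewrite coefD; apply: idealD.
by rewrite coefM; apply: ideal_sum => // j _; apply: idealMl.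
Qed.

(** If [i] and [j] are the first indices of coefficients outside [P], the coefficient of the product
    at i + j has exactly one term outside [P]. *)
Lemma coef_in_prime P : is_prime_ideal P -> is_prime_ideal (coef_in P).
Proof.
move=> pP; have [iP [n1 _]] := pP; split; first exact: coef_in_ideal.
split; first by move/(_ 0%N); rewrite coefC.
move=> p q hpq; apply: NNPP => /not_or_and[/not_all_ex_not np /not_all_ex_not nq].
have [i [npi hi]] := nat_min np; have [j [nqj hj]] := nat_min nq.
have [] // : P p`_i \/ P q`_j.
apply: (primeM pP); move: (hpq (i + j)%N); rewrite coefM.
have lti : (i < (i + j).+1)%N by rewrite ltnS leq_addr.
rewrite (bigD1 (Ordinal lti)) //= addKn => h; apply: idealDr h => //.
apply: ideal_sum => // k; rewrite -val_eqE /= => nki.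
have [lt_ki|le_ik] := ltnP k i; first by apply: idealMr => //; apply: NNPP => /(hi _ lt_ki).
apply: idealMl => //; apply: NNPP; apply: hj.
by move: nki le_ik (ltn_ord k); lia.
Qed.

End PolyIdeals.

Section Factorial.
Variable R : idomainType.
Implicit Types (a b c p u : R) (s : seq R).

Definition is_unit (S : comNzRingType) (u : S) := exists v, v * u = 1.

Definition prime_elt (p : R) := p <> 0 /\ is_prime_ideal (multiple p).

Definition factors a := exists u s,
  [/\ is_unit u, forall p, p \in s -> prime_elt p & a = u * \prod_(p <- s) p].

Definition factorial := forall a, a <> 0 -> factors a.

Lemma factorsM a b : factors a -> factors b -> factors (a * b).
Proof.
move=> [u [s [[u' hu] hs ->]]] [v [t [[v' hv] ht ->]]]; exists (u * v), (s ++ t).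
split; last by rewrite big_cat /=; ring.
  by exists (u' * v'); rewrite mulrACA hu hv mulr1.
by move=> p; rewrite mem_cat => /orP[/hs|/ht].
Qed.

Lemma factors_unit u : is_unit u -> factors u.
Proof. by move=> uu; exists u, [::]; rewrite big_nil mulr1. Qed.

Lemma factors_prime p : prime_elt p -> factors p.
Proof.
move=> pp; exists 1, [:: p]; rewrite big_seq1 mul1r; split=> //.
  by exists 1; rewrite mulr1.
by move=> q; rewrite inE => /eqP->.
Qed.

Lemma prime_elt_Nunit p : prime_elt p -> ~ is_unit p.
Proof. by case=> _ [_ [h _]] [v hv]; apply: h; exists v. Qed.

Lemma prime_elt_prod p s : prime_elt p -> multiple p (\prod_(q <- s) q) ->
  exists2 q, q \in s & multiple p q.
Proof.
case=> _ pp; elim: s => [|a s IH]; first by rewrite big_nil; case: pp => _ [].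
rewrite big_cons => /(primeM pp)[h|/IH[q qs hq]]; first by exists a; rewrite ?mem_head.
by exists q => //; rewrite inE qs orbT.
Qed.

Lemma prime_elt_unitM p u a : prime_elt p -> is_unit u -> multiple p (u * a) -> multiple p a.
Proof.
move=> pp [v hv] h; rewrite -(mul1r a) -hv -mulrA.
by apply: idealMl => //; apply: multiple_ideal.
Qed.

Lemma prime_elt_assoc p q : prime_elt p -> prime_elt q -> multiple p q -> multiple q p.
Proof.
move=> [np pp] [nq pq] [c eqc].
have [||//] := primeM pq (x := c) (y := p); first by rewrite -eqc; apply: multiple_id.
case=> d ed; case: (prime_elt_Nunit (conj np pp)); exists d.
apply/(mulIf (x := q)); first exact/eqP.
by rewrite mul1r {2}eqc ed; ring.
Qed.

End Factorial.

Section FactorialPoly.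
Variable R : idomainType.
Hypothesis facR : factorial R.
Implicit Types (p q : {poly R}).

Lemma multiple_polyC (a : R) p : multiple a%:P p <-> coef_in (multiple a) p.
Proof.
split=> [[c ->] i|h]; first by rewrite coefMC; exists c`_i.
pose c i := sval (constructive_indefinite_description _ (h i)).
have hc i : p`_i = c i * a.
  by rewrite /c; case: constructive_indefinite_description.
exists (\poly_(i < size p) c i); apply/polyP => i; rewrite coefMC coef_poly.
by case: ltnP => [_|le]; [rewrite hc | rewrite nth_default ?mul0r].
Qed.

Lemma prime_elt_polyC (a : R) : prime_elt a -> prime_elt a%:P.
Proof.
case=> na pa; split; first by move/eqP; rewrite polyC_eq0 => /eqP.
have [_ [n1 hM]] := coef_in_prime pa.
split; first exact: multiple_ideal.
split; first by move/multiple_polyC.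
by move=> x y /multiple_polyC/hM[]/multiple_polyC; [left|right].
Qed.

Definition no_const_factor p := forall a : R, prime_elt a -> ~ multiple a%:P p.

(** The prime factors of [c] are cancelled one at a time: each stays prime in R[X] and does not
    divide [p], so it divides [h]. *)
Lemma const_cancel (c : R) p g h : c <> 0 -> no_const_factor p -> c%:P * g = h * p ->
  exists h', h = c%:P * h' /\ g = h' * p.
Proof.
move=> nc np; have [u [s [[v uv] hs ec]]] := facR nc.
rewrite ec; elim: s {nc ec} hs g h => [|a s IH] hs g h.
  rewrite big_nil mulr1 => e; exists (v%:P * h).
  by split; [rewrite mulrA -rmorphM /= [u * v]mulrC uv mul1r
            |rewrite -mulrA -e mulrA -rmorphM /= uv mul1r].
have pa := hs a (mem_head _ _); rewrite big_cons mulrCA.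
set x := u * _; rewrite rmorphM /= -mulrA => e.
have [na ppa] := prime_elt_polyC pa.
have [|[h1 eh]|] := primeM ppa (x := h) (y := p).
- by rewrite -e; exists (x%:P * g); rewrite mulrC.
- have [||h' [e1 e2]] := IH _ g h1.
  + by move=> q qs; apply: hs; rewrite inE qs orbT.
  + by apply: (mulfI (x := a%:P)); [exact/eqP|rewrite e eh; ring].
  + by exists h'; rewrite eh e1 -/x; split=> //; ring.
- by move/np.
Qed.

(** A factorization over the fraction field descends to R: each prime factor of [c] divides [a] or
    [b], and dividing by it leaves the sizes alone. *)
Lemma const_split (c : R) p a b : c <> 0 -> c%:P * p = a * b ->
  exists a' b', [/\ p = a' * b', size a' = size a & size b' = size b].
Proof.
move=> nc; have [u [s [[v uv] hs ec]]] := facR nc.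
have nv : v != 0 by apply/eqP => v0; move: uv; rewrite v0 mul0r => /eqP; rewrite eq_sym oner_eq0.
rewrite ec; elim: s {nc ec} hs a b => [|q s IH] hs a b.
  rewrite big_nil mulr1 => e; exists (v%:P * a), b.
  by rewrite -mulrA -e mulrA -rmorphM /= uv mul1r mul_polyC size_scale.
have pa := hs q (mem_head _ _); rewrite big_cons mulrCA.
set x := u * _; rewrite rmorphM /= -mulrA => e.
have [na ppa] := prime_elt_polyC pa; have nq : q != 0 by case: pa => /eqP.
have hs' z : z \in s -> prime_elt z by move=> zs; apply: hs; rewrite inE zs orbT.
have [|[h1 eh]|[h1 eh]] := primeM ppa (x := a) (y := b).
- by rewrite -e; exists (x%:P * p); rewrite mulrC.
- have [|a' [b' [-> e1 e2]]] := IH hs' h1 b.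
    by apply: (mulfI (x := q%:P)); [exact/eqP|rewrite e eh; ring].
  by exists a', b'; rewrite e1 e2 eh [_ * q%:P]mulrC mul_polyC size_scale.
- have [|a' [b' [-> e2 e1]]] := IH hs' a h1.
    by apply: (mulfI (x := q%:P)); [exact/eqP|rewrite e eh; ring].
  by exists a', b'; rewrite e1 e2 eh [_ * q%:P]mulrC mul_polyC size_scale.
Qed.

Lemma primitive_irreducible_prime p : no_const_factor p -> (1 < size p)%N ->
  (forall a b, p = a * b -> (size a <= 1)%N \/ (size b <= 1)%N) -> prime_elt p.
Proof.
move=> np sp hp; have p0 : p != 0 by rewrite -size_poly_gt0 ltnW.
(* Over a domain [%|] is divisibility up to a nonzero constant, so this is irreducibility over the
   fraction field. *)
have irr : irreducible_poly p.
  split=> // q sq /Pdiv.Idomain.dvdpP[[c a] /= nc e].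
  have [a' [b' [e' sa sb]]] := const_split (elimN eqP nc) (etrans (mul_polyC c p) e).
  have nz : a * q != 0 by rewrite -e -mul_polyC mulf_neq0 // polyC_eq0.
  move: nz; rewrite mulf_eq0 negb_or => /andP[na nq].
  have sa1 : size a = 1%N.
    have [|] := hp _ _ e'; rewrite ?sa ?sb => h.
      by apply/eqP; rewrite eqn_leq h size_poly_gt0.
    by move: sq; rewrite eqn_leq h size_poly_gt0 nq.
  rewrite /eqp; apply/andP; split; apply/Pdiv.Idomain.dvdpP.
    by exists (c, a) => //=.
  exists (a`_0, c%:P) => /=.
    by rewrite -[0%N]/(1.-1)%N -sa1 -lead_coefE lead_coef_eq0.
  by rewrite -mul_polyC -size1_polyC ?sa1 // -e mul_polyC.
split; first exact/eqP.
split; first exact: multiple_ideal.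
split=> [[c /(congr1 (fun x : {poly R} => size x))]|x y [c e]].
  rewrite size_poly1; have [->|nc] := eqVneq c 0; first by rewrite mul0r size_poly0.
  rewrite size_mul // => e; move: (size_poly_gt0 c); rewrite nc.
  by case: (size c) e sp => // n; case: (size p) => [|[|m]] //; rewrite !addnS /=.
have dv : p %| x * y by apply/Pdiv.Idomain.dvdpP; exists (1, c); rewrite ?oner_eq0 ?scale1r.
have fin z : p %| z -> multiple p z.
  case/Pdiv.Idomain.dvdpP=> [[d h] /= nd eh].
  have [|h' [_ ->]] := const_cancel (elimN eqP nd) np (g := z) (h := h).
    by rewrite mul_polyC.
  by exists h'.
have [/fin|ndv] := boolP (p %| x); first by left.
right; apply: fin; rewrite -(@Gauss_dvdpr _ y x) //.
rewrite /coprimep; apply: contraR ndv => sg.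
have := irr.2 _ sg (dvdp_gcdl _ _).
by move/eqp_dvdl => <-; apply: dvdp_gcdr.
Qed.

Lemma is_unit_polyC (u : R) : is_unit u -> is_unit u%:P.
Proof. by case=> v h; exists v%:P; rewrite -rmorphM /= h. Qed.

Lemma factors_primitive p : p <> 0 -> no_const_factor p ->
  (forall a : {poly R}, (size a < size p)%N -> a <> 0 -> factors a) -> factors p.
Proof.
move=> np nc IH; have [sp1|sp1] := leqP (size p) 1.
  rewrite (size1_polyC sp1) in np nc *; apply: factors_unit; apply: is_unit_polyC.
  have [|u [s [uu hs e]]] := facR (a := p`_0); first by move=> p0; apply: np; rewrite p0.
  case: s hs e => [|b s] hs e; first by rewrite e big_nil mulr1.
  case: (nc b (hs _ (mem_head _ _))); rewrite e big_cons.
  by exists (u * \prod_(j <- s) j)%:P; rewrite -rmorphM /=; congr (_%:P); ring.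
have [[a [b [ep sa sb]]]|irr] :=
    classic (exists a b, [/\ p = a * b, (1 < size a)%N & (1 < size b)%N]).
  have na : a != 0 by rewrite -size_poly_gt0 ltnW.
  have nb : b != 0 by rewrite -size_poly_gt0 ltnW.
  have sab : size p = (size a + size b).-1 by rewrite ep size_mul.
  by rewrite ep; apply: factorsM; apply: IH; try exact/eqP; lia.
apply: factors_prime; apply: primitive_irreducible_prime => // a b ep.
by apply: NNPP => /not_or_and[/negP sa /negP sb]; apply: irr; exists a, b; split=> //; lia.
Qed.

Theorem factorial_poly : factorial {poly R}.
Proof.
move=> p; elim: {p}(size p).+1 {-2}p (ltnSn (size p)) => // n IHn p; rewrite ltnS => sp np.
have nlc : lead_coef p <> 0 by apply/eqP; rewrite lead_coef_eq0; apply/eqP.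
have [u [s [uu hs elc]]] := facR nlc.
(* Inner induction on the number of primes in the leading coefficient: dividing [p] by a constant
   prime removes one of them. This extracts the content without gcds, since a constant prime factor
   of [p] is associate to one of the list. *)
elim: {s}(size s).+1 {-2}s (ltnSn (size s)) hs p elc np nlc sp => // m IHm s.
rewrite ltnS => ss hs p elc np nlc sp.
have [[a as_ [p1 ep]]|hno] := classic (exists2 a, a \in s & multiple a%:P p).
  have pa := hs _ as_; have pA := prime_elt_polyC pa.
  have na : a != 0 by apply/eqP; case: pa.
  have np1 : p1 <> 0 by move=> p10; apply: np; rewrite ep p10 mul0r.
  rewrite ep; apply: factorsM; last exact: factors_prime.
  apply: (IHm (rem a s)) => //.
  - by rewrite size_rem //; case: (s) ss as_.
  - by move=> q /mem_rem; apply: hs.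
  - apply: (mulIf (x := a)) => //.
    rewrite -[X in _ * X](lead_coefC a) -lead_coefM -ep elc.
    by rewrite (perm_big _ (perm_to_rem as_)) big_cons /=; ring.
  - by apply/eqP; rewrite lead_coef_eq0; apply/eqP.
  - by move: sp; rewrite ep mulrC mul_polyC size_scale.
apply: factors_primitive => // [a pa hap|a sa]; last first.
  by apply: IHn; apply: leq_trans sp.
apply: hno; have : multiple a (lead_coef p) by move/multiple_polyC: hap; apply.
rewrite elc => /(prime_elt_unitM pa uu)/(prime_elt_prod pa)[b bs hb].
exists b => //; case: hap => d ->; case: (prime_elt_assoc pa (hs _ bs) hb) => e ->.
by exists (d * e%:P); rewrite rmorphM /= mulrA.
Qed.

End FactorialPoly.

Lemma factorial_iso (R S : idomainType) (phi : {rmorphism R -> S}) (psi : {rmorphism S -> R}) :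
  cancel phi psi -> cancel psi phi -> factorial R -> factorial S.
Proof.
move=> phiK psiK facR a na.
have prime_phi p : prime_elt p -> prime_elt (phi p).
  have mp x : multiple (phi p) x <-> multiple p (psi x).
    split=> [[c ->]|[c e]]; first by exists (psi c); rewrite rmorphM phiK.
    by exists (phi c); rewrite -rmorphM -e psiK.
  case=> np [_ [n1 hM]]; split.
    by move=> p0; apply: np; rewrite -(phiK p) p0 rmorph0.
  split; first exact: multiple_ideal.
  split=> [/mp|x y /mp]; first by rewrite rmorph1.
  by rewrite rmorphM => /hM[]/mp; [left|right].
have [|u [s [[v hu] hs e]]] := facR (psi a).
  by move=> p0; apply: na; rewrite -(psiK a) p0 rmorph0.
exists (phi u), (map phi s); split.
- by exists (phi v); rewrite -rmorphM hu rmorph1.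
- by move=> q /mapP[p /hs ps ->]; apply: prime_phi.
- by rewrite big_map -rmorph_prod -rmorphM -e psiK.
Qed.

Section MPoly.

Lemma mpoly_gen_ind (n : nat) (k : comNzRingType) (P : {mpoly k[n]} -> Prop) :
  (forall c, P c%:MP) -> (forall i, P 'X_i) -> (forall p q, P p -> P q -> P (p + q)) ->
  (forall p q, P p -> P q -> P (p * q)) -> forall p, P p.
Proof.
move=> hC hX hD hM; elim/mpolyind => [|c m p _ _ Pp]; first by rewrite -mpolyC0.
apply: (hD) => //; rewrite -mul_mpolyC; apply: (hM) => //.
rewrite mpolyXE_id; apply: (big_ind P) => //; first by rewrite -mpolyC1.
move=> i _; elim: (m i) => [|j IH]; first by rewrite expr0 -mpolyC1.
by rewrite exprS; apply: hM.
Qed.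

Definition meval_mor (n : nat) (k S : comNzRingType) (phi : {rmorphism k -> S}) (h : 'I_n -> S) :
  {rmorphism {mpoly k[n]} -> S} := mmap phi h.

Lemma meval_morC (n : nat) (k S : comNzRingType) (phi : {rmorphism k -> S}) (h : 'I_n -> S) c :
  meval_mor phi h c%:MP = phi c.
Proof. exact: mmapC. Qed.

Lemma meval_morX (n : nat) (k S : comNzRingType) (phi : {rmorphism k -> S}) (h : 'I_n -> S) i :
  meval_mor phi h 'X_i = h i.
Proof. by rewrite /meval_mor /= mmapX mmap1U. Qed.

Lemma mpoly_mor_eq (n : nat) (k S : comNzRingType) (f g : {rmorphism {mpoly k[n]} -> S}) :
  (forall c, f c%:MP = g c%:MP) -> (forall i, f 'X_i = g 'X_i) -> f =1 g.
Proof.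
move=> hC hX; elim/mpoly_gen_ind => // p q; first by rewrite !rmorphD => -> ->.
by rewrite !rmorphM => -> ->.
Qed.

Lemma poly_mor_eq (R S : comNzRingType) (f g : {rmorphism {poly R} -> S}) :
  (forall c, f c%:P = g c%:P) -> f 'X = g 'X -> f =1 g.
Proof.
move=> hC hX; elim/poly_ind => [|p c IH]; first by rewrite !rmorph0.
by rewrite !rmorphD !rmorphM hC hX IH.
Qed.

(* The unbundled forms avoid unification problems between bundled compositions. *)
Lemma mpoly_tri_eq (n : nat) (k S T : comNzRingType) (f : {rmorphism {mpoly k[n]} -> S})
    (g : {rmorphism S -> T}) (h : {rmorphism {mpoly k[n]} -> T}) :
  (forall c, g (f c%:MP) = h c%:MP) -> (forall i, g (f 'X_i) = h 'X_i) ->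
  forall p, g (f p) = h p.
Proof.
move=> hC hX; elim/mpoly_gen_ind => // p q; first by rewrite !rmorphD => -> ->.
by rewrite !rmorphM => -> ->.
Qed.

Lemma poly_tri_eq (R S T : comNzRingType) (f : {rmorphism {poly R} -> S})
    (g : {rmorphism S -> T}) (h : {rmorphism {poly R} -> T}) :
  (forall c, g (f c%:P) = h c%:P) -> g (f 'X) = h 'X -> forall p, g (f p) = h p.
Proof.
move=> hC hX; elim/poly_ind => [|p c IH]; first by rewrite !rmorph0.
by rewrite !rmorphD !rmorphM hC hX IH.
Qed.

Lemma poly_sq_eq (R S S' T : comNzRingType) (f : {rmorphism {poly R} -> S})
    (g : {rmorphism S -> T}) (f' : {rmorphism {poly R} -> S'}) (g' : {rmorphism S' -> T}) :
  (forall c, g (f c%:P) = g' (f' c%:P)) -> g (f 'X) = g' (f' 'X) ->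
  forall p, g (f p) = g' (f' p).
Proof.
move=> hC hX; elim/poly_ind => [|p c IH]; first by rewrite !rmorph0.
by rewrite !rmorphD !rmorphM hC hX IH.
Qed.

Section Recursion.
Variables (k : comNzRingType) (n : nat).
Let C := mpolyC n.+1 (R := k) : {rmorphism k -> {mpoly k[n.+1]}}.
Let CP := polyC \o (mpolyC n (R := k)) : {rmorphism k -> {poly {mpoly k[n]}}}.

Definition mpoly_widen := meval_mor C (fun i : 'I_n => 'X_(lift ord_max i)).

Definition mpoly_of_poly := hmorph mpoly_widen 'X_ord_max.

Definition poly_of_mpoly := meval_mor CP (fun i : 'I_n.+1 =>
  if unlift ord_max i is Some j then ('X_j)%:P else 'X).

Lemma mpoly_of_polyK : cancel mpoly_of_poly poly_of_mpoly.
Proof.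
apply: (poly_mor_eq (f := poly_of_mpoly \o mpoly_of_poly) (g := idfun)) => /=.
  move=> c; rewrite /mpoly_of_poly hmorphC.
  apply: (mpoly_mor_eq (f := poly_of_mpoly \o mpoly_widen) (g := polyC)) => /= [a|i].
    by rewrite /mpoly_widen meval_morC /= /poly_of_mpoly meval_morC.
  by rewrite /mpoly_widen meval_morX /poly_of_mpoly meval_morX liftK.
by rewrite /mpoly_of_poly hmorphX /poly_of_mpoly meval_morX unlift_none.
Qed.

Lemma poly_of_mpolyK : cancel poly_of_mpoly mpoly_of_poly.
Proof.
apply: (mpoly_mor_eq (f := mpoly_of_poly \o poly_of_mpoly) (g := idfun)) => /= [c|i].
  by rewrite /poly_of_mpoly meval_morC /mpoly_of_poly /= hmorphC /mpoly_widen meval_morC.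
rewrite /poly_of_mpoly meval_morX; case: unliftP => [j ->|->].
  by rewrite /mpoly_of_poly hmorphC /mpoly_widen meval_morX.
by rewrite /mpoly_of_poly hmorphX.
Qed.

End Recursion.

Theorem factorial_mpoly (k : fieldType) n : factorial {mpoly k[n]}.
Proof.
elim: n => [|n IH].
  move=> p np; apply: factors_unit; have e : p = (p@_0%MM)%:MP.
    apply/mpolyP => m; rewrite mcoeffC.
    by have -> : m = 0%MM by [apply/mnmP; case]; rewrite eqxx mulr1.
  exists (p@_0%MM)^-1%:MP; rewrite {2}e -mpolyCM mulVf //.
  by apply/eqP => p0; apply: np; rewrite e p0.
apply: (factorial_iso (@mpoly_of_polyK k n) (@poly_of_mpolyK k n)).
exact: factorial_poly.
Qed.

End MPoly.

(** * Filtrations, Gauss's lemma and traces of idempotents *)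

Section Filtrations.

(** [w m a] reads: a has degree at most m. A relation rather than a degree function lets 0 belong to
    every level, negative ones included. *)
Record filtration (S : comNzRingType) := Filtration {
  fw :> int -> S -> Prop;
  fw0 : forall m, fw m 0;
  fw1 : fw 0 1;
  fwN : forall m a, fw m a -> fw m (- a);
  fwD : forall m a b, fw m a -> fw m b -> fw m (a + b);
  fwM : forall m m' a b, fw m a -> fw m' b -> fw (m + m') (a * b);
  fw_le : forall m m' a, m <= m' -> fw m a -> fw m' a }.

Variable S : comNzRingType.
Variable w : filtration S.

Lemma fw_sum m (T : Type) (r : seq T) (Q : pred T) (F : T -> S) :
  (forall i, Q i -> w m (F i)) -> w m (\sum_(i <- r | Q i) F i).
Proof. by move=> h; apply: big_ind => //; [exact: fw0 | exact: fwD]. Qed.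

Lemma fwB m a b : w m a -> w m b -> w m (a - b).
Proof. by move=> ha hb; apply: fwD => //; apply: fwN. Qed.

Lemma fw_prod (T : Type) (r : seq T) (F : T -> S) (f : T -> int) :
  (forall i, w (f i) (F i)) -> w (\sum_(i <- r) f i) (\prod_(i <- r) F i).
Proof.
move=> h; elim: r => [|a r IH]; first by rewrite !big_nil; apply: fw1.
by rewrite !big_cons; apply: fwM.
Qed.

Lemma fwX m a n : w m a -> w (m * n%:Z) (a ^+ n).
Proof.
move=> h; elim: n => [|n IH]; first by rewrite mulr0 expr0; apply: fw1.
by rewrite exprS intS mulrDr mulr1; apply: fwM.
Qed.

Lemma fw_eq m m' a : m = m' -> w m a -> w m' a. Proof. by move->. Qed.

(** Along a permutation the offsets [t] cancel, so every term of the Leibniz expansion has the same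
    bound. *)
Lemma fw_det (N : nat) (A : 'M[S]_N) (s : int) (t : 'I_N -> int) :
  (forall a b, w (s + t b - t a) (A a b)) -> w (N%:Z * s) (\det A).
Proof.
move=> h; apply: fw_sum => /= g _.
apply: (fw_eq (m := 0 + N%:Z * s)); first by rewrite add0r.
apply: fwM.
  by case: (odd_perm g); rewrite ?expr0 ?expr1; [apply: fwN|]; apply: fw1.
apply: (@fw_eq (\sum_(i < N) (s + t (g i) - t i))); last by apply: fw_prod => i; apply: h.
rewrite sumrB big_split /= [X in _ + X - _](_ : _ = \sum_i t i); last first.
  by rewrite [RHS](reindex_inj (@perm_inj _ g)).
by rewrite addrK sumr_const card_ord -mulr_natl natz.
Qed.

(** The weighted degree on S[X] for which X has weight [kap]. *)
Definition poly_fw (kap : int) (m : int) (u : {poly S}) :=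
  forall i, w (m - kap * i%:Z) u`_i.

Lemma poly_fw0 kap m : poly_fw kap m 0.
Proof. by move=> i; rewrite coef0; apply: fw0. Qed.

Lemma poly_fw1 kap : poly_fw kap 0 1.
Proof.
move=> i; rewrite coef1; case: i => [|i]; first by rewrite mulr0 subr0; apply: fw1.
exact: fw0.
Qed.

Lemma poly_fwN kap m a : poly_fw kap m a -> poly_fw kap m (- a).
Proof. by move=> h i; rewrite coefN; apply: fwN. Qed.

Lemma poly_fwD kap m a b : poly_fw kap m a -> poly_fw kap m b -> poly_fw kap m (a + b).
Proof. by move=> h h' i; rewrite coefD; apply: fwD. Qed.

Lemma poly_fwM kap m m' a b :
  poly_fw kap m a -> poly_fw kap m' b -> poly_fw kap (m + m') (a * b).
Proof.
move=> h h' i; rewrite coefM; apply: fw_sum => j _.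
apply: fw_eq (fwM (h j) (h' (i - j)%N)).
by rewrite -subzn; [ring | rewrite -ltnS].
Qed.

Lemma poly_fw_le kap m m' a : m <= m' -> poly_fw kap m a -> poly_fw kap m' a.
Proof. by move=> lem h i; apply: fw_le (h i); rewrite lerD2r. Qed.

Definition poly_filt kap : filtration {poly S} :=
  Filtration (@poly_fw0 kap) (@poly_fw1 kap) (@poly_fwN kap) (@poly_fwD kap)
    (@poly_fwM kap) (@poly_fw_le kap).

Lemma poly_fwC kap m a : w m a -> poly_filt kap m a%:P.
Proof.
move=> h i; rewrite coefC; case: i => [|i]; first by rewrite mulr0 subr0.
exact: fw0.
Qed.

Lemma poly_fwX kap : poly_filt kap kap 'X.
Proof.
move=> i; rewrite coefX; case: i => [|[|i]]; try exact: fw0.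
by rewrite mulr1 subrr; apply: fw1.
Qed.

End Filtrations.

Lemma poly_fwXn (S : comNzRingType) (w : filtration S) kap n :
  poly_filt w kap (kap * n%:Z) 'X^n.
Proof. exact: (fwX (w := poly_filt w kap) n (poly_fwX w kap)). Qed.

Arguments fw_eq {S w m m' a}.

Lemma fw_char_poly (S : comNzRingType) (w : filtration S) (N : nat) (A : 'M[S]_N)
    (s : int) (t : 'I_N -> int) :
  (forall a b, w (s + t b - t a) (A a b)) ->
  poly_filt w s (N%:Z * s) (char_poly A).
Proof.
move=> h; apply: (fw_det (w := poly_filt w s) (t := t)) => a b; rewrite !mxE.
apply: fwB; last by apply: poly_fwC.
have [->|_] := eqVneq a b; last by rewrite mulr0n; apply: fw0.
by rewrite addrK mulr1n; apply: poly_fwX.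
Qed.

Section StrictFiltration.
Variables (R : idomainType) (w : filtration R).

(** The last clause is additivity of the degree in negative form: deg a > m and deg b > m' mean at
    least m + 1 and m' + 1, so the product has degree at least m + m' + 2. *)
Definition strict :=
  [/\ ~ w (-1) 1, forall a, exists m : nat, w m%:Z a &
   forall a b m m', ~ w m a -> ~ w m' b -> ~ w (m + m' + 1) (a * b)].

Hypothesis ws : strict.
Variable s : int.
Let W := poly_filt w s.

(** Here m + 1 is the exact weighted degree of [G], and [i] the first index whose coefficient
    reaches it. The search starts at N s - 1, a level that the leading coefficient 1 excludes. *)
Local Lemma poly_fw_exact (G : {poly R}) (N : nat) : G \is monic -> size G = N.+1 ->
  exists m i, [/\ N%:Z * s - 1 <= m, W (m + 1) G, ~ w (m - s * i%:Z) G`_i &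
    forall j, (j < i)%N -> w (m - s * j%:Z) G`_j].
Proof.
move=> mG sG; case: ws => n1 hex _.
have [t [ht mint]] : exists t : nat, W (N%:Z * s - 1 + t%:Z) G
    /\ forall t', (t' < t)%N -> ~ W (N%:Z * s - 1 + t'%:Z) G.
  apply: nat_min.
  have [M hM] : exists M : nat, forall i, (i < size G)%N -> W M%:Z (G`_i *: 'X^i).
    elim: (size G) => [|n [M hM]]; first by exists 0%N.
    have [m hm] := hex G`_n; pose m' := (m + absz (s * n%:Z)%R)%N.
    exists (maxn M m') => i; rewrite ltnS leq_eqVlt => /orP[/eqP->|/hM]; last first.
      by apply: fw_le; lia.
    apply: (fw_le (m := m%:Z + s * n%:Z)); first by rewrite /m'; lia.
    by rewrite -mul_polyC; apply: fwM; [exact: poly_fwC|exact: poly_fwXn].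
  exists (M + absz (N%:Z * s - 1)%R)%N.
  apply: (fw_le (m := M%:Z)); first by lia.
  by rewrite -[G]coefK poly_def; apply: fw_sum => i _; apply: hM.
have t0 : (0 < t)%N.
  case: t ht {mint} => // /(_ N); rewrite addr0 => h.
  have e : G`_N = 1 by move/monicP: mG; rewrite /lead_coef sG.
  by case: n1; move: h; rewrite e; apply: fw_eq; ring.
have /not_all_ex_not hi : ~ W (N%:Z * s - 1 + t.-1%:Z) G by apply: mint; lia.
have [i [hi1 hi2]] := nat_min hi.
exists (N%:Z * s - 1 + t.-1%:Z), i; split=> //; first by lia.
  by apply: fw_eq ht; lia.
by move=> j /hi2 h; apply: NNPP.
Qed.

(** Neither factor has weight below that of its leading term, so an excess in [G] cannot be
    compensated by [G']: the first coefficients of top weight meet at index i + i', where all other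
    terms are smaller. *)
Lemma monic_factor_fw (G G' : {poly R}) (N N' : nat) :
  G \is monic -> size G = N.+1 -> G' \is monic -> size G' = N'.+1 ->
  W ((N + N')%:Z * s) (G * G') -> W (N%:Z * s) G.
Proof.
move=> mG sG mG' sG' hGG.
have [m [i [hm hW hi hlt]]] := poly_fw_exact mG sG.
have [m' [i' [hm' hW' hi' hlt']]] := poly_fw_exact mG' sG'.
have [le|lt] := lerP m (N%:Z * s - 1); first by apply: fw_le hW; lia.
case: ws => _ _ /(_ _ _ _ _ hi hi'); case.
have /= := hGG (i + i')%N; rewrite coefM.
have lti : (i < (i + i').+1)%N by rewrite ltnS leq_addr.
rewrite (bigD1 (Ordinal lti)) //= addKn => h.
apply: (@fw_le _ w (m + m' + 1 - s * (i + i')%:Z)); first by lia.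
set r := \sum_(k < _ | _) _ in h.
rewrite -[G`_i * _](addrK r); apply: fwB.
  by apply: fw_le h; lia.
apply: fw_sum => j; rewrite -val_eqE /= => nji.
have [lt_ji|le_ij] := ltnP j i.
  apply: fw_eq (fwM (hlt _ lt_ji) (hW' (i + i' - j)%N)).
  by rewrite -subzn; [ring | rewrite -ltnS].
have lt' : (i + i' - j < i')%N by move: nji (ltn_ord j); lia.
apply: fw_eq (fwM (hW j) (hlt' _ lt')).
by rewrite -subzn; [ring | rewrite -ltnS].
Qed.

End StrictFiltration.

Lemma frac_repr (R : idomainType) (z : {fraction R}) :
  z = tofrac (\n_(repr z)) / tofrac (\d_(repr z)).
Proof.
have nd : tofrac (\d_(repr z)) != 0 by rewrite tofrac_eq0 denom_ratioP.
apply: (mulIf nd); rewrite divfK // -{1}[z]reprK /FracField.tofrac; unlock.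
rewrite !piE; apply/eqmodP; rewrite /= FracField.equivfE /FracField.mulf.
by rewrite !numden_Ratio ?mulr1 ?oner_neq0 ?denom_ratioP // mulrC.
Qed.

(** The matrices e M and (1 - e) M have sum M and product 0, so X - e M times X - (1 - e) M is X (X
    - M); then take determinants. *)
Lemma char_poly_idempotent (S : comNzRingType) (N : nat) (M e : 'M[S]_N) :
  e *m e = e -> e *m M = M *m e ->
  char_poly (e *m M) * char_poly ((1%:M - e) *m M) = 'X ^+ N * char_poly M.
Proof.
move=> ee eM; set f := 1%:M - e.
have fM : f *m M = M *m f by rewrite mulmxBl mulmxBr mul1mx mulmx1 eM.
have PQ : (e *m M) *m (f *m M) = 0.
  rewrite fM !mulmxA eM -[M *m e *m M]mulmxA eM mulmxA -[_ *m f]mulmxA.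
  by rewrite mulmxBr mulmx1 ee subrr mulmx0.
have -> : 'X ^+ N = \det ('X%:M : 'M[{poly S}]_N) by rewrite det_scalar.
rewrite /char_poly -!det_mulmx; congr (\det _); rewrite /char_poly_mx.
set P := map_mx _ (e *m M); set Q := map_mx _ (f *m M).
have PQ0 : P *m Q = 0 by rewrite /P /Q -map_mxM PQ map_mx0.
have PQD : P + Q = map_mx polyC M by rewrite -map_mxD -mulmxDl /f addrC subrK mul1mx.
rewrite -PQD mulmxBl !mulmxBr PQ0 subr0 !mul_scalar_mx !mul_mx_scalar.
by rewrite scalerDr opprD addrA addrAC.
Qed.

Section Gauss.
Variable R : idomainType.
Hypothesis facR : factorial R.
Let K := {fraction R}.
Let phi : {rmorphism R -> K} := @FracField.tofrac R.

(** Gauss's lemma with denominators cleared. Each prime of c c' divides [h] or [h'] and is removed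
    there together with one factor of the leading coefficient; once c c' is a unit, [c] is
    invertible. *)
Local Lemma monic_descent (c c' : R) (h h' H : {poly R}) : c <> 0 -> c' <> 0 ->
  lead_coef h = c -> lead_coef h' = c' -> h * h' = (c * c')%:P * H ->
  exists g, h = c%:P * g.
Proof.
move=> nc nc'; have ncc : c * c' <> 0 by apply/eqP; rewrite mulf_neq0 //; apply/eqP.
have [u [s [[v uv] hs ec]]] := facR ncc.
clear ncc; elim: s c c' nc nc' h h' ec hs => [|a s IH] c c' nc nc' h h' ec hs lh lh' e.
  exists ((v * c')%:P * h); rewrite mulrA -rmorphM /=.
  have -> : c * (v * c') = v * (c * c') by ring.
  by rewrite ec big_nil mulr1 uv polyC1 mul1r.
have pa := hs a (mem_head _ _); have na : a != 0 by case: pa => /eqP.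
have [_ ppa] := prime_elt_polyC pa.
have hs' z : z \in s -> prime_elt z by move=> zs; apply: hs; rewrite inE zs orbT.
have [|[h1 eh]|[h1 eh]] := primeM ppa (x := h) (y := h').
- rewrite e ec big_cons; exists ((u * \prod_(j <- s) j)%:P * H).
  by rewrite mulrCA rmorphM /=; ring.
- have ec1 : c = a * lead_coef h1 by rewrite -lh eh lead_coefM lead_coefC mulrC.
  have [|||||g eg] := IH (lead_coef h1) c' _ _ h1 h' _ hs' _ lh'.
  + by move=> l0; apply: nc; rewrite ec1 l0 mulr0.
  + by [].
  + by apply: (mulfI na); rewrite mulrA -ec1 ec big_cons; ring.
  + by [].
  + apply: (mulfI (x := a%:P)); first by rewrite polyC_eq0.
    by rewrite !mulrA -rmorphM mulrA -ec1 -e eh; ring.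
  exists g; rewrite eh ec1 {1}eg rmorphM /=; ring.
- have ec1 : c' = a * lead_coef h1 by rewrite -lh' eh lead_coefM lead_coefC mulrC.
  apply: (IH c (lead_coef h1) nc _ h h1 _ hs' lh) => //.
  + by move=> l0; apply: nc'; rewrite ec1 l0 mulr0.
  + by apply: (mulfI na); rewrite mulrCA -ec1 ec big_cons; ring.
  + apply: (mulfI (x := a%:P)); first by rewrite polyC_eq0.
    by rewrite !mulrA -rmorphM mulrCA -ec1 -e eh; ring.
Qed.

Lemma phi_inj : injective phi.
Proof. by move=> x y /eqP; rewrite tofrac_eq => /eqP. Qed.

Lemma clear_denominators (G : {poly K}) :
  exists c h, c <> 0 /\ phi c *: G = map_poly phi h.
Proof.
elim/poly_ind: G => [|G z [c [h [nc e]]]].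
  exists 1, 0; split; first by apply/eqP; rewrite oner_neq0.
  by rewrite scaler0 rmorph0.
set n := \n_(repr z); set d := \d_(repr z).
exists (c * d), (d *: h * 'X + (c * n)%:P); split.
  by apply/eqP; rewrite mulf_neq0 ?denom_ratioP //; apply/eqP.
have nd : phi d != 0 by rewrite tofrac_eq0 denom_ratioP.
have -> : map_poly phi (d *: h * 'X + (c * n)%:P) =
    (phi d *: map_poly phi h) * 'X + (phi (c * n))%:P.
  by rewrite rmorphD /= map_polyC /= rmorphM /= map_polyX map_polyZ.
rewrite -e scalerDr; congr (_ + _).
  by rewrite scalerA -scalerAl [c * d]mulrC rmorphM.
rewrite -mul_polyC -polyCM; congr (_%:P).
by rewrite !rmorphM /= {1}(frac_repr z) -/n -/d -mulrA [_ * (_ / _)]mulrCA divff // mulr1.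
Qed.

Lemma gauss_monic (G G' : {poly K}) (H : {poly R}) :
  G \is monic -> G' \is monic -> map_poly phi H = G * G' ->
  exists g, G = map_poly phi g.
Proof.
move=> mG mG' e.
have [c [h [nc eh]]] := clear_denominators G.
have [c' [h' [nc' eh']]] := clear_denominators G'.
have lc (F : {poly K}) d f : F \is monic -> phi d *: F = map_poly phi f -> lead_coef f = d.
  move=> /monicP mF ef; apply: phi_inj.
  by rewrite -(lead_coef_map_inj phi_inj (rmorph0 _)) -ef lead_coefZ mF mulr1.
have [|g eg] := monic_descent (H := H) nc nc' (lc _ _ _ mG eh) (lc _ _ _ mG' eh').
  apply: (map_inj_poly phi_inj (rmorph0 _)).
  by rewrite !rmorphM /= -eh -eh' !map_polyC /= e -!mul_polyC; ring.
exists g; apply: (scalerI (a := phi c)); first by rewrite tofrac_eq0; apply/eqP.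
by rewrite eh eg rmorphM /= map_polyC mul_polyC.
Qed.

Variable w : filtration R.
Hypothesis ws : strict w.

(* With e an idempotent commuting with M, the characteristic polynomials of e M and
   (1 - e) M multiply to X^N char(M): Gauss's lemma and the additivity of the weighted
   degree then control the coefficients of char(e M), in particular its trace. *)
Lemma idempotent_trace (N : nat) (M : 'M[R]_N) (e : 'M[K]_N) (s : int) (t : 'I_N -> int) :
  (0 < N)%N -> (forall a b, w (s + t b - t a) (M a b)) ->
  e *m e = e -> e *m map_mx phi M = map_mx phi M *m e ->
  exists z, w s z /\ \tr (e *m map_mx phi M) = phi z.
Proof.
move=> N0 hM ee eM; set M' := map_mx phi M in eM *.
pose f := 1%:M - e.
have prod := char_poly_idempotent ee eM; rewrite -map_char_poly -/f in prod.
have [g eg] := gauss_monic (char_poly_monic _) (char_poly_monic _)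
  (H := 'X^N * char_poly M) (etrans (rmorphM _ _ _)
    (etrans (congr1 (fun x => x * _) (map_polyXn _ _)) (esym prod))).
have [g' eg'] := gauss_monic (char_poly_monic _) (char_poly_monic _)
  (H := 'X^N * char_poly M) (etrans (rmorphM _ _ _)
    (etrans (congr1 (fun x => x * _) (map_polyXn _ _)) (etrans (esym prod) (mulrC _ _)))).
have mon x (A : 'M[K]_N) : char_poly A = map_poly phi x -> x \is monic.
  move=> ex; apply/monicP/phi_inj; rewrite -(lead_coef_map_inj phi_inj (rmorph0 _)).
  by rewrite -ex (monicP (char_poly_monic _)) rmorph1.
have sz x (A : 'M[K]_N) : char_poly A = map_poly phi x -> size x = N.+1.
  by move=> ex; rewrite -(size_map_inj_poly phi_inj (rmorph0 _)) -ex size_char_poly.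
have egg : g * g' = 'X^N * char_poly M.
  apply: (map_inj_poly phi_inj (rmorph0 _)).
  by rewrite !rmorphM /= -eg -eg' prod map_polyXn.
have hg : poly_filt w s (N%:Z * s) g.
  apply: (monic_factor_fw ws (mon _ _ eg) (sz _ _ eg) (mon _ _ eg') (sz _ _ eg')).
  rewrite egg PoszD mulrDl; apply: fwM; first by rewrite mulrC; apply: poly_fwXn.
  exact: (fw_char_poly (t := t)).
exists (- g`_N.-1); split; last first.
  rewrite rmorphN -coef_map /= -eg char_poly_trace ?opprK //.
apply: fwN; apply: fw_eq (hg N.-1).
by rewrite -{1}(prednK N0) intS; ring.
Qed.

End Gauss.

(** * Dual bases *)

(* A finite free R-algebra, presented as S modulo the congruence [cong u] ("u = 0"), with
   a basis v and its dual basis v' for the bilinear form (x, y) |-> lam (x * y). *)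
Record dual_bases (R S : comNzRingType) (rho : {rmorphism R -> S}) (cong : S -> Prop)
    (lam : S -> R) (I : finType) (v v' : I -> S) : Prop := DualBases {
  db_ideal : is_ideal cong;
  db_add : forall x y, lam (x + y) = lam x + lam y;
  db_scale : forall r x, lam (rho r * x) = r * lam x;
  db_zero : forall x, cong x -> lam x = 0;
  db_expand : forall u, cong (u - \sum_i rho (lam (u * v' i)) * v i);
  db_dual : forall i j, lam (v j * v' i) = (i == j)%:R }.

(** Powers are iterated products because the size will be a cardinal [#|I|], which is not
    syntactically a successor. *)
Lemma cayley_hamilton_iter (R : comNzRingType) n (A : 'M[R]_n) :
  \sum_(i < size (char_poly A)) (char_poly A)`_i *: iter i (mulmx A) 1%:M = 0.
Proof.
case: n A => [|n] A; first by rewrite [LHS]thinmx0 [RHS]thinmx0.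
rewrite -[RHS](Cayley_Hamilton A) /horner_mx /horner_morph.
rewrite (horner_coef_wide _ (size_poly _ _)); apply: eq_bigr => i _.
rewrite coef_map /= -[RHS]/(_ *m _) mul_scalar_mx; congr (_ *: _).
by elim: (i : nat) => [|j IH]; rewrite ?expr0 // exprS iterS IH.
Qed.

Section MultiplicationMatrix.
Variables (R S : comNzRingType) (rho : {rmorphism R -> S}) (cong : S -> Prop) (lam : S -> R).
Variables (I : finType) (v v' : I -> S).
Hypothesis db : dual_bases rho cong lam v v'.

Lemma lam0 : lam 0 = 0. Proof. by apply: (db_zero db); apply: ideal0; apply: db_ideal db. Qed.

Lemma lam_sum (T : Type) (r : seq T) (Q : pred T) (F : T -> S) :
  lam (\sum_(i <- r | Q i) F i) = \sum_(i <- r | Q i) lam (F i).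
Proof. by apply: (big_morph lam (db_add db) lam0). Qed.

Lemma lamN x : lam (- x) = - lam x.
Proof. by apply: (addIr (lam x)); rewrite -(db_add db) !addNr lam0. Qed.

Lemma lam_cong x y : cong (x - y) -> lam x = lam y.
Proof. by move/(db_zero db); rewrite (db_add db) lamN => /eqP; rewrite subr_eq0 => /eqP. Qed.

Lemma lam_expand z u : lam (z * u) = \sum_i lam (u * v' i) * lam (z * v i).
Proof.
rewrite (lam_cong (y := z * \sum_i rho (lam (u * v' i)) * v i)).
  by rewrite mulr_sumr lam_sum; apply: eq_bigr => i _; rewrite mulrCA (db_scale db).
by rewrite -mulrBr; apply: idealMl; [exact: (db_ideal db)|exact: (db_expand db)].
Qed.

Let N := #|I|.
Let V (i : 'I_N) := v (enum_val i).
Let V' (i : 'I_N) := v' (enum_val i).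

Definition mulmat (z : S) : 'M[R]_N := \matrix_(i, j) lam (z * V j * V' i).

Lemma mulmatM z w : mulmat (z * w) = mulmat z *m mulmat w.
Proof.
apply/matrixP => i j; rewrite !mxE.
have -> : z * w * V j * V' i = (z * V' i) * (w * V j) by ring.
rewrite lam_expand big_enum_val /=; apply: eq_bigr => l _; rewrite !mxE mulrC.
by congr (lam _ * lam _); rewrite /V /V'; ring.
Qed.

Lemma mulmatD z w : mulmat (z + w) = mulmat z + mulmat w.
Proof. by apply/matrixP => i j; rewrite !mxE !mulrDl (db_add db). Qed.

Lemma mulmat_rho r : mulmat (rho r) = r%:M.
Proof.
apply/matrixP => i j; rewrite !mxE -mulrA (db_scale db) (db_dual db).
by rewrite (inj_eq enum_val_inj) mulr_natr.
Qed.

Lemma mulmat1 : mulmat 1 = 1%:M.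
Proof. by rewrite -(rmorph1 rho) mulmat_rho. Qed.

Lemma mulmat_cong z : cong z -> mulmat z = 0.
Proof.
move=> cz; apply/matrixP => i j; rewrite !mxE; apply: (db_zero db).
by do 2![apply: idealMr; first exact: (db_ideal db)].
Qed.

Lemma mulmat0 : mulmat 0 = 0.
Proof. exact: (mulmat_cong (ideal0 (db_ideal db))). Qed.

Lemma mulmat_eq z w : cong (z - w) -> mulmat z = mulmat w.
Proof.
move/mulmat_cong; rewrite mulmatD => /(congr1 (fun A => A + mulmat w)).
by rewrite -addrA -mulmatD addNr mulmat0 addr0 add0r.
Qed.

Lemma cong_mulmat z : mulmat z = 0 -> cong z.
Proof.
move=> Mz; have iC := db_ideal db.
suff h i : lam (z * v' i) = 0.
  have := db_expand db z; rewrite big1 ?subr0 // => i _.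
  by rewrite h rmorph0 mul0r.
have -> : z * v' i = (z * v' i) * 1 by rewrite mulr1.
rewrite lam_expand big1 // => j _.
have /matrixP/(_ (enum_rank i) (enum_rank j)) := Mz.
rewrite !mxE /V /V' !enum_rankK => e.
by rewrite mulrAC e mulr0.
Qed.

(** The sum of the v v' plays the role of the different, which relates the trace to [lam]. For
    S[X]/(g) it is g', see [sum_horner_quotient]. *)
Lemma mulmat_tr z : \tr (mulmat z) = lam (z * \sum_i v i * v' i).
Proof.
rewrite mulr_sumr lam_sum big_enum_val /=; apply: eq_bigr => i _.
by rewrite !mxE mulrA.
Qed.

Lemma mulmat_horner p z : mulmat (map_poly rho p).[z] =
  \sum_(i < size p) p`_i *: iter i (mulmx (mulmat z)) 1%:M.
Proof.
rewrite (horner_coef_wide _ (size_poly _ _)).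
have sumE (n : nat) (F : 'I_n -> S) : mulmat (\sum_i F i) = \sum_i mulmat (F i).
  elim: n F => [|n IH] F; last by rewrite !big_ord_recr /= mulmatD IH.
  by rewrite !big_ord0 mulmat0.
rewrite sumE; apply: eq_bigr => i _.
rewrite coef_map mulmatM mulmat_rho mul_scalar_mx; congr (_ *: _).
elim: (i : nat) => [|n IH]; first by rewrite expr0 mulmat1.
by rewrite exprS mulmatM IH.
Qed.

Lemma cong_char_poly z : cong (map_poly rho (char_poly (mulmat z))).[z].
Proof. by apply: cong_mulmat; rewrite mulmat_horner cayley_hamilton_iter. Qed.

End MultiplicationMatrix.

(** * Euler's dual basis for a monic polynomial, and towers of two such algebras *)

Import Pdiv.CommonRing Pdiv.RingMonic.

Section OneVariable.
Variables (S : comNzRingType) (g : {poly S}) (d : nat).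
Hypotheses (mg : g \is monic) (sg : size g = d.+1).

(** Euler's functional: for separable [g] it is the trace of u/g'. The basis dual to the powers of X
    consists of the quotients of [g] by X^(i+1), the polynomials of Horner's scheme. *)
Definition top_coef (u : {poly S}) : S := (rmodp u g)`_d.-1.
Definition horner_quotient (i : 'I_d) : {poly S} := drop_poly i.+1 g.

Lemma rmodp_uniq (a u r : {poly S}) : (size r <= d)%N -> u = a * g + r -> rmodp u g = r.
Proof. by move=> sr ->; rewrite rmodp_addl_mul_small // sg ltnS. Qed.

Lemma rmodp_eq u : u = rdivp u g * g + rmodp u g.
Proof. exact: rdivp_eq. Qed.

Lemma size_rmodp u : (size (rmodp u g) <= d)%N.
Proof. by rewrite -ltnS -sg ltn_rmodp -size_poly_gt0 sg. Qed.

Lemma top_coef_dual (j : nat) (i : 'I_d) : (j < d)%N ->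
  top_coef ('X^j * horner_quotient i) = (i == j :> nat)%:R.
Proof.
move=> jd; rewrite /top_coef /horner_quotient; have lt_id := ltn_ord i.
have lg : g`_d = 1 by move/monicP: mg; rewrite /lead_coef sg.
have [le_ji|lt_ij] := leqP j i.
  rewrite (rmodp_uniq (a := 0) (r := 'X^j * drop_poly i.+1 g)) ?mul0r ?add0r //.
    rewrite coefXnM coef_drop_poly; case: ltnP => [|h]; first by lia.
    have [<-|nij] := eqVneq (i : nat) j.
      by rewrite (_ : _ + _ = d)%N ?lg //; lia.
    by rewrite nth_default // sg; lia.
  rewrite (leq_trans (size_polyMleq _ _)) // size_polyXn size_drop_poly sg.
  by have := ltn_ord i; lia.
have -> : (i == j :> nat) = false by lia.
(* Modulo [g], the high part of [g] is minus its low part; the new remainder has size at most j,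
   hence no term of degree d - 1. *)
have e : 'X^j * drop_poly i.+1 g = 'X^(j - i.+1) * g + - ('X^(j - i.+1) * take_poly i.+1 g).
  rewrite -{2}(poly_take_drop i.+1 g) mulrDr addrAC subrr add0r.
  by rewrite {1}(_ : j = (j - i.+1) + i.+1)%N ?exprD; [ring|lia].
have st : (size ('X^(j - i.+1) * take_poly i.+1 g)%R <= j)%N.
  rewrite (leq_trans (size_polyMleq _ _)) // size_polyXn.
  by have := size_take_poly i.+1 g; lia.
rewrite (rmodp_uniq _ e) ?size_polyN; last by apply: leq_trans st _; lia.
by rewrite coefN nth_default ?oppr0 // (leq_trans st) //; lia.
Qed.

Lemma top_coefD u w : top_coef (u + w) = top_coef u + top_coef w.
Proof. by rewrite /top_coef rmodpD // coefD. Qed.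

Lemma top_coefZ c u : top_coef (c%:P * u) = c * top_coef u.
Proof. by rewrite /top_coef mul_polyC rmodpZ // coefZ. Qed.

Lemma one_variable_dual_bases :
  dual_bases polyC (multiple g) top_coef (fun i : 'I_d => 'X^i) horner_quotient.
Proof.
split.
- exact: multiple_ideal.
- exact: top_coefD.
- exact: top_coefZ.
- move=> x [c ->]; rewrite /top_coef (rmodp_uniq (a := c) (r := 0)) ?coef0 ?addr0 //.
  by rewrite size_poly0.
- move=> u; exists (rdivp u g); rewrite {1}(rmodp_eq u) -addrA.
  suff -> : \sum_i (top_coef (u * horner_quotient i))%:P * 'X^i = rmodp u g.
    by rewrite subrr addr0.
  have eR : rmodp u g = \sum_(j < d) (rmodp u g)`_j *: 'X^j.
    rewrite -[LHS]coefK poly_def.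
    rewrite (big_ord_widen d (fun j => (rmodp u g)`_j *: 'X^j)) ?size_rmodp //.
    rewrite big_mkcond; apply: eq_bigr => j _; case: ifP => // /negbT; rewrite -leqNgt => h.
    by rewrite nth_default ?scale0r.
  rewrite [RHS]eR; apply: eq_bigr => i _; rewrite mul_polyC; congr (_ *: _).
  have -> : top_coef (u * horner_quotient i) = top_coef (rmodp u g * horner_quotient i).
    by rewrite /top_coef rmodp_mulml.
  rewrite [in LHS]eR.
  rewrite mulr_suml (big_morph top_coef top_coefD (id1 := 0)); last first.
    by rewrite /top_coef rmod0p coef0.
  rewrite (bigD1 i) //= big1 => [|j nji].
    by rewrite -scalerAl -mul_polyC top_coefZ top_coef_dual // eqxx mulr1 addr0.
  rewrite -scalerAl -mul_polyC top_coefZ top_coef_dual //.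
  by rewrite eq_sym val_eqE (negPf nji) mulr0.
- by move=> i j; rewrite top_coef_dual.
Qed.

(** In degree l, each of the l + 1 summands with i at most l contributes the coefficient of [g] at l
    + 1. *)
Lemma sum_horner_quotient : \sum_(i < d) 'X^i * horner_quotient i = g^`().
Proof.
apply/polyP => l; rewrite coef_sum coef_deriv.
have [lt_ld|le_dl] := ltnP l d; last first.
  rewrite nth_default ?sg // mul0rn big1 // => i _.
  rewrite coefXnM coef_drop_poly ltnNge (leq_trans (ltnW (ltn_ord i)) le_dl) /=.
  by rewrite nth_default // sg; have := ltn_ord i; lia.
transitivity (\sum_(i < d | (i < l.+1)%N) g`_l.+1).
  rewrite [RHS]big_mkcond; apply: eq_bigr => i _.
  rewrite coefXnM coef_drop_poly ltnS; case: ltnP => // le_il.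
  by congr (g`_ _); lia.
by rewrite -(big_ord_widen _ (fun=> g`_l.+1)) // sumr_const card_ord.
Qed.

(** Since [g] is monic and no heavier than its leading term, every step of the division preserves
    the weight bound. *)
Lemma rmodp_fw (w : filtration S) (kap m : int) u :
  poly_filt w kap (kap * d%:Z) g -> poly_filt w kap m u -> poly_filt w kap m (rmodp u g).
Proof.
move=> wg; suff h n (v : {poly S}) : (size v <= n)%N -> poly_filt w kap m v ->
    poly_filt w kap m (rmodp v g) by move=> wu; apply: (h _ _ (leqnn (size u))).
elim: n v => [|n IH] v sv wv.
  by move: sv; rewrite size_poly_leq0 => /eqP->; rewrite rmod0p; apply: fw0.
have [sd|ds] := leqP (size v) d.
  by rewrite (rmodp_uniq (a := 0) (r := v)) // mul0r add0r.
pose e := (size v).-1; pose c := lead_coef v.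
have -> : rmodp v g = rmodp (v - c%:P * 'X^(e - d) * g) g.
  by rewrite rmodpB // rmodp_mull // subr0.
apply: IH; last first.
  apply: fwB => //; apply: (@fw_eq _ _ (m - kap * e%:Z + kap * (e - d)%:Z + kap * d%:Z)).
    by rewrite -subzn; [ring|rewrite /e; lia].
  apply: fwM => //; apply: fwM; last exact: poly_fwXn.
  by apply: poly_fwC; apply: wv.
have sve : size v = e.+1 by rewrite /e prednK // (leq_trans _ ds).
rewrite -ltnS; apply: (leq_trans _ sv); rewrite sve; apply/leq_sizeP => j le_ej.
rewrite coefB -mulrA coefCM coefXnM.
have lg : g`_d = 1 by move/monicP: mg; rewrite /lead_coef sg.
have -> : (j < e - d)%N = false by lia.
move: le_ej; rewrite leq_eqVlt => /orP[/eqP<-|lt_ej].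
  by rewrite subKn ?lg ?mulr1 ?subrr //; rewrite /e; lia.
by rewrite !nth_default ?mulr0 ?subr0 ?sg ?sve //; rewrite /e in lt_ej *; lia.
Qed.

Lemma top_coef_fw (w : filtration S) (kap m : int) u :
  poly_filt w kap (kap * d%:Z) g -> poly_filt w kap m u ->
  w (m - kap * d.-1%:Z) (top_coef u).
Proof. by move=> wg wu; apply: (rmodp_fw wg wu). Qed.

Lemma horner_quotient_fw (w : filtration S) (kap : int) (i : 'I_d) :
  poly_filt w kap (kap * d%:Z) g -> poly_filt w kap (kap * (d.-1 - i)%:Z) (horner_quotient i).
Proof.
move=> wg j; rewrite coef_drop_poly; apply: fw_eq (wg (j + i.+1)%N).
have := ltn_ord i => lt_id; rewrite -subzn; last by lia.
by rewrite -subn1 -subzn; [lia|lia].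
Qed.

End OneVariable.

Section Composition.
Variables (R S T : comNzRingType) (rho : {rmorphism R -> S}) (sig : {rmorphism S -> T}).
Variables (q : S) (b : T -> Prop) (lam : S -> R) (mu : T -> S).
Variables (I J : finType) (v v' : I -> S) (w w' : J -> T).
Hypothesis dv : dual_bases rho (multiple q) lam v v'.
Hypothesis dw : dual_bases sig b mu w w'.

Definition comp_cong (u : T) : Prop := exists c, b (u - c * sig q).
Definition comp_basis (x : J * I) : T := sig (v x.2) * w x.1.
Definition comp_dual (x : J * I) : T := sig (v' x.2) * w' x.1.

(** In a tower the functionals compose and dual bases multiply; the coordinates over S are expanded
    in turn modulo [q]. *)
Lemma comp_dual_bases :
  dual_bases (sig \o rho) comp_cong (lam \o mu) comp_basis comp_dual.
Proof.
have ib := db_ideal dw.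
split=> /=.
- split; first by exists 0; rewrite mul0r subr0; apply: ideal0.
  split=> [x y [c hc] [d hd]|a x [c hc]].
    by exists (c + d); rewrite mulrDl opprD addrACA; apply: idealD.
  by exists (a * c); rewrite -mulrA -mulrBr; apply: idealMl.
- by move=> x y; rewrite (db_add dw) (db_add dv).
- by move=> r x; rewrite (db_scale dw) (db_scale dv).
- move=> x [c hc]; rewrite (lam_cong dw hc) mulrC (db_scale dw).
  by apply: (db_zero dv); exists (mu c); rewrite mulrC.
- move=> u; pose c j := sval (constructive_indefinite_description _ (db_expand dv (mu (u * w' j)))).
  have hc j : mu (u * w' j) - \sum_i rho (lam (mu (u * w' j) * v' i)) * v i = c j * q.
    by rewrite /c; case: constructive_indefinite_description.
  exists (\sum_j sig (c j) * w j).
  rewrite (_ : _ - _ = u - \sum_j sig (mu (u * w' j)) * w j); first exact: (db_expand dw).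
  rewrite -addrA -opprD; congr (_ - _).
  rewrite -(pair_bigA _ (fun j i => sig (rho (lam (mu (u * (sig (v' i) * w' j))))) * (sig (v i) * w j))) /=.
  rewrite mulr_suml -big_split /=; apply: eq_bigr => j _.
  transitivity (sig (\sum_i rho (lam (mu (u * w' j) * v' i)) * v i) * w j + sig (c j) * w j * sig q).
    congr (_ + _); rewrite rmorph_sum mulr_suml; apply: eq_bigr => i _.
    rewrite rmorphM /= mulrA; congr (sig (rho (lam _)) * _ * _).
    by rewrite mulrCA (db_scale dw) mulrC.
  by rewrite mulrAC -rmorphM -hc -mulrDl -rmorphD addrC subrK.
- move=> [j i] [j' i'] /=; rewrite /comp_basis /comp_dual /= .
  rewrite (_ : _ * _ = sig (v i' * v' i) * (w j' * w' j)); last by rewrite rmorphM; ring.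
  rewrite (db_scale dw) (db_dual dw) xpair_eqE.
  case: (j == j'); last by rewrite mulr0 (lam0 dv).
  by rewrite mulr1 (db_dual dv).
Qed.

Lemma comp_discr : \sum_x comp_basis x * comp_dual x =
  sig (\sum_i v i * v' i) * \sum_j w j * w' j.
Proof.
rewrite /comp_basis /comp_dual.
rewrite -(pair_bigA _ (fun j i => sig (v i) * w j * (sig (v' i) * w' j))) /=.
rewrite mulr_sumr; apply: eq_bigr => j _; rewrite rmorph_sum mulr_suml.
by apply: eq_bigr => i _; rewrite rmorphM; ring.
Qed.

End Composition.

(** * Degree of polynomials and translations along a line *)

Section DegreeFiltration.
Variables (k : fieldType) (n : nat).
Local Notation B := {mpoly k[n]}.

(* msize with its structure arguments fixed once and for all *)
Definition msz (p : B) : nat := msize p.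

Lemma msz_gt0 (p : B) : p != 0 -> (0 < msz p)%N.
Proof. by rewrite lt0n /msz msize_poly_eq0. Qed.

Lemma mszM (p q : B) : p != 0 -> q != 0 -> msz (p * q) = (msz p + msz q).-1.
Proof. exact: msizeM. Qed.

Lemma mszD (p q : B) : (msz (p + q) <= maxn (msz p) (msz q))%N.
Proof. exact: msizeD_le. Qed.

(** [msz] is the total degree plus one, but 0 at the zero polynomial: hence the shift, and the
    exception that puts 0 in every level. *)
Definition deg_fw (m : int) (p : B) := p <> 0 -> (msz p)%:Z <= m + 1.

Lemma deg_fw0 m : deg_fw m 0. Proof. by []. Qed.
Lemma deg_fw1 : deg_fw 0 1. Proof. by rewrite /deg_fw /msz msize1. Qed.
Lemma deg_fwN m p : deg_fw m p -> deg_fw m (- p).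
Proof. by move=> h np; rewrite /msz msizeN; apply: h => p0; apply: np; rewrite p0 oppr0. Qed.
Lemma deg_fwD m p q : deg_fw m p -> deg_fw m q -> deg_fw m (p + q).
Proof.
have [->|np] := eqVneq p 0; first by rewrite add0r.
have [->|nq] := eqVneq q 0; first by rewrite addr0.
move=> /(_ (elimN eqP np)) hp /(_ (elimN eqP nq)) hq _.
by have := mszD p q; lia.
Qed.
Lemma deg_fwM m m' p q : deg_fw m p -> deg_fw m' q -> deg_fw (m + m') (p * q).
Proof.
have [->|np] := eqVneq p 0; first by rewrite mul0r => _ _; apply: deg_fw0.
have [->|nq] := eqVneq q 0; first by rewrite mulr0 => _ _; apply: deg_fw0.
move=> /(_ (elimN eqP np)) hp /(_ (elimN eqP nq)) hq _; rewrite mszM //.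
by have := msz_gt0 np; have := msz_gt0 nq; lia.
Qed.
Lemma deg_fw_le m m' p : m <= m' -> deg_fw m p -> deg_fw m' p.
Proof. by move=> le h np; have := h np; lia. Qed.

Definition deg_filt : filtration B :=
  Filtration deg_fw0 deg_fw1 deg_fwN deg_fwD deg_fwM deg_fw_le.

Lemma deg_filt_strict : strict deg_filt.
Proof.
split=> [h|p|p q m m'].
- by have := h (elimN eqP (oner_neq0 _)); rewrite /msz msize1.
- by exists (msz p) => _; lia.
rewrite /= /deg_fw => hp hq h.
have np : p != 0 by apply/eqP => p0; apply: hp.
have nq : q != 0 by apply/eqP => q0; apply: hq.
have := h (elimN eqP (mulf_neq0 np nq)); rewrite mszM //.
have hp' : ~ (msz p)%:Z <= m + 1 by move=> ?; apply: hp.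
have hq' : ~ (msz q)%:Z <= m' + 1 by move=> ?; apply: hq.
by have := msz_gt0 np; have := msz_gt0 nq; lia.
Qed.

Lemma deg_filtC (m : nat) c : deg_filt m%:Z c%:MP.
Proof. by move=> _; rewrite /msz msizeC; case: (c != 0); lia. Qed.

Lemma deg_filtX i : deg_filt 1 'X_i.
Proof. by move=> _; rewrite /msz msizeX mdeg1. Qed.

Lemma deg_filt0P p : deg_filt 0 p -> p = (p@_0%MM)%:MP.
Proof.
have [->|np h] := eqVneq p 0; first by rewrite mcoeff0 mpolyC0.
by apply: msize1_polyC; rewrite -/(msz p); have := h (elimN eqP np); lia.
Qed.

End DegreeFiltration.

Section LineTranslation.
Variables (k : fieldType) (n : nat) (w : 'I_n -> k).
Local Notation B := {mpoly k[n]}.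

Lemma meval_mor_filt (S : comNzRingType) (W : filtration S) (phi : {rmorphism k -> S}) h m :
  (forall c, W 0 (phi c)) -> (forall i, W 1 (h i)) ->
  forall p : B, deg_filt k n m p -> W m (meval_mor phi h p).
Proof.
move=> hC hX p; have [-> _|np hp] := eqVneq p 0; first by rewrite rmorph0; apply: fw0.
rewrite /meval_mor /= /mmap big_seq; apply: fw_sum => a /msize_mdeg_lt; rewrite -/(msz p) => lt.
apply: (fw_le (m := 0 + \sum_(i < n) (1 * (a i)%:Z))).
  rewrite add0r (eq_bigr (fun i => (a i)%:Z)); last by move=> i _; rewrite mul1r.
  have -> : \sum_(i < n) (a i)%:Z = (mdeg a)%:Z.
    by rewrite mdegE (big_morph Posz PoszD (erefl _)).
  by have := hp (elimN eqP np); lia.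
by apply: fwM => //; apply: fw_prod => i; apply: fwX.
Qed.

Definition translate : {rmorphism B -> {poly B}} :=
  meval_mor (polyC \o mpolyC n (R := k)) (fun i => ('X_i)%:P + ((w i)%:MP)%:P * 'X).

Lemma translateC c : translate c%:MP = (c%:MP)%:P.
Proof. by rewrite /translate meval_morC. Qed.

Lemma translateX i : translate 'X_i = ('X_i)%:P + ((w i)%:MP)%:P * 'X.
Proof. by rewrite /translate meval_morX. Qed.

Lemma translate_filt m b : deg_filt k n m b -> poly_filt (deg_filt k n) 1 m (translate b).
Proof.
move=> h; apply: (meval_mor_filt (W := poly_filt (deg_filt k n) 1)) h => [c|i] /=.
  by apply: (poly_fwC (w := deg_filt k n)); apply: (@deg_filtC _ _ 0%N).
apply: (poly_fwD (w := deg_filt k n)); first by apply: poly_fwC; apply: deg_filtX.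
apply: (fw_eq (w := poly_filt (deg_filt k n) 1) (add0r 1)).
apply: (fwM (f := poly_filt (deg_filt k n) 1)); last exact: poly_fwX.
by apply: poly_fwC; apply: (@deg_filtC _ _ 0%N).
Qed.

Lemma translate_coef0 b : (translate b)`_0 = b.
Proof.
rewrite -horner_coef0 -horner_evalE.
apply: (mpoly_mor_eq (f := horner_eval 0 \o translate) (g := idfun)) => /= [c|i].
  by rewrite translateC horner_evalE hornerC.
by rewrite translateX horner_evalE hornerD hornerC hornerM hornerX mulr0 addr0.
Qed.

Lemma size_translate b : (size (translate b) <= msz b)%N.
Proof.
have [->|nb] := eqVneq b 0; first by rewrite rmorph0 size_poly0.
apply/leq_sizeP => j le_bj.
have h : deg_filt k n ((msz b)%:Z - 1) b by move=> _; lia.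
have hc : deg_filt k n ((msz b)%:Z - 1 - 1 * j%:Z) (translate b)`_j by exact: (translate_filt h).
apply/eqP; apply: contraT => nc.
by have := hc (elimN eqP nc); have := msz_gt0 nc; lia.
Qed.

End LineTranslation.

(** * Numerators of logarithmic forms *)

(* The ring morphisms of this section are variables characterised by their values on
   generators: with transparent bodies, unification would try to compare them by unfolding.
   [Phi b] stands for b (x + w T), for a fixed direction w. *)
Section Interpolation.
Variables (A B : idomainType) (degB : filtration B) (dg : B -> nat).
Hypotheses (facB : factorial B) (strictB : strict degB).
Local Notation S1 := {poly B}.
Local Notation S2 := {poly {poly B}}.
Variables (evB : {rmorphism B -> A}) (evBY : {rmorphism S1 -> A}) (y : A).
Hypotheses (evBYC : forall b, evBY b%:P = evB b) (evBYX : evBY 'X = y).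

Variables (P : A -> Prop) (q : B) (f : {poly B}) (r : nat) (s : {poly B}) (kap : int).
Hypotheses (primeP : is_prime_ideal P) (Pq : P (evB q)).
Hypothesis PBq : forall b, P (evB b) -> multiple q b.
Hypothesis dgq : forall b, b <> 0 -> (dg b < dg (b * q)%R)%N.
Hypotheses (mf : f \is monic) (sf : size f = r.+2) (fy : evBY f = 0).
Hypothesis wf : poly_filt degB kap (kap * r.+1%:Z) f.
Hypothesis nPs : ~ P (evBY s).
Hypothesis sP : forall p, P (evBY p) -> exists a b, s * p = a * f + b * q%:P.
Variables (d : nat) (c0 c0' : B).
Variables (Phi : {rmorphism B -> S1}) (PhiY : {rmorphism S1 -> S2}).
Hypotheses (Phi_filt : forall m b, degB m b -> poly_filt degB 1 m (Phi b))
  (Phi_coef0 : forall b, (Phi b)`_0 = b)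
  (PhiPhi : forall b, (map_poly Phi (Phi b)).[- 'X] = b%:P)
  (PhiYE : forall p, PhiY p = map_poly Phi p).
Hypotheses (wq : degB d.+1%:Z q) (c0V : c0' * c0 = 1) (wc0' : degB 0 c0').
Hypotheses (size_Phiq : size (Phi q) = d.+2) (qtop : (Phi q)`_d.+1 = c0).

Let qm : S1 := c0'%:P * Phi q.
Let fP : S2 := PhiY f.

Local Lemma nc0' : c0' != 0.
Proof. by apply/eqP => c00; move: c0V; rewrite c00 mul0r => /eqP; rewrite eq_sym oner_eq0. Qed.

Local Lemma qmE : Phi q = c0%:P * qm.
Proof. by rewrite /qm mulrA -polyCM mulrC [c0 * _]mulrC c0V mulr1. Qed.

Local Lemma size_qm : size qm = d.+2.
Proof. by rewrite /qm mul_polyC size_scale ?size_Phiq // nc0'. Qed.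

Local Lemma monic_qm : qm \is monic.
Proof. by apply/monicP; rewrite /lead_coef size_qm /qm coefCM qtop. Qed.

Local Lemma monic_fP : fP \is monic. Proof. by rewrite /fP PhiYE; apply: monic_map. Qed.
Local Lemma size_fP : size fP = r.+2.
Proof. by rewrite /fP PhiYE size_map_poly_id0 // (monicP mf) rmorph1 oner_neq0. Qed.

Local Lemma qm_fw : poly_filt degB 1 (1 * d.+1%:Z) qm.
Proof.
apply: (fw_eq (w := poly_filt degB 1) (add0r _)); apply: (fwM (f := poly_filt degB 1)).
  exact: poly_fwC.
by rewrite mul1r; apply: Phi_filt.
Qed.

Let W2 := poly_filt (poly_filt degB 1) kap.

Local Lemma PhiY_fw m p : poly_filt degB kap m p -> W2 m (PhiY p).
Proof. by move=> h i; rewrite PhiYE coef_map; apply: Phi_filt; apply: h. Qed.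

Local Lemma fP_fw : W2 (kap * r.+1%:Z) fP. Proof. exact: PhiY_fw. Qed.

(** The algebra B[T,Y]/(q(x + wT), f(x + wT, Y)), free of rank (d+1)(r+1) over B. Geometrically, the
    hypersurface q = 0 of the cover is projected to affine space along [w]. *)
Let cong := comp_cong polyC qm (multiple fP).
Let lam := top_coef qm d.+1 \o top_coef fP r.+1.
Let V := comp_basis polyC (fun i : 'I_d.+1 => 'X^i) (fun i : 'I_r.+1 => 'X^i : S2).
Let V' := comp_dual polyC (@horner_quotient B qm d.+1) (@horner_quotient S1 fP r.+1).
Let rho : {rmorphism B -> S2} := polyC \o polyC.

Local Lemma dbS : dual_bases rho cong lam V V'.
Proof.
apply: comp_dual_bases.
  exact: (one_variable_dual_bases monic_qm size_qm).
exact: (one_variable_dual_bases monic_fP size_fP).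
Qed.

Let Delta : S2 := (qm^`())%:P * fP^`().

Local Lemma DeltaE : \sum_i V i * V' i = Delta.
Proof. by rewrite comp_discr (sum_horner_quotient monic_qm size_qm)
  (sum_horner_quotient monic_fP size_fP). Qed.

Local Lemma lam_fw m u : W2 m u -> degB (m - kap * r%:Z - d%:Z) (lam u).
Proof.
move=> h; rewrite -[d%:Z]mul1r /lam /=.
apply: (top_coef_fw monic_qm size_qm qm_fw).
exact: (top_coef_fw monic_fP size_fP fP_fw).
Qed.

Let wt (j : 'I_r.+1 * 'I_d.+1) : int := kap * j.1%:Z + j.2%:Z.

Local Lemma V_fw j : W2 (wt j) (V j).
Proof.
rewrite /wt addrC; apply: fwM; last exact: poly_fwXn.
apply: poly_fwC; apply: (fw_eq (w := poly_filt degB 1) (mul1r _)); exact: poly_fwXn.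
Qed.

Local Lemma V'_fw j : W2 (kap * r%:Z + d%:Z - wt j) (V' j).
Proof.
apply: (fw_eq (m := 1 * (d - j.2)%:Z + kap * (r - j.1)%:Z)).
  have h1 := ltn_ord j.1; have h2 := ltn_ord j.2.
  by rewrite -!subzn /wt; [ring|lia|lia].
apply: fwM; last exact: (horner_quotient_fw monic_fP size_fP _ fP_fw).
by apply: poly_fwC; apply: (horner_quotient_fw monic_qm size_qm _ qm_fw).
Qed.

Variables (LamT : {rmorphism S1 -> {poly A}}) (Lam : {rmorphism S2 -> {poly A}}).
Hypotheses (LamTE : forall t, LamT t = (map_poly (map_poly evB \o Phi) t).[- 'X])
  (LamC : forall t, Lam t%:P = LamT t) (LamX : Lam 'X = y%:P).

Local Lemma PhiYC b : PhiY b%:P = (Phi b)%:P. Proof. by rewrite PhiYE; apply: map_polyC. Qed.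
Local Lemma PhiYX : PhiY 'X = 'X. Proof. by rewrite PhiYE; apply: map_polyX. Qed.

Local Lemma LamTC b : LamT b%:P = map_poly evB (Phi b).
Proof. by rewrite LamTE map_polyC hornerC. Qed.

Local Lemma LamTX : LamT 'X = - 'X.
Proof. by rewrite LamTE map_polyX hornerX. Qed.

(** [Lam] sends b to b(x + wT) and T to -T, so it undoes the translation. It maps the algebra [cong]
    to A[T] modulo the extension [PT] of [P]. *)
Local Lemma LamT_Phi b : LamT (Phi b) = (evB b)%:P.
Proof.
rewrite LamTE map_poly_comp -[X in _.[X]]opprK -(map_polyX evB) opprK -rmorphN /=.
by rewrite horner_map PhiPhi /= map_polyC.
Qed.

Local Lemma Lam_PhiY p : Lam (PhiY p) = (evBY p)%:P.
Proof.
apply: (poly_sq_eq (f := PhiY) (g := Lam) (f' := evBY) (g' := polyC)) => [b|].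
  by rewrite PhiYC LamC LamT_Phi evBYC.
by rewrite PhiYX LamX evBYX.
Qed.

Variable Theta : {rmorphism S2 -> S2}.
Hypotheses (ThetaE : forall z, Theta z = (map_poly PhiY z).[- 'X%:P]).

Local Lemma ThetaC p : Theta p%:P = PhiY p.
Proof. by rewrite ThetaE map_polyC hornerC. Qed.

Local Lemma ThetaX : Theta 'X = - 'X%:P.
Proof. by rewrite ThetaE map_polyX hornerX. Qed.

(** Change of coordinates: every element is a polynomial in T with coefficients translated from
    B[Y], because translation is invertible. Membership in [PT] can then be read coefficient by
    coefficient. *)
Local Lemma Theta_surj z : exists z', Theta z' = z.
Proof.
have hB b : exists z', Theta z' = b%:P%:P.
  exists (map_poly polyC (Phi b)); rewrite ThetaE -map_poly_comp.
  rewrite (eq_map_poly (g := polyC \o Phi)) => [|c]; last by rewrite /= PhiYC.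
  by rewrite map_poly_comp -polyCN horner_map /= PhiPhi.
have hT t : exists z', Theta z' = t%:P.
  elim/poly_ind: t => [|t b [z1 e1]]; first by exists 0; rewrite rmorph0.
  have [z2 e2] := hB b; exists (z1 * (- 'X) + z2).
  by rewrite rmorphD rmorphM rmorphN ThetaX e1 e2 opprK polyCD polyCM.
elim/poly_ind: z => [|z t [z1 e1]]; first by exists 0; rewrite rmorph0.
have [z2 e2] := hT t; exists (z1 * 'X%:P + z2).
by rewrite rmorphD rmorphM ThetaC PhiYX e1 e2.
Qed.

Local Lemma LamTheta z : Lam (Theta z) = map_poly evBY z.
Proof.
apply: (poly_tri_eq (f := Theta) (g := Lam) (h := map_poly evBY)) => [p|].
  by rewrite ThetaC Lam_PhiY [RHS]map_polyC.
by rewrite ThetaX rmorphN LamC LamTX opprK [RHS]map_polyX.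
Qed.

Let iP : is_ideal P := proj1 primeP.
Let PT := coef_in P.
Let primePT : is_prime_ideal PT := coef_in_prime primeP.
Let iPT : is_ideal PT := proj1 primePT.
Let icong : is_ideal cong := db_ideal dbS.

Local Lemma cong_fP u : cong (u * fP).
Proof. by exists 0; rewrite mul0r subr0; exists u. Qed.

Local Lemma cong_Phiq u : cong (u * (Phi q)%:P).
Proof.
exists (u * c0%:P%:P); rewrite qmE polyCM mulrA subrr.
by apply: ideal0; apply: multiple_ideal.
Qed.

Let sigma := PhiY s.

Local Lemma sigma_kernel z : PT (Lam z) -> cong (sigma * z).
Proof.
have [z' <-] := Theta_surj z; rewrite LamTheta => hz.
rewrite ThetaE (horner_coef_wide _ (size_poly _ _)) mulr_sumr.
apply: ideal_sum => // i _; rewrite coef_map mulrA; apply: idealMr => //.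
have [|a [b e]] := sP (p := z'`_i); first by have := hz i; rewrite coef_map.
rewrite -[_ * _]/(PhiY s * PhiY z'`_i) -rmorphM e rmorphD !rmorphM; apply: idealD => //.
  exact: cong_fP.
by rewrite PhiYC; apply: cong_Phiq.
Qed.

Local Lemma cong_Lam u : cong u -> PT (Lam u).
Proof.
case=> c [a e]; rewrite -(subrK (c * polyC qm) u) e rmorphD.
rewrite [Lam (a * _)]rmorphM [Lam (c * _)]rmorphM; apply: (idealD iPT).
  by rewrite /fP Lam_PhiY fy polyC0 mulr0; apply: (ideal0 iPT).
apply: (idealMl _ iPT); rewrite LamC /qm rmorphM; apply: (idealMl _ iPT).
by rewrite LamT_Phi => -[|i]; rewrite coefC //=; apply: (ideal0 iP).
Qed.

Local Lemma nPT_sigma : ~ PT (Lam sigma).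
Proof. by rewrite /sigma Lam_PhiY => /(_ 0%N); rewrite coefC. Qed.

Local Lemma nPc0 : ~ P (evB c0).
Proof.
move=> Pc; case: primeP => _ [n1 _]; apply: n1.
by rewrite -(rmorph1 evB) -c0V rmorphM; apply: (idealMl _ iP).
Qed.

Local Lemma Lam_rho b : Lam b%:P%:P = map_poly evB (Phi b).
Proof. by rewrite LamC LamTC. Qed.

Local Lemma nPT_q : ~ PT (Lam q%:P%:P).
Proof. by rewrite Lam_rho => /(_ d.+1); rewrite coef_map qtop; apply: nPc0. Qed.

(** B embeds in (A/P)[T]. If b(x + wT) has all coefficients in [P], its constant term makes [q]
    divide b; and [q] itself is outside [PT], having the unit [c0] as top coefficient. So the
    quotient satisfies the same condition, with smaller [dg]. *)
Local Lemma PT_rho b : PT (Lam b%:P%:P) -> b = 0.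
Proof.
elim: {b}(dg b).+1 {-2}b (ltnSn (dg b)) => // m IH b; rewrite ltnS => le_bm hb.
have Pb : P (evB b) by have := hb 0%N; rewrite Lam_rho coef_map Phi_coef0.
have [c ec] := PBq Pb; have [c00|/eqP nc] := eqVneq c 0; first by rewrite ec c00 mul0r.
case: (nc); apply: IH; first by apply: leq_trans le_bm; rewrite ec; apply: dgq.
by move: hb; rewrite ec !polyCM rmorphM => /(primeM primePT)[|/nPT_q].
Qed.

Local Lemma split_X (p : {poly B}) : p != 0 ->
  exists m p' b, b != 0 /\ p = 'X^m * (p' * 'X + b%:P).
Proof.
elim/poly_ind: p => [|p c IH]; first by rewrite eqxx.
have [-> |nc] := eqVneq c 0; last by exists 0%N, p, c; rewrite expr0 mul1r.
rewrite addr0 => np; have [|m [p' [b [nb ->]]]] := IH.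
  by apply: contraNneq np => ->; rewrite mul0r.
by exists m.+1, p', b; split=> //; rewrite exprS; ring.
Qed.

Let Mat := mulmat lam V V'.
Let K := {fraction B}.
Let phi : {rmorphism B -> K} := @FracField.tofrac B.

Local Lemma Mat_fw x i j : degB (kap * r%:Z + d%:Z - wt x + wt (enum_val j) - wt (enum_val i))
  (Mat (V' x) i j).
Proof.
rewrite mxE; apply: (fw_eq _ (lam_fw (fwM (fwM (V'_fw x) (V_fw _)) (V'_fw _)))).
by ring.
Qed.

(* [e / b] is the idempotent of the components on which [sigma] is invertible; it comes from
   the factor prime to X of the characteristic polynomial of [sigma]. *)
Local Lemma idempotent_mod : exists b e g,
  [/\ b != 0, e = g * sigma, cong (e * e - rho b * e) & PT (Lam e - Lam (rho b))].
Proof.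
have nchi : char_poly (Mat sigma) != 0 by rewrite monic_neq0 ?char_poly_monic.
have [m [chi1 [b [nb echi]]]] := split_X nchi.
have := cong_char_poly dbS sigma; rewrite -/Mat echi.
rewrite rmorphM rmorphD rmorphM /= map_polyXn map_polyX map_polyC hornerM hornerXn.
rewrite hornerD hornerM hornerX hornerC -[_ b]/(rho b).
set g := _.[sigma] => hc.
(* By Cayley-Hamilton a power of sigma times g sigma + b vanishes. As sigma is outside the prime
   [PT], the second factor lies in it, and one further sigma kills it: so -(g sigma) squares to b
   times itself. *)
have hL : PT (Lam (g * sigma + rho b)).
  move: (cong_Lam hc); rewrite rmorphM => /(primeM primePT) [|//].
  by rewrite rmorphXn => /(primeX primePT)/nPT_sigma.
have hs := sigma_kernel hL.
exists b, (- (g * sigma)), (- g); split=> //; first by rewrite mulNr.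
  rewrite (_ : _ - _ = g * (sigma * (g * sigma + rho b))); first exact: (idealMl _ icong).
  by ring.
rewrite -rmorphB (_ : _ - _ = - (g * sigma + rho b)); last by ring.
by rewrite rmorphN; apply: (idealN iPT).
Qed.

Let eps : {rmorphism S2 -> S1} := map_poly (horner_eval 0).

Local Lemma eps_coef u i : (eps u)`_i = (u`_i)`_0.
Proof. by rewrite /eps /= coef_map /= horner_evalE horner_coef0. Qed.

Local Lemma eps_PhiY p : eps (PhiY p) = p.
Proof. by apply/polyP => i; rewrite eps_coef PhiYE coef_map /= Phi_coef0. Qed.

Local Lemma evBY_eps u : evBY (eps u) = (Lam u)`_0.
Proof.
rewrite -horner_coef0 -horner_evalE.
apply: (poly_sq_eq (f := eps) (g := evBY) (f' := Lam) (g' := horner_eval 0)) => [t|].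
  rewrite [eps _]map_polyC evBYC LamC.
  apply: (poly_sq_eq (f := horner_eval 0) (g := evB) (f' := LamT) (g' := horner_eval 0)) => [b|].
    by rewrite LamTC /= !horner_evalE hornerC horner_coef0 coef_map Phi_coef0.
  by rewrite LamTX /= !horner_evalE hornerX hornerN hornerX oppr0 rmorph0.
by rewrite [eps _]map_polyX evBYX LamX /= horner_evalE hornerC.
Qed.

(* The coordinates of [e * Delta / b] in the basis [V] are traces of products with an
   idempotent, hence lie in [B] with bounded degree; [U] is the resulting element at T = 0. *)
Lemma interpolation_along_direction : exists U : {poly B},
  [/\ poly_filt degB kap (kap * r%:Z + d%:Z) U,
      P (evBY U - evBY f^`() * evB ((Phi q)`_1)) &
      forall p, P (evBY p) -> exists a b, U * p = a * f + b * q%:P].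
Proof.
have [b [e [g [nb eg ee Le]]]] := idempotent_mod.
have nphib : phi b != 0 by rewrite tofrac_eq0.
pose E : 'M[K]_#|_| := (phi b)^-1 *: map_mx phi (Mat e).
have MM := mulmatM dbS; have MC z z' : Mat z *m Mat z' = Mat z' *m Mat z.
  by rewrite -!MM mulrC.
have EE : E *m E = E.
  rewrite /E -scalemxAl -scalemxAr -map_mxM -MM (mulmat_eq dbS ee) MM (mulmat_rho dbS).
  by rewrite mul_scalar_mx map_mxZ scalerA mulVf // scale1r.
have EC x : E *m map_mx phi (Mat (V' x)) = map_mx phi (Mat (V' x)) *m E.
  by rewrite /E -scalemxAl -scalemxAr -!map_mxM MC.
have N0 : (0 < #|{: 'I_r.+1 * 'I_d.+1}|)%N by rewrite card_prod !card_ord.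
have hz x := idempotent_trace facB strictB N0 (Mat_fw x) EE (EC x).
pose zeta x := sval (constructive_indefinite_description _ (hz x)).
have [zw ztr] : (forall x, degB (kap * r%:Z + d%:Z - wt x) (zeta x)) /\
    forall x, \tr (E *m map_mx phi (Mat (V' x))) = phi (zeta x).
  by split=> x; rewrite /zeta; case: constructive_indefinite_description => z [].
(* The trace formula: [zeta] gives the coordinates of e Delta / b in the basis [V], which are
   therefore in B although e / b is not. *)
have bz x : b * zeta x = lam (e * V' x * Delta).
  rewrite -DeltaE -(mulmat_tr dbS) -/Mat; apply: phi_inj.
  rewrite -/phi rmorphM -ztr /E -scalemxAl linearZ /= -map_mxM trace_map_mx.
  by rewrite mulrA mulfV // mul1r -MM.
pose U2 := \sum_x rho (zeta x) * V x.
have bU2 : cong (rho b * U2 - e * Delta).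
  have -> : rho b * U2 = \sum_x rho (lam (e * Delta * V' x)) * V x.
    rewrite mulr_sumr; apply: eq_bigr => x _; rewrite mulrA -rmorphM bz.
    by congr (rho (lam _) * _); ring.
  by rewrite -opprB; apply: (idealN icong); apply: (db_expand dbS).
have wU2 : W2 (kap * r%:Z + d%:Z) U2.
  apply: fw_sum => x _; apply: (fw_eq (m := (kap * r%:Z + d%:Z - wt x) + wt x)).
    by rewrite subrK.
  by apply: fwM; [apply: poly_fwC; apply: poly_fwC|exact: V_fw].
have wc0 : degB 0 c0.
  by rewrite -qtop; apply: fw_eq (Phi_filt wq d.+1); rewrite mul1r subrr.
(* The factor [c0] undoes the normalization of [qm] by its inverse. *)
exists (c0%:P * eps U2); split.
- apply: (fw_eq (w := poly_filt degB kap) (add0r _)).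
  apply: (fwM (f := poly_filt degB kap)); first exact: poly_fwC.
  move=> i; rewrite eps_coef; apply: fw_eq (wU2 i 0%N).
  by rewrite mulr0 subr0.
(* Modulo [PT] the idempotent e / b is 1, and b may be cancelled because [PT_rho] keeps it outside
   [PT]. *)
- have hL : PT (Lam U2 - Lam Delta).
    have hb : ~ PT (Lam (rho b)) by move/PT_rho/eqP; apply/negP.
    have : PT (Lam (rho b) * (Lam U2 - Lam Delta)).
      rewrite (_ : _ * _ = (Lam (rho b) * Lam U2 - Lam e * Lam Delta) +
        (Lam e - Lam (rho b)) * Lam Delta); last by ring.
      apply: (idealD iPT); last exact: (idealMr _ iPT).
      by rewrite -!rmorphM -rmorphB; apply: cong_Lam.
    by case/(primeM primePT).
  have := hL 0%N; rewrite coefB -!evBY_eps /Delta rmorphM.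
  have -> : eps (qm^`())%:P = (c0' * (Phi q)`_1)%:P.
    rewrite [LHS]map_polyC /= horner_evalE horner_coef0 coef_deriv mulr1n /qm coefCM.
    by [].
  have -> : eps fP^`() = f^`().
    apply/polyP => i; rewrite eps_coef !coef_deriv coefMn /fP PhiYE coef_map.
    by rewrite Phi_coef0.
  move=> h; rewrite rmorphM evBYC.
  rewrite (_ : _ - _ = evB c0 * (evBY (eps U2) - evBY ((c0' * (Phi q)`_1)%:P * f^`()))).
    exact: (idealMl _ iP).
  rewrite rmorphM evBYC rmorphM mulrBr; congr (_ - _).
  rewrite [RHS]mulrA [evB c0 * _]mulrA -rmorphM [c0 * _]mulrC c0V rmorph1 mul1r.
  by rewrite mulrC.
- move=> p Pp.
  have h1 : cong (sigma * PhiY p).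
    by apply: sigma_kernel; rewrite Lam_PhiY => -[|i]; rewrite coefC //=; apply: (ideal0 iP).
  have h2 : cong (rho b * (U2 * PhiY p)).
    rewrite (_ : _ * _ = (rho b * U2 - e * Delta) * PhiY p + g * Delta * (sigma * PhiY p)).
      by apply: (idealD icong); [apply: (idealMr _ icong)|apply: (idealMl _ icong)].
    by rewrite eg; ring.
  (* The algebra is free over the domain B, so b cancels, as is seen on multiplication matrices. *)
  have [c [a ea]] : cong (U2 * PhiY p).
    apply: (cong_mulmat dbS); rewrite -/Mat.
    have := mulmat_cong dbS h2; rewrite MM (mulmat_rho dbS) mul_scalar_mx => h3.
    apply/matrixP => i j; move/matrixP/(_ i j)/eqP: h3; rewrite !mxE mulf_eq0 (negPf nb).
    by move/eqP.
  exists (c0%:P * eps a), (eps c).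
  have eqm : eps qm%:P = (c0' * q)%:P.
    by rewrite [LHS]map_polyC /= horner_evalE horner_coef0 /qm coefCM Phi_coef0.
  have := congr1 eps ea; rewrite rmorphB [eps (a * _)]rmorphM
    [eps (U2 * _)]rmorphM [eps (c * _)]rmorphM eqm /fP !eps_PhiY => /eqP.
  rewrite subr_eq => /eqP e2; rewrite -mulrA e2 mulrDr !mulrA; congr (_ + _).
  transitivity ((c0' * c0)%:P * (eps c * q%:P)); last by rewrite c0V mul1r.
  rewrite !polyCM; ring.
Qed.

End Interpolation.

(** * Directions in which a polynomial keeps its full degree *)

Section Infinite.
Variable k : fieldType.
Hypothesis char0 : [pchar k] =i pred0.

Lemma natr_inj (m n : nat) : m%:R = n%:R :> k -> m = n.
Proof.
have h : forall a b : nat, (a <= b)%N -> a%:R = b%:R :> k -> a = b.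
  move=> a b le e; have /eqP : (b - a)%:R = 0 :> k by rewrite natrB // e subrr.
  by rewrite (proj1 (pcharf0P k) char0) subn_eq0 => le'; apply/eqP; rewrite eqn_leq le.
by case: (leqP m n) => [/h//|/ltnW/h e /esym/e].
Qed.

Lemma poly_nonroot (p : {poly k}) : p != 0 -> exists t, p.[t] != 0.
Proof.
move=> np; apply: NNPP => h.
have hr t : root p t by apply/negPn/negP => nr; apply: h; exists t.
suff : (size [seq m%:R : k | m <- iota 0 (size p)] < size p)%N.
  by rewrite size_map size_iota ltnn.
apply: max_poly_roots => //; first by apply/allP => t _; apply: hr.
by rewrite map_inj_uniq ?iota_uniq // => a b; apply: natr_inj.
Qed.

Lemma meval_polyC_horner n (v : 'I_n -> {poly k}) (p : {mpoly k[n]}) t :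
  (meval_mor (polyC : {rmorphism k -> {poly k}}) v p).[t] = p.@[fun i => (v i).[t]].
Proof.
apply: (mpoly_tri_eq (f := meval_mor (polyC : {rmorphism k -> {poly k}}) v)
  (g := horner_eval t) (h := meval_mor idfun (fun i => (v i).[t]))) => [c|i].
  by rewrite 2!meval_morC /= horner_evalE hornerC.
by rewrite 2!meval_morX /= horner_evalE.
Qed.

Lemma mpoly_nonvanish n (p : {mpoly k[n]}) : p != 0 -> exists w : 'I_n -> k, p.@[w] != 0.
Proof.
elim: n p => [|n IH] p np.
  exists (fun=> 0); have e : p = (p@_0%MM)%:MP.
    apply/mpolyP => m; rewrite mcoeffC.
    by have -> : m = 0%MM by [apply/mnmP; case]; rewrite eqxx mulr1.
  by rewrite e mevalC; apply: contraNneq np => h; rewrite e h mpolyC0.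
have np' : poly_of_mpoly k n p != 0.
  by apply: contraNneq np => h; rewrite -(@poly_of_mpolyK k n p) h rmorph0.
have [|w hw] := IH (lead_coef (poly_of_mpoly k n p)); first by rewrite lead_coef_eq0.
have nu : map_poly (meval w) (poly_of_mpoly k n p) != 0.
  apply: contraNneq hw => /(congr1 (fun u : {poly k} => u`_(size (poly_of_mpoly k n p)).-1)).
  by rewrite coef_map coef0 => /eqP.
have [t ht] := poly_nonroot nu.
exists (fun i => if unlift ord_max i is Some j then w j else t).
suff <- : (map_poly (meval w) (poly_of_mpoly k n p)).[t] =
    p.@[fun i => if unlift ord_max i is Some j then w j else t] by [].
apply: (mpoly_tri_eq (f := @poly_of_mpoly k n) (g := hmorph (meval_mor idfun w) t)
  (h := meval_mor idfun (fun i => if unlift ord_max i is Some j then w j else t))) => [c|i].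
  by rewrite /poly_of_mpoly 2!meval_morC /= hmorphC meval_morC.
rewrite /poly_of_mpoly 2!meval_morX; case: unliftP => [j _|_].
  by rewrite hmorphC meval_morX.
by rewrite hmorphX.
Qed.

End Infinite.

Section Directions.
Variables (k : fieldType) (n : nat).
Local Notation B := {mpoly k[n]}.

Lemma translate_inverse (w : 'I_n -> k) (b : B) :
  (map_poly (translate w) (translate w b)).[- 'X] = b%:P.
Proof.
apply: (mpoly_tri_eq (f := translate w) (g := hmorph (translate w) (- 'X)) (h := polyC)) => [c|i].
  by rewrite translateC hmorphC translateC.
rewrite translateX rmorphD rmorphM hmorphX 2!hmorphC translateX translateC.
by rewrite mulrN addrK.
Qed.

Lemma translate_coef1 (w : 'I_n -> k) (b : B) :
  (translate w b)`_1 = \sum_i w i *: b^`M(i).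
Proof.
elim/mpoly_gen_ind: b => [c|i|p q hp hq|p q hp hq].
- rewrite translateC coefC big1 // => i _; by rewrite mderivC scaler0.
- rewrite translateX coefD coefC add0r coefMX coefC /= (bigD1 i) //= big1.
    have e0 : (U_(i) - U_(i))%MM = 0%MM by apply/mnmP => j; rewrite mnmBE subnn mnmE.
    by rewrite mderivX mnm1E eqxx e0 mpolyX0 mulr1n scale1r addr0 alg_mpolyC.
  move=> j nji; rewrite mderivX mnm1E eq_sym (negPf nji) scale0r scaler0 //.
- rewrite [translate w _]rmorphD coefD.
  apply: etrans (congr2 +%R hp hq) _; rewrite -big_split /=; apply: eq_bigr => i _.
  by rewrite mderivD scalerDr.
- rewrite [translate w _]rmorphM coefM 2!big_ord_recl big_ord0 addr0 /= /bump /= addn0.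
  apply: etrans (congr2 +%R (congr2 *%R (translate_coef0 w p) hq)
    (congr2 *%R hp (translate_coef0 w q))) _.
  rewrite mulr_sumr mulr_suml -big_split; apply: eq_bigr => i _ /=.
  by rewrite mderivM scalerDr scalerAl scalerAr addrC.
Qed.

Definition top_form (d : nat) (q : B) : B := \sum_(m <- msupp q | mdeg m == d) q@_m *: 'X_[m].

Lemma top_form_coef d (q : B) m : (top_form d q)@_m = if mdeg m == d then q@_m else 0.
Proof.
rewrite /top_form raddf_sum /= -big_filter.
have [dm|dm] := eqVneq (mdeg m) d; last first.
  rewrite big1_seq // => m' /andP[_]; rewrite mem_filter => /andP[/eqP dm' _].
  rewrite mcoeffZ mcoeffX; have -> : (m' == m) = false; last by rewrite mulr0.
  by apply/negP => /eqP e; move: dm; rewrite -dm' e eqxx.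
have [ms|ms] := boolP (m \in msupp q); last first.
  rewrite memN_msupp_eq0 // big1_seq // => m' /andP[_]; rewrite mem_filter => /andP[_ ms'].
  rewrite mcoeffZ mcoeffX; have -> : (m' == m) = false; last by rewrite mulr0.
  by apply/negP => /eqP e; move: ms; rewrite -e ms'.
rewrite (bigD1_seq m) ?filter_uniq ?msupp_uniq ?mem_filter ?dm ?eqxx //=.
rewrite mcoeffZ mcoeffX eqxx mulr1 big1 ?addr0 // => m' /negPf nm.
by rewrite mcoeffZ mcoeffX nm mulr0.
Qed.

Lemma top_form_neq0 (q : B) : q != 0 -> top_form (msz q).-1 q != 0.
Proof.
move=> nq; have e := mlead_deg nq.
apply/eqP => /(congr1 (mcoeff (mlead q))); rewrite top_form_coef mcoeff0.
rewrite /msz -e eqxx; apply/eqP; by rewrite mleadc_eq0.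
Qed.

(** The coefficient of T^d has degree at most 0 in x, so it is a constant and may be computed at x =
    0, where q(wT) appears. *)
Lemma translate_top (w : 'I_n -> k) d (q : B) : deg_filt k n d%:Z q ->
  (translate w q)`_d = ((top_form d q).@[w])%:MP.
Proof.
move=> hq; have := @translate_filt k n w _ _ hq d; rewrite mul1r subrr => /deg_filt0P ->.
congr (_%:MP).
have -> : ((translate w q)`_d)@_0%MM =
    (meval_mor (polyC : {rmorphism k -> {poly k}}) (fun i => (w i)%:P * 'X) q)`_d.
  rewrite -[in RHS](mpoly_tri_eq (f := translate w) (g := map_poly (mcoeff 0%MM))
    (h := meval_mor (polyC : {rmorphism k -> {poly k}}) (fun i => (w i)%:P * 'X))) => [|c|i].
  - by rewrite coef_map.
  - by rewrite translateC meval_morC [LHS]map_polyC /= mcoeffC eqxx mulr1.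
  rewrite translateX meval_morX rmorphD rmorphM /= !map_polyC /= map_polyX mcoeffC eqxx mulr1.
  by rewrite mcoeffX mnm1_eq0 polyC0 add0r.
rewrite /meval_mor /= /mmap coef_sum /top_form raddf_sum /= [RHS]big_mkcond.
apply: eq_bigr => m _; rewrite coefCM mevalZ mevalX.
have -> : mmap1 (fun i => (w i)%:P * 'X) m = (\prod_i w i ^+ m i)%:P * 'X^(mdeg m).
  rewrite /mmap1 mdegE -prodrXr rmorph_prod -big_split; apply: eq_bigr => i _ /=.
  by rewrite exprMn rmorphXn.
rewrite coefCM coefXn eq_sym; case: ifP => _; first by rewrite mulr1.
by rewrite !mulr0.
Qed.

End Directions.

Definition ev_coord (k : fieldType) (A : comNzRingType) (iota : {rmorphism k -> A}) (n : nat)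
  (x : 'I_n -> A) : {rmorphism {mpoly k[n]} -> A} := meval_mor iota x.

Definition ev_pair (k : fieldType) (A : comNzRingType) (iota : {rmorphism k -> A}) (n : nat)
  (x : 'I_n -> A) (y : A) : {rmorphism {poly {mpoly k[n]}} -> A} := hmorph (ev_coord iota x) y.

Section LogNumerator.
Variables (k : fieldType) (A : idomainType) (iota : {rmorphism k -> A}) (n : nat).
Hypothesis char0 : [pchar k] =i pred0.
Variables (x : 'I_n -> A) (y : A).
Local Notation B := {mpoly k[n]}.
Local Notation degB := (deg_filt k n).
Local Notation evB := (ev_coord iota x).
Local Notation evBY := (ev_pair iota x y).

Lemma ev_pairC b : evBY b%:P = evB b. Proof. exact: hmorphC. Qed.
Lemma ev_pairX : evBY 'X = y. Proof. exact: hmorphX. Qed.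
Lemma ev_coordC c : evB c%:MP = iota c. Proof. exact: meval_morC. Qed.
Lemma ev_coordX i : evB 'X_i = x i. Proof. exact: meval_morX. Qed.

Variables (P : A -> Prop) (q : B) (f : {poly B}) (r : nat) (s : {poly B}) (kap : int).
Hypotheses (primeP : is_prime_ideal P) (Pq : P (evB q)) (nq : q != 0).
Hypothesis PBq : forall b, P (evB b) -> multiple q b.
Hypotheses (mf : f \is monic) (sf : size f = r.+2) (fy : evBY f = 0).
Hypothesis wf : poly_filt degB kap (kap * r.+1%:Z) f.
Hypothesis nPs : ~ P (evBY s).
Hypothesis sP : forall p, P (evBY p) -> exists a b, s * p = a * f + b * q%:P.

Lemma prime_gen_nonconst : (1 < msz q)%N.
Proof.
rewrite ltnNge; apply/negP => /msize1_polyC e; have [iP [n1 _]] := primeP.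
have nc : q@_0%MM != 0 by apply: contraNneq nq => h; rewrite e h mpolyC0.
apply: n1; rewrite -(rmorph1 iota) -(mulVf nc) rmorphM; apply: (idealMl _ iP).
by rewrite -ev_coordC -e.
Qed.

(** The second clause says that U/(f' q) has the same polar part at [P] as g/q; the third, U P
    inside (q), that it has no pole at the other primes above [q]. *)
Definition is_log_numerator (g : B) (U : {poly B}) :=
  [/\ poly_filt degB kap (kap * r%:Z + (msz q - 2)%:Z) U,
      P (evBY U - evBY f^`() * evB g) &
      forall p, P (evBY p) -> exists a b, U * p = a * f + b * q%:P].

Lemma log_numerator_direction (w : 'I_n -> k) : (top_form (msz q).-1 q).@[w] != 0 ->
  exists U, is_log_numerator (\sum_i w i *: q^`M(i)) U.
Proof.
set c := _.@[w] => nc; set d := (msz q - 2)%N.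
have sz := prime_gen_nonconst; have ed : (msz q).-1 = d.+1 by rewrite /d; lia.
have wq : degB d.+1%:Z q by move=> _; rewrite -ed; lia.
have qtop : (translate w q)`_d.+1 = c%:MP by rewrite (translate_top w wq) -ed.
have sPhi : size (translate w q) = d.+2.
  apply/eqP; rewrite eqn_leq; apply/andP; split.
    by apply: leq_trans (size_translate w q) _; rewrite /d; lia.
  rewrite ltnNge; apply/negP => /leq_sizeP/(_ d.+1 (leqnn _)).
  by rewrite qtop => /eqP; rewrite mpolyC_eq0 (negPf nc).
rewrite -translate_coef1.
apply: (@interpolation_along_direction A B degB (@msz k n) (@factorial_mpoly k n)
  (@deg_filt_strict k n) evB evBY y ev_pairC ev_pairX P q f r s kap primeP Pq PBq _ mf sf fy wf
  nPs sP d (c%:MP) (c^-1%:MP) (translate w) (map_poly (translate w)) (@translate_filt k n w)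
  (translate_coef0 w) (translate_inverse w) _ wq _ _ sPhi qtop
  (hmorph (map_poly evB \o translate w) (- 'X))
  (hmorph (hmorph (map_poly evB \o translate w) (- 'X)) y%:P) _ _ _
  (hmorph (map_poly (translate w)) (- 'X%:P)) _) => //.
- move=> b /eqP nb; rewrite mszM //; have := msz_gt0 nb; lia.
- by rewrite -mpolyCM mulVf // mpolyC1.
- exact: (@deg_filtC _ _ 0%N).
- by move=> t; apply: hmorphC.
- exact: hmorphX.
Qed.

Lemma log_numeratorB a g1 g2 U1 U2 : is_log_numerator g1 U1 -> is_log_numerator g2 U2 ->
  is_log_numerator (a *: (g1 - g2)) ((a%:MP)%:P * (U1 - U2)).
Proof.
have iP := proj1 primeP.
move=> [w1 h1 s1] [w2 h2 s2]; split.
- apply: (fw_eq (w := poly_filt degB kap) (add0r _)).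
  apply: (fwM (f := poly_filt degB kap)); last exact: (fwB (w := poly_filt degB kap)).
  by apply: poly_fwC; apply: (@deg_filtC _ _ 0%N).
- rewrite rmorphM ev_pairC rmorphB -mul_mpolyC rmorphM rmorphB mulrCA -mulrBr.
  apply: (idealMl _ iP); rewrite (_ : _ - _ = (evBY U1 - evBY f^`() * evB g1) -
    (evBY U2 - evBY f^`() * evB g2)); last by ring.
  exact: (idealB iP).
- move=> p Pp; have [a1 [b1 e1]] := s1 _ Pp; have [a2 [b2 e2]] := s2 _ Pp.
  exists ((a%:MP)%:P * (a1 - a2)), ((a%:MP)%:P * (b1 - b2)).
  transitivity ((a%:MP)%:P * (U1 * p - U2 * p)); first by ring.
  by rewrite e1 e2; ring.
Qed.

(** The top form of [q] may vanish on the i-th axis. Two good directions differing by t times the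
    i-th basis vector give the partial derivative as a difference. *)
Lemma log_numerator i : exists U, is_log_numerator q^`M(i) U.
Proof.
have [w0 h0] := mpoly_nonvanish char0 (top_form_neq0 nq).
set h := top_form _ q in h0.
pose u := meval_mor (polyC : {rmorphism k -> {poly k}})
  (fun j => (w0 j)%:P + (j == i)%:R%:P * 'X) h.
(* The factor 'X excludes t = 0, which must be inverted below. *)
have nu : u * 'X != 0.
  rewrite mulf_neq0 ?polyX_eq0 //; apply: contraNneq h0 => u0.
  have := meval_polyC_horner (fun j => (w0 j)%:P + (j == i)%:R%:P * 'X) h 0.
  rewrite -/u u0 horner0 => e; rewrite (_ : h.@[w0] = 0) // [RHS]e.
  by apply: meval_eq => j; rewrite hornerD hornerM hornerX !hornerC mulr0 addr0.
have [t] := poly_nonroot char0 nu; rewrite hornerMX mulf_eq0 negb_or => /andP[ut nt].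
pose w1 j := w0 j + (j == i)%:R * t.
have h1 : h.@[w1] != 0.
  move: ut; rewrite /u meval_polyC_horner; congr (_ != 0); apply: meval_eq => j.
  by rewrite hornerD hornerM hornerX !hornerC.
have [U0 hU0] := log_numerator_direction h0; have [U1 hU1] := log_numerator_direction h1.
exists ((t^-1%:MP)%:P * (U1 - U0)).
have -> : q^`M(i) = t^-1 *: (\sum_j w1 j *: q^`M(j) - \sum_j w0 j *: q^`M(j)).
  rewrite -sumrB (bigD1 i) //= big1 => [|j nji]; last first.
    by rewrite /w1 (negPf nji) mul0r addr0 subrr.
  by rewrite /w1 eqxx mul1r addr0 -scalerBl addrC addKr scalerA mulVf // scale1r.
exact: log_numeratorB.
Qed.

End LogNumerator.

(** * Transcendence basis and primitive element *)

Section FractionMap.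
Variables (B : idomainType) (F : fieldType) (phi : {rmorphism B -> F}).
Hypothesis injphi : injective phi.

(** Carrying the injectivity proof in the term allows the morphism structures, which depend on it,
    to be inferred. *)
Definition frac_map of injective phi := fun z : {fraction B} =>
  phi (\n_(repr z)) / phi (\d_(repr z)).

Local Notation fm := (frac_map injphi).

Lemma frac_map_neq0 b : b != 0 -> phi b != 0.
Proof. by apply: contraNneq => h; apply/eqP/injphi; rewrite h rmorph0. Qed.

Lemma frac_mapE (n d : B) : d != 0 -> fm (tofrac n / tofrac d) = phi n / phi d.
Proof.
move=> nd; set z := _ / _; have nz := denom_ratioP (repr z).
apply/eqP; rewrite /frac_map eqr_div ?frac_map_neq0 // -!rmorphM; apply/eqP; congr (phi _).
have tz : tofrac (\d_(repr z)) != 0 by rewrite tofrac_eq0.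
have td : tofrac d != 0 by rewrite tofrac_eq0.
apply/eqP; rewrite -tofrac_eq !tofracM -eqr_div //; apply/eqP.
by rewrite -frac_repr.
Qed.

Lemma frac_map_is_zmod_morphism : zmod_morphism fm.
Proof.
move=> u v; rewrite {1}(frac_repr u) {1}(frac_repr v).
set a := \n_(repr u); set b := \d_(repr u); set c := \n_(repr v); set d := \d_(repr v).
have nb : b != 0 := denom_ratioP _; have nd : d != 0 := denom_ratioP _.
have -> : tofrac a / tofrac b - tofrac c / tofrac d = tofrac (a * d - c * b) / tofrac (b * d).
  by rewrite -mulNr addf_div ?tofrac_eq0 // tofracB !tofracM mulNr.
rewrite frac_mapE ?mulf_neq0 // /frac_map -/a -/b -/c -/d.
by rewrite rmorphB !rmorphM; field; rewrite !frac_map_neq0.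
Qed.

Lemma frac_map_is_monoid_morphism : monoid_morphism fm.
Proof.
split.
  by rewrite -[1]divr1 -tofrac1 frac_mapE ?oner_neq0 // rmorph1 divr1.
move=> u v; rewrite {1}(frac_repr u) {1}(frac_repr v) mulf_div -!tofracM.
rewrite frac_mapE ?mulf_neq0 ?denom_ratioP // !rmorphM -mulf_div.
by [].
Qed.

HB.instance Definition _ := GRing.isZmodMorphism.Build {fraction B} F fm frac_map_is_zmod_morphism.
HB.instance Definition _ := GRing.isMonoidMorphism.Build {fraction B} F fm frac_map_is_monoid_morphism.

Definition frac_mor : {rmorphism {fraction B} -> F} := fm.

Lemma frac_mor_tofrac b : frac_mor (tofrac b) = phi b.
Proof.
by rewrite -[tofrac b]divr1 -tofrac1 [LHS]frac_mapE ?oner_neq0 // rmorph1 divr1.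
Qed.

End FractionMap.

Section AlgebraicElements.
Variables (B A : idomainType) (ev : {rmorphism B -> A}).

Definition alg_over (a : A) := exists2 p : {poly B}, p != 0 & hmorph ev a p = 0.

Hypothesis injev : injective ev.
Let K := {fraction B}.
Let L := {fraction A}.
Let evL : {rmorphism B -> L} := @FracField.tofrac A \o ev.

Lemma injevL : injective evL.
Proof. by move=> u v /eqP; rewrite tofrac_eq => /eqP/injev. Qed.

Let KL : {rmorphism K -> L} := frac_mor injevL.

Lemma KL_tofrac (p : {poly B}) (a : A) :
  (map_poly KL (map_poly (@FracField.tofrac B) p)).[tofrac a] = tofrac (hmorph ev a p).
Proof.
rewrite -map_poly_comp (eq_map_poly (g := evL)); last by move=> b; apply: frac_mor_tofrac.
by rewrite map_poly_comp horner_map.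
Qed.

Lemma alg_overP a : alg_over a <-> algebraicOver KL (tofrac a).
Proof.
split=> [[p np hp]|[p np hp]].
  exists (map_poly (@FracField.tofrac B) p).
    by rewrite map_poly_eq0_id0 ?tofrac_eq0 ?lead_coef_eq0.
  by rewrite /root KL_tofrac hp tofrac0.
have [c [h [nc e]]] := clear_denominators p.
exists h.
  apply: contraNneq np => h0; move: e; rewrite h0 rmorph0 => /eqP.
  by rewrite scaler_eq0 tofrac_eq0 => /orP[/eqP|].
have : tofrac (hmorph ev a h) = 0.
  rewrite -KL_tofrac -e map_polyZ hornerZ.
  by move/rootP: hp => ->; rewrite mulr0.
by move/eqP; rewrite tofrac_eq0 => /eqP.
Qed.

Lemma alg_over_ev b : alg_over (ev b).
Proof.
exists ('X - b%:P); first by rewrite polyXsubC_eq0.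
by rewrite rmorphB hmorphX hmorphC subrr.
Qed.

Lemma alg_overD a b : alg_over a -> alg_over b -> alg_over (a + b).
Proof. by move=> /alg_overP ha /alg_overP hb; apply/alg_overP; rewrite tofracD; exact: (algebraic_add ha hb). Qed.

Lemma alg_overM a b : alg_over a -> alg_over b -> alg_over (a * b).
Proof. by move=> /alg_overP ha /alg_overP hb; apply/alg_overP; rewrite tofracM; exact: (algebraic_mul ha hb). Qed.

Lemma alg_overN a : alg_over a -> alg_over (- a).
Proof. by move=> /alg_overP ha; apply/alg_overP; rewrite tofracN; exact: (algebraic_opp ha). Qed.

Definition gen_by (y a : A) := exists (b : B) (p : {poly B}), b != 0 /\ ev b * a = hmorph ev y p.

Lemma gen_by_frac y a : (exists p : {poly K}, (map_poly KL p).[tofrac y] = tofrac a) <-> gen_by y a.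
Proof.
split=> [[p e]|[b [p [nb e]]]].
  have [c [h [nc eh]]] := clear_denominators p; exists c, h; split; first exact/eqP.
  apply/eqP; rewrite -tofrac_eq -KL_tofrac -eh map_polyZ hornerZ e tofracM.
  by apply/eqP; congr (_ * _); rewrite [RHS]frac_mor_tofrac.
exists ((tofrac b)^-1 *: map_poly (@FracField.tofrac B) p).
rewrite map_polyZ hornerZ KL_tofrac -e tofracM fmorphV [KL _]frac_mor_tofrac.
by rewrite mulKf // tofrac_eq0; apply: contraNneq nb => h; apply/eqP/injev; rewrite h rmorph0.
Qed.

Lemma gen_by_trans y z a : gen_by z y -> gen_by y a -> gen_by z a.
Proof.
move=> /gen_by_frac[p ep] /gen_by_frac[q eq]; apply/gen_by_frac; exists (q \Po p).
by rewrite map_comp_poly horner_comp ep eq.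
Qed.

Hypothesis char0 : [pchar B] =i pred0.

Lemma primitive_two x y : alg_over x -> alg_over y ->
  exists z, [/\ alg_over z, gen_by z x & gen_by z y].
Proof.
move=> ax ay; have [/alg_overP [p np rp]] := (ax, tt).
move=> _; have /alg_overP [q nq rq] := ay.
have cK : [pchar K] =i pred0.
  apply/pcharf0P => m; rewrite -(rmorph_nat (@FracField.tofrac B)) tofrac_eq0.
  by move: m; apply/pcharf0P.
have [m [hx hy]] := pchar0_PET np rp nq rq cK.
have e : tofrac y *+ m - tofrac x = tofrac (y *+ m - x) by rewrite tofracB tofracMn.
exists (y *+ m - x); split; last 2 first.
- by apply/gen_by_frac; rewrite -e.
- by apply/gen_by_frac; rewrite -e.
apply: alg_overD; last exact: alg_overN.
rewrite -mulr_natr; apply: alg_overM => //.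
by rewrite -(rmorph_nat ev); apply: alg_over_ev.
Qed.

Lemma primitive_seq (l : seq A) : (forall a, a \in l -> alg_over a) ->
  exists y, alg_over y /\ forall a, a \in l -> gen_by y a.
Proof.
elim: l => [|a l IH] h; first by exists (ev 0); split=> //; apply: alg_over_ev.
have [|y [ay hy]] := IH; first by move=> b bl; apply: h; rewrite inE bl orbT.
have [z [az za zy]] := primitive_two (h a (mem_head _ _)) ay.
exists z; split=> // b; rewrite inE => /orP[/eqP->//|/hy].
exact: gen_by_trans.
Qed.

End AlgebraicElements.

Section TranscendenceBasis.
Variables (k : fieldType) (A : idomainType) (iota : {rmorphism k -> A}).

Lemma ev_coord_recr n (x : 'I_n.+1 -> A) p :
  ev_coord iota x p = hmorph (ev_coord iota (fun i => x (lift ord_max i))) (x ord_max)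
    (poly_of_mpoly k n p).
Proof.
symmetry; apply: (mpoly_tri_eq (f := poly_of_mpoly k n)
  (g := hmorph (ev_coord iota (fun i => x (lift ord_max i))) (x ord_max))
  (h := ev_coord iota x)) => [c|i].
  by rewrite /poly_of_mpoly meval_morC /= hmorphC !ev_coordC.
rewrite /poly_of_mpoly meval_morX ev_coordX; case: unliftP => [j ->|->].
  by rewrite hmorphC ev_coordX.
by rewrite hmorphX.
Qed.

(** Greedy choice: a generator that is not algebraic over the current variables becomes the new last
    variable, and earlier algebraic relations are carried along the inclusion of polynomial
    rings. *)
Lemma transcendence_basis (gens : seq A) : exists n (x : 'I_n -> A),
  injective (ev_coord iota x) /\ forall g, g \in gens -> alg_over (ev_coord iota x) g.
Proof.
elim: gens => [|g gens [n [x [inj hg]]]].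
  exists 0%N, (fun=> 0); split=> // p q.
  have e (u : {mpoly k[0]}) : u = (u@_0%MM)%:MP.
    apply/mpolyP => m; rewrite mcoeffC.
    by have -> : m = 0%MM by [apply/mnmP; case]; rewrite eqxx mulr1.
  by rewrite (e p) (e q) !ev_coordC => /fmorph_inj ->.
have [ag|nag] := classic (alg_over (ev_coord iota x) g).
  by exists n, x; split=> // a; rewrite inE => /orP[/eqP->|/hg].
pose x' (i : 'I_n.+1) := if unlift ord_max i is Some j then x j else g.
have ex : (fun i => x' (lift ord_max i)) =1 x by move=> i; rewrite /x' liftK.
have emax : x' ord_max = g by rewrite /x' unlift_none.
have ev_x b : ev_coord iota (fun i => x' (lift ord_max i)) b = ev_coord iota x b.
  apply: (mpoly_mor_eq (f := ev_coord iota (fun i => x' (lift ord_max i)))) => [c|i].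
    by rewrite !ev_coordC.
  by rewrite !ev_coordX ex.
have ev_gx (u : A) p : hmorph (ev_coord iota (fun i => x' (lift ord_max i))) u p =
    hmorph (ev_coord iota x) u p.
  apply: (poly_mor_eq (f := hmorph (ev_coord iota (fun i => x' (lift ord_max i))) u)) => [c|].
    by rewrite !hmorphC ev_x.
  by rewrite !hmorphX.
have inj0 p : ev_coord iota x' p = 0 -> p = 0.
  rewrite ev_coord_recr ev_gx emax => h0.
  rewrite -(@poly_of_mpolyK k n p); apply/eqP; apply: contraT => np; case: nag.
  exists (poly_of_mpoly k n p) => //.
  by apply: contraNneq np => ->; rewrite rmorph0.
have inj' : injective (ev_coord iota x').
  move=> p q /eqP; rewrite -subr_eq0 -rmorphB => /eqP/inj0/eqP.
  by rewrite subr_eq0 => /eqP.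
have ev_widen b : ev_coord iota x' (mpoly_widen k n b) = ev_coord iota x b.
  apply: (mpoly_tri_eq (f := mpoly_widen k n) (g := ev_coord iota x')) => [c|i].
    by rewrite /mpoly_widen meval_morC !ev_coordC.
  by rewrite /mpoly_widen meval_morX !ev_coordX ex.
exists n.+1, x'; split=> // a; rewrite inE => /orP[/eqP->|/hg[p np hp]].
  exists ('X - ('X_ord_max)%:P); first by rewrite polyXsubC_eq0.
  by rewrite rmorphB hmorphX hmorphC ev_coordX emax subrr.
exists (map_poly (mpoly_widen k n) p).
  rewrite map_poly_eq0_id0 ?lead_coef_eq0 //; apply: contraNneq np => h0.
  rewrite -lead_coef_eq0; apply/eqP/inj; rewrite -ev_widen h0.
  by rewrite !rmorph0.
rewrite -hp; apply: (poly_tri_eq (f := map_poly (mpoly_widen k n))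
  (g := hmorph (ev_coord iota x') a) (h := hmorph (ev_coord iota x) a)) => [b|].
  apply: etrans (congr1 (hmorph (ev_coord iota x') a) (map_polyC (mpoly_widen k n) b)) _.
  by rewrite !hmorphC ev_widen.
apply: etrans (congr1 (hmorph (ev_coord iota x') a) (map_polyX (mpoly_widen k n))) _.
by rewrite !hmorphX.
Qed.

End TranscendenceBasis.

Section IntegralGenerator.
Variables (B A : idomainType) (ev : {rmorphism B -> A}).
Hypothesis injev : injective ev.
Hypothesis char0 : [pchar B] =i pred0.

Lemma integral_multiple y : alg_over ev y -> exists (l : B) (f : {poly B}),
  [/\ l != 0, f \is monic, (1 < size f)%N, hmorph ev (ev l * y) f = 0 &
      forall p : {poly B}, (size p < size f)%N -> hmorph ev (ev l * y) p = 0 -> p = 0].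
Proof.
case=> p0 np0 hp0.
have [N [[p [np hp sp]] Nmin]] := nat_min (ex_intro (fun N => exists p : {poly B},
  [/\ p != 0, hmorph ev y p = 0 & size p = N]) _ (ex_intro _ _ (And3 np0 hp0 erefl))).
have sp1 : (1 < size p)%N.
  rewrite ltnNge; apply/negP => /size1_polyC e; move: hp np; rewrite e hmorphC.
  by rewrite -(rmorph0 ev) => /injev ->; rewrite eqxx.
set l := lead_coef p; have nl : l != 0 by rewrite lead_coef_eq0.
pose m := (size p).-2; have sm : size p = m.+2 by rewrite /m; lia.
(* The powers of [l] are chosen so that f(l Y) = l^m p(Y), with f monic. *)
pose f0 : {poly B} := \sum_(i < m.+1) (p`_i * l ^+ (m - i)) *: 'X^i.
pose f := f0 + 'X^(m.+1).
have sf0 : (size f0 < m.+2)%N.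
  rewrite ltnS; apply: (leq_trans (size_sum _ _ _)); apply/bigmax_leqP => i _.
  by rewrite (leq_trans (size_scale_leq _ _)) // size_polyXn.
have sf : size f = m.+2 by rewrite /f addrC size_polyDl size_polyXn.
exists l, f; split=> //.
- by apply/monicP; rewrite /f addrC lead_coefDl ?size_polyXn // lead_coefXn.
- by rewrite sf.
- have e : hmorph ev (ev l * y) f = ev l ^+ m * hmorph ev y p.
    have evZ (u : A) c j : hmorph ev u (c *: 'X^j) = ev c * u ^+ j.
      by rewrite -mul_polyC rmorphM hmorphC rmorphXn hmorphX.
    have ep : p = \sum_(i < m.+1) p`_i *: 'X^i + l *: 'X^(m.+1).
      by rewrite -[LHS]coefK poly_def sm big_ord_recr /= /l lead_coefE sm.
    have ey : hmorph ev y p = \sum_(i < m.+1) ev p`_i * y ^+ i + ev l * y ^+ m.+1.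
      rewrite {1}ep rmorphD rmorph_sum evZ; congr (_ + _).
      by apply: eq_bigr => i _; rewrite evZ.
    rewrite ey /f /f0 rmorphD rmorph_sum rmorphXn hmorphX mulrDr mulr_sumr; congr (_ + _).
      apply: eq_bigr => i _; rewrite evZ rmorphM rmorphXn exprMn.
      have le_im : (i <= m)%N by rewrite -ltnS.
      have -> : ev l ^+ m = ev l ^+ (m - i) * ev l ^+ i by rewrite -exprD subnK.
      by ring.
    by rewrite exprMn exprS; ring.
  by rewrite e hp mulr0.
- move=> g sg hg; apply/eqP; apply: contraT => ng.
  pose g' := g \Po (l%:P * 'X).
  have sg' : size g' = size g.
    by rewrite /g' size_comp_poly2 // mul_polyC size_scale // size_polyX.
  have hg' : hmorph ev y g' = 0.
    rewrite -hg; apply: (poly_tri_eq (f := comp_poly (l%:P * 'X)) (g := hmorph ev y)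
      (h := hmorph ev (ev l * y))) => [b|].
      by apply: etrans (congr1 (hmorph ev y) (comp_polyC b _)) _; rewrite !hmorphC.
    by apply: etrans (congr1 (hmorph ev y) (comp_polyX _)) _; rewrite rmorphM hmorphC !hmorphX.
  case: (Nmin (size g)).
    by rewrite -sp sm -sf.
  by exists g'; split=> //; rewrite -size_poly_gt0 sg' size_poly_gt0.
Qed.

Lemma gen_by_multiple y (l : B) a : l != 0 -> gen_by ev y a -> gen_by ev (ev l * y) a.
Proof.
move=> nl; apply: gen_by_trans => //; exists l, 'X; split=> //.
by rewrite hmorphX.
Qed.

(** In a relation of least degree for [a], the constant term is nonzero, else [a] could be divided
    out; the rest of the relation writes it as a multiple of [a]. *)
Lemma alg_inverse y a : alg_over ev a -> a != 0 -> (exists p, hmorph ev y p = a) ->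
  exists b v, b != 0 /\ a * hmorph ev y v = ev b.
Proof.
move=> [p0 np0 hp0] na [pa epa].
have [N [[p [np hp sp]] Nmin]] := nat_min (ex_intro (fun N => exists p : {poly B},
  [/\ p != 0, hmorph ev a p = 0 & size p = N]) _ (ex_intro _ _ (And3 np0 hp0 erefl))).
have [p1 [c ep]] : exists p1 c, p = p1 * 'X + c%:P.
  exists (drop_poly 1 p), p`_0; rewrite -[LHS](poly_take_drop 1 p) expr1 addrC; congr (_ + _).
  apply/polyP => i; rewrite coef_take_poly coefC; by case: i.
have hp1 : hmorph ev a p1 * a = - ev c.
  by apply/eqP; rewrite -addr_eq0 -hp ep rmorphD rmorphM hmorphX hmorphC.
have nc : c != 0.
  apply/eqP => c0; move: hp1; rewrite c0 rmorph0 oppr0 => /eqP.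
  rewrite mulf_eq0 (negPf na) orbF => /eqP hp1.
  have np1 : p1 != 0 by apply: contraNneq np => h; rewrite ep h c0 mul0r addr0.
  case: (Nmin (size p1)); last by exists p1.
  by rewrite -sp ep c0 addr0 size_mulX.
exists c, (- (p1 \Po pa)); split=> //.
rewrite rmorphN mulrN mulrC; apply/eqP; rewrite eqr_oppLR -hp1; apply/eqP; congr (_ * _).
apply: (poly_tri_eq (f := comp_poly pa) (g := hmorph ev y) (h := hmorph ev a)) => [b|].
  by apply: etrans (congr1 (hmorph ev y) (comp_polyC b _)) _; rewrite !hmorphC.
by apply: etrans (congr1 (hmorph ev y) (comp_polyX _)) _; rewrite hmorphX.
Qed.

End IntegralGenerator.

Lemma char0_CC : [pchar CC] =i pred0.
Proof. by apply/pcharf0P => m; exact: (@pnatr_eq0 (complex Rdefinitions.R) m). Qed.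

Lemma char0_mpoly (k : fieldType) n : [pchar k] =i pred0 -> [pchar {mpoly k[n]}] =i pred0.
Proof.
move=> c0; apply/pcharf0P => m; rewrite -mpolyC_nat mpolyC_eq0.
by move: m; apply/pcharf0P.
Qed.

(* A[1/H] = B_H[y] with B = C[x_1..x_n], f the monic minimal polynomial of y over B,
   and f'(y) invertible after inverting H. *)
Record normal_form (A : idomainType) (iota : {rmorphism CC -> A}) := NormalForm {
  nf_n : nat; nf_x : 'I_nf_n -> A; nf_y : A; nf_r : nat;
  nf_f : {poly {mpoly CC[nf_n]}}; nf_H : {mpoly CC[nf_n]}; nf_v : {poly {mpoly CC[nf_n]}};
  nf_kap : nat;
  nf_inj : injective (ev_coord iota nf_x);
  nf_monic : nf_f \is monic;
  nf_size : size nf_f = nf_r.+2;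
  nf_root : ev_pair iota nf_x nf_y nf_f = 0;
  nf_min : forall p : {poly {mpoly CC[nf_n]}}, (size p <= nf_r.+1)%N ->
    ev_pair iota nf_x nf_y p = 0 -> p = 0;
  nf_weight : poly_filt (deg_filt CC nf_n) nf_kap%:Z (nf_kap%:Z * nf_r.+1%:Z) nf_f;
  nf_H0 : nf_H != 0;
  nf_gen : forall a, exists j p, ev_coord iota nf_x nf_H ^+ j * a = ev_pair iota nf_x nf_y p;
  nf_alg : forall a, alg_over (ev_coord iota nf_x) a;
  nf_etale : ev_pair iota nf_x nf_y nf_f^`() * ev_pair iota nf_x nf_y nf_v
    = ev_coord iota nf_x nf_H }.

Section NormalFormExists.
Variables (A : idomainType) (iota : {rmorphism CC -> A}).

(** If the weight of Y bounds the degrees of all coefficients, no term is heavier than the leading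
    power of Y. *)
Lemma monic_weight (n r : nat) (f : {poly {mpoly CC[n]}}) : f \is monic -> size f = r.+2 ->
  exists kap : nat, poly_filt (deg_filt CC n) kap%:Z (kap%:Z * r.+1%:Z) f.
Proof.
move=> mf sf; have [K hK] : exists K : nat, forall i, (msz f`_i <= K)%N.
  exists (\max_(i < size f) msz f`_i) => i.
  have [lt|le] := ltnP i (size f); first exact: (leq_bigmax (Ordinal lt)).
  by rewrite nth_default // /msz msize0.
exists K => i; have [lt|le] := ltnP i r.+1.
  have h : (K * i + K <= K * r.+1)%N by rewrite addnC -mulnS leq_mul2l lt orbT.
  move=> _; have := hK i; move: h; rewrite -!PoszM; move: (K * i)%N (K * r.+1)%N (msz _) => a b c; lia.
have [->|ne] := eqVneq i r.+1.
  move=> _; rewrite (_ : f`_r.+1 = 1) /msz ?msize1 ?subrr //.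
  by move/monicP: mf; rewrite /lead_coef sf.
by rewrite nth_default ?sf; [exact: fw0 | move: le ne; lia].
Qed.

Variables (n : nat) (x : 'I_n -> A).
Local Notation ev := (ev_coord iota x).

Lemma common_denominator (y : A) (gens : seq A) : (forall g, g \in gens -> gen_by ev y g) ->
  exists H, H != 0 /\ forall g, g \in gens -> exists p, ev H * g = hmorph ev y p.
Proof.
elim: gens => [|g gens IH] h; first by exists 1; rewrite oner_neq0.
have [|H [nH hH]] := IH; first by move=> b bl; apply: h; rewrite inE bl orbT.
have [b [p [nb e]]] := h g (mem_head _ _).
exists (H * b); split; first by rewrite mulf_neq0.
move=> g'; rewrite inE => /orP[/eqP->|/hH[p' e']].
  by exists (H%:P * p); rewrite !rmorphM hmorphC -mulrA e.
by exists (b%:P * p'); rewrite !rmorphM hmorphC -e'; ring.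
Qed.

Lemma subalg_denominator (y : A) (gens : seq A) H : (forall g, g \in gens -> exists p, ev H * g = hmorph ev y p) ->
  forall a, in_subalg iota gens a -> exists j p, ev H ^+ j * a = hmorph ev y p.
Proof.
move=> hH a; elim=> {a} [c|g /hH[p e]|a b _ [i [p e]] _ [j [q e']]|a b _ [i [p e]] _ [j [q e']]].
- by exists 0%N, (c%:MP)%:P; rewrite expr0 mul1r hmorphC ev_coordC.
- by exists 1%N, p; rewrite expr1.
- exists (i + j)%N, ((H ^+ j)%:P * p + (H ^+ i)%:P * q).
  by rewrite rmorphD !rmorphM !hmorphC !rmorphXn exprD -e -e'; ring.
- by exists (i + j)%N, (p * q); rewrite rmorphM exprD -e -e'; ring.
Qed.

End NormalFormExists.

Theorem normal_form_exists (A : idomainType) (iota : {rmorphism CC -> A}) :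
  finitely_generated iota -> inhabited (normal_form iota).
Proof.
case=> gens hgens; have [n [x [inj ag]]] := transcendence_basis iota gens.
have cB := char0_mpoly n char0_CC.
have alg a : alg_over (ev_coord iota x) a.
  elim: (hgens a) => {a} [c|g /ag//|a b _ ha _ hb|a b _ ha _ hb].
  - by rewrite -(ev_coordC iota x); apply: alg_over_ev.
  - exact: alg_overD.
  - exact: alg_overM.
have [y0 [ay0 gy0]] := primitive_seq inj cB ag.
have [l [f [nl mf sf fy fmin]]] := integral_multiple inj ay0.
set y := _ * y0 in fy fmin.
have [|H0 [nH0 hH0]] := @common_denominator _ iota n x y gens.
  by move=> g /gy0; apply: gen_by_multiple.
have [r sfr] : exists r, size f = r.+2 by exists (size f).-2; lia.
(* By minimality f' would be the zero polynomial, against characteristic 0 since f is monic. A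
   nonzero multiple [c] of f'(y) in B is then included in H. *)
have nf' : hmorph (ev_coord iota x) y f^`() != 0.
  apply/eqP => h0.
  have sf' : (size f^`() < size f)%N by apply: lt_size_deriv; rewrite monic_neq0.
  have := fmin _ sf' h0 => /(congr1 (fun p : {poly _} => p`_r)).
  rewrite coef_deriv coef0; have -> : f`_r.+1 = 1 by move/monicP: mf; rewrite /lead_coef sfr.
  by move/eqP; rewrite (proj1 (pcharf0P _) cB).
have [|c [v [nc ev_]]] := alg_inverse (y := y) (alg _) nf'; first by exists f^`().
have [kap wf] := monic_weight mf sfr.
have hH a := subalg_denominator hH0 (hgens a).
constructor.
refine (@NormalForm A iota n x y r f (H0 * c) (v * H0%:P) kap inj mf sfr fy _ wf _ _ alg _).
- by move=> p sp; apply: fmin; rewrite sfr ltnS.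
- by rewrite mulf_neq0.
- move=> a; have [j [p e]] := hH a; exists j, ((c ^+ j)%:P * p).
  by rewrite rmorphM exprMn [RHS]rmorphM ev_pairC rmorphXn -[ev_pair _ _ _ p]e; ring.
- by rewrite [ev_pair _ _ _ (v * _)]rmorphM ev_pairC mulrA [X in X * _]ev_ rmorphM mulrC.
Qed.

(** * Derivations *)

Section DerivationExtension.
Variables (S : comNzRingType) (F : fieldType) (ev : {rmorphism S -> F}).
Hypothesis frac_ev : forall z, exists p v, ev v != 0 /\ z = ev p / ev v.

Definition derivation (D : F -> F) :=
  (forall u v, D (u + v) = D u + D v) /\ (forall u v, D (u * v) = u * D v + v * D u).

Variable d : S -> F.
Hypotheses (dD : forall p q, d (p + q) = d p + d q)
  (dM : forall p q, d (p * q) = ev p * d q + ev q * d p)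
  (d0 : forall p, ev p = 0 -> d p = 0).

Local Lemma d_zero : d 0 = 0. Proof. by apply: d0; rewrite rmorph0. Qed.
Local Lemma dN p : d (- p) = - d p.
Proof. by apply/eqP; rewrite -addr_eq0 -dD addNr d_zero. Qed.

Local Lemma quotient_rule_wd p v p' v' : ev v != 0 -> ev v' != 0 -> ev p / ev v = ev p' / ev v' ->
  (ev v * d p - ev p * d v) / ev v ^+ 2 = (ev v' * d p' - ev p' * d v') / ev v' ^+ 2.
Proof.
move=> nv nv' /eqP; rewrite eqr_div // => /eqP e.
have : d (p * v' - p' * v) = 0 by apply: d0; rewrite rmorphB !rmorphM e subrr.
rewrite dD dN !dM => h.
have ep : ev p = ev p' * ev v / ev v' by rewrite -e mulfK.
have edp : ev v' * d p = ev p' * d v + ev v * d p' - ev p * d v'.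
  apply/eqP; rewrite -subr_eq0 -h; apply/eqP; ring.
apply/eqP; rewrite eqr_div ?expf_neq0 //; apply/eqP.
apply: (mulfI nv').
transitivity ((ev v * (ev v' * d p) - ev v' * ev p * d v) * ev v' ^+ 2); first by ring.
rewrite edp ep; field; exact: nv'.
Qed.

Let num z := sval (constructive_indefinite_description _ (frac_ev z)).
Local Lemma num_ex z : exists v, ev v != 0 /\ z = ev (num z) / ev v.
Proof. by rewrite /num; case: constructive_indefinite_description. Qed.
Let den z := sval (constructive_indefinite_description _ (num_ex z)).
Local Lemma denP z : ev (den z) != 0 /\ z = ev (num z) / ev (den z).
Proof. by rewrite /den; case: constructive_indefinite_description. Qed.

Let D z := (ev (den z) * d (num z) - ev (num z) * d (den z)) / ev (den z) ^+ 2.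

Local Lemma D_quotient p v : ev v != 0 ->
  D (ev p / ev v) = (ev v * d p - ev p * d v) / ev v ^+ 2.
Proof.
by move=> nv; have [nd e] := denP (ev p / ev v); apply: quotient_rule_wd.
Qed.

(** Only the vanishing of [d] on the kernel of [ev] is asked, so that it applies to A and also to
    B[Y], whose evaluation at y kills f. *)
Lemma derivation_extension : exists D, derivation D /\ forall p, D (ev p) = d p.
Proof.
exists D; split; last first.
  have d1 : d 1 = 0.
    by have := dM 1 1; rewrite mulr1 rmorph1 !mul1r => /eqP; rewrite addrC -subr_eq subrr eq_sym => /eqP.
  move=> p; rewrite -[ev p]divr1 -(rmorph1 ev) D_quotient ?rmorph1 ?oner_neq0 //.
  by rewrite d1 mul1r mulr0 subr0 expr1n divr1.
have pair z z' : exists p p' v, [/\ ev v != 0, z = ev p / ev v & z' = ev p' / ev v].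
  have [nv e] := denP z; have [nv' e'] := denP z'.
  exists (num z * den z'), (num z' * den z), (den z * den z').
  rewrite !rmorphM mulf_neq0 //; split=> //; first by rewrite -mulf_div divff // mulr1.
  by rewrite [X in _ / X]mulrC -mulf_div divff // mulr1.
split=> z z'; have [p [p' [v [nv -> ->]]]] := pair z z'.
  rewrite -mulrDl -rmorphD !D_quotient // dD rmorphD; field; exact: nv.
rewrite mulf_div -!rmorphM !D_quotient ?rmorphM ?mulf_neq0 // !dM.
by field; exact: nv.
Qed.

End DerivationExtension.

Section DerivationTheory.
Variables (F : fieldType) (D : F -> F).
Hypothesis derD : derivation D.

Lemma derD_add u v : D (u + v) = D u + D v. Proof. by case: derD. Qed.
Lemma derD_mul u v : D (u * v) = u * D v + v * D u. Proof. by case: derD. Qed.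
Lemma derD0 : D 0 = 0.
Proof. by apply: (addrI (D 0)); rewrite -derD_add !addr0. Qed.
Lemma derD_sum (T : Type) (r : seq T) (Q : pred T) (G : T -> F) :
  D (\sum_(i <- r | Q i) G i) = \sum_(i <- r | Q i) D (G i).
Proof. exact: (big_morph D derD_add derD0). Qed.
Lemma derD1 : D 1 = 0.
Proof.
have := derD_mul 1 1; rewrite mulr1 !mul1r => /eqP.
by rewrite addrC -subr_eq subrr eq_sym => /eqP.
Qed.
Lemma derD_div u v : v != 0 -> D (u / v) = (v * D u - u * D v) / v ^+ 2.
Proof.
move=> nv; have h : D u = u / v * D v + v * D (u / v).
  by rewrite -derD_mul divfK.
by apply: (mulfI nv); rewrite h; field; exact: nv.
Qed.
Lemma derDX u n : D (u ^+ n.+1) = n.+1%:R * u ^+ n * D u.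
Proof.
elim: n => [|n IH]; first by rewrite expr1 expr0 !mul1r.
by rewrite exprS derD_mul IH [u ^+ n.+1]exprS -[n.+2]addn1 natrD; ring.
Qed.
End DerivationTheory.

Section CoefficientDerivative.
Variables (B : comNzRingType) (d : B -> B).
Hypotheses (dD : forall a b, d (a + b) = d a + d b) (dM : forall a b, d (a * b) = a * d b + b * d a).

Lemma leibniz0 : d 0 = 0.
Proof. by apply: (addrI (d 0)); rewrite -dD !addr0. Qed.

Lemma leibniz1 : d 1 = 0.
Proof.
have := dM 1 1; rewrite mulr1 !mul1r => /eqP.
by rewrite addrC -subr_eq subrr eq_sym => /eqP.
Qed.

Definition coefwise (p : {poly B}) : {poly B} := map_poly d p.

Lemma coefwiseE p i : (coefwise p)`_i = d p`_i.
Proof. by rewrite coef_map_id0 // leibniz0. Qed.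

Lemma coefwiseD p q : coefwise (p + q) = coefwise p + coefwise q.
Proof. by apply/polyP => i; rewrite coefD !coefwiseE coefD dD. Qed.

Lemma coefwiseM p q : coefwise (p * q) = p * coefwise q + q * coefwise p.
Proof.
apply/polyP => i; rewrite [q * _]mulrC coefD !coefwiseE !coefM.
rewrite (big_morph d dD leibniz0) -big_split; apply: eq_bigr => j _ /=.
by rewrite !coefwiseE dM [q`__ * _]mulrC.
Qed.

Lemma coefwiseC b : coefwise b%:P = (d b)%:P.
Proof.
by apply/polyP => i; rewrite coefwiseE !coefC; case: ifP => // _; rewrite leibniz0.
Qed.

Lemma coefwiseX : coefwise 'X = 0.
Proof.
apply/polyP => i; rewrite coefwiseE coefX coef0; case: (i == 1%N).
  exact: leibniz1.
exact: leibniz0.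
Qed.

End CoefficientDerivative.

(** * Charts *)

(* [F] is the fraction field of [A], and A[1/H] = B[1/H][y] where [f] is the monic minimal
   polynomial of [y] over [B] and f'(y) is invertible in A[1/H]; [ch_ev] is evaluation at [y]. *)
Record chart (B A : idomainType) (F : fieldType) := Chart {
  ch_F : {rmorphism A -> F}; ch_ev : {rmorphism {poly B} -> A};
  ch_f : {poly B}; ch_r : nat; ch_H : B; ch_v : {poly B};
  ch_F0 : forall a, ch_F a = 0 -> a = 0;
  ch_frac : forall z, exists a b, ch_F b != 0 /\ z = ch_F a / ch_F b;
  ch_inj : forall b, ch_ev b%:P = 0 -> b = 0;
  ch_monic : ch_f \is monic;
  ch_size : size ch_f = ch_r.+2;
  ch_root : ch_ev ch_f = 0;
  ch_min : forall p : {poly B}, (size p <= ch_r.+1)%N -> ch_ev p = 0 -> p = 0;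
  ch_H0 : ch_H != 0;
  ch_gen : forall a, exists j p, ch_ev ((ch_H ^+ j)%:P) * a = ch_ev p;
  ch_alg : forall a, alg_over (ch_ev \o polyC) a;
  ch_etale : ch_ev ch_f^`() * ch_ev ch_v = ch_ev ch_H%:P;
  ch_fact : factorial B; ch_noeth : noetherian A }.

Section ChartTheory.
Variables (B A : idomainType) (F : fieldType) (C : chart B A F).
Local Notation f := (ch_f C).
Local Notation r := (ch_r C).
Local Notation H := (ch_H C).
Local Notation toF := (ch_F C).
Local Notation evA := (ch_ev C).

Definition ch_evB : {rmorphism B -> A} := evA \o polyC.
Definition ch_evF : {rmorphism {poly B} -> F} := toF \o evA.
Definition ch_evFB : {rmorphism B -> F} := ch_evF \o polyC.
Local Notation evB := ch_evB.
Local Notation evF := ch_evF.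
Local Notation evFB := ch_evFB.

Lemma evFE p : evF p = toF (evA p). Proof. by []. Qed.
Lemma evFBE b : evFB b = evF b%:P. Proof. by []. Qed.
Lemma evFBA b : evFB b = toF (evB b). Proof. by []. Qed.

Lemma toF_eq0 a : (toF a == 0) = (a == 0).
Proof.
by apply/eqP/eqP => [|->]; [apply: ch_F0 | rewrite rmorph0].
Qed.

Lemma toF_inj a b : toF a = toF b -> a = b.
Proof.
by move=> h; apply/eqP; rewrite -subr_eq0 -toF_eq0 rmorphB h subrr.
Qed.

Lemma evFB_eq0 b : (evFB b == 0) = (b == 0).
Proof.
rewrite evFBA toF_eq0; apply/eqP/eqP => [|->]; first exact: (@ch_inj _ _ _ C).
by rewrite rmorph0.
Qed.

Lemma evFH_neq0 : evFB H != 0. Proof. by rewrite evFB_eq0 ch_H0. Qed.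

Lemma evF_min (p : {poly B}) : (size p <= r.+1)%N -> evF p = 0 -> p = 0.
Proof. by move=> sp /eqP; rewrite evFE toF_eq0 => /eqP h; apply: ch_min h. Qed.

Lemma evF_min_eq (p p' : {poly B}) : (size p <= r.+1)%N -> (size p' <= r.+1)%N ->
  evF p = evF p' -> p = p'.
Proof.
move=> sp sp' e; apply/eqP; rewrite -subr_eq0; apply/eqP/evF_min.
  by apply: leq_trans (size_polyD _ _) _; rewrite size_polyN geq_max sp sp'.
by rewrite rmorphB e subrr.
Qed.

Lemma evFf : evF f = 0. Proof. by rewrite evFE ch_root rmorph0. Qed.

Lemma evF_reduce (p : {poly B}) : exists (p' a : {poly B}), [/\ (size p' <= r.+1)%N, evF p = evF p',
  p = a * f + p' & forall w kap m, poly_filt w kap (kap * r.+1%:Z) f ->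
    poly_filt w kap m p -> poly_filt w kap m p'].
Proof.
exists (rmodp p f), (rdivp p f); have e := rdivp_eq (ch_monic C) p; split=> //.
- by rewrite -ltnS -(ch_size C) ltn_rmodp monic_neq0 // ch_monic.
- by rewrite {1}e rmorphD rmorphM evFf mulr0 add0r.
- by move=> w kap m wf wp; apply: (rmodp_fw (ch_monic C) (ch_size C) wf wp).
Qed.

Lemma evF_ker p : evF p = 0 -> exists a, p = a * f.
Proof.
have [p' [a [sp e -> _]]] := evF_reduce p; rewrite rmorphD rmorphM evFf mulr0 add0r => h.
by exists a; rewrite (evF_min sp h) addr0.
Qed.

Lemma tofrac_gen a : exists j p, evFB H ^+ j * toF a = evF p.
Proof.
have [j [p e]] := ch_gen C a; exists j, p.
by rewrite evFE -e [RHS]rmorphM -rmorphXn.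
Qed.

Lemma evF_fraction z : exists p v, evF v != 0 /\ z = evF p / evF v.
Proof.
have [a [b [nb ->]]] := ch_frac C z.
have [j [p e]] := tofrac_gen a; have [j' [p' e']] := tofrac_gen b.
have nH := evFH_neq0.
have ep : evF ((H ^+ j')%:P * p) = evFB H ^+ j' * (evFB H ^+ j * toF a).
  by rewrite rmorphM -evFBE rmorphXn -e.
have ep' : evF ((H ^+ j)%:P * p') = evFB H ^+ j * (evFB H ^+ j' * toF b).
  by rewrite rmorphM -evFBE rmorphXn -e'.
exists ((H ^+ j')%:P * p), ((H ^+ j)%:P * p').
rewrite {p e}ep {p' e'}ep'; move: (expf_neq0 j nH) (expf_neq0 j' nH).
move: (evFB H ^+ j) (evFB H ^+ j') => h h' nh nh'.
by rewrite !mulf_neq0 //; split=> //; field; rewrite nb nh nh'.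
Qed.

(** The subring A[1/H] = B[1/H][y] of F. *)
Definition regular (z : F) := exists j p, evFB H ^+ j * z = evF p.

Lemma regular_evF p : regular (evF p).
Proof. by exists 0%N, p; rewrite expr0 mul1r. Qed.

Lemma regular_evFB b : regular (evFB b).
Proof. exact: regular_evF. Qed.

Lemma regular_tofrac a : regular (toF a).
Proof. exact: tofrac_gen. Qed.

Lemma regular_reduced z : regular z -> exists j (p : {poly B}),
  (size p <= r.+1)%N /\ evFB H ^+ j * z = evF p.
Proof.
by move=> [j [p e]]; have [p' [a [sp ep _ _]]] := evF_reduce p; exists j, p'; rewrite -ep.
Qed.

Lemma regularD u v : regular u -> regular v -> regular (u + v).
Proof.
move=> [i [p e]] [j [q e']]; exists (i + j)%N, ((H ^+ j)%:P * p + (H ^+ i)%:P * q).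
by rewrite rmorphD !rmorphM -!evFBE !rmorphXn exprD -e -e'; ring.
Qed.

Lemma regularM u v : regular u -> regular v -> regular (u * v).
Proof.
move=> [i [p e]] [j [q e']]; exists (i + j)%N, (p * q).
by rewrite rmorphM exprD -e -e'; ring.
Qed.

Lemma regularN u : regular u -> regular (- u).
Proof. by move=> [i [p e]]; exists i, (- p); rewrite rmorphN mulrN e. Qed.

Lemma regularB u v : regular u -> regular v -> regular (u - v).
Proof. by move=> hu hv; apply: regularD => //; apply: regularN. Qed.

Lemma regularX u j : regular u -> regular (u ^+ j).
Proof.
move=> h; elim: j => [|j IH]; first by rewrite expr0 -(rmorph1 evF); apply: regular_evF.
by rewrite exprS; apply: regularM.
Qed.

Lemma regular_sum (T : Type) (s : seq T) (Q : pred T) (G : T -> F) :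
  (forall i, Q i -> regular (G i)) -> regular (\sum_(i <- s | Q i) G i).
Proof.
move=> h; apply: big_ind => //; last exact: regularD.
by rewrite -(rmorph0 evF); apply: regular_evF.
Qed.

Lemma regular_Hinv : regular (evFB H)^-1.
Proof. by exists 1%N, 1; rewrite expr1 rmorph1 divff // evFH_neq0. Qed.

Lemma etale_neq0 : evF f^`() != 0.
Proof.
apply: contraNneq evFH_neq0 => h.
by rewrite evFBA /= -ch_etale [X in X == _]rmorphM -evFE h mul0r.
Qed.

Lemma etale_inv : (evF f^`())^-1 = evF (ch_v C) / evFB H.
Proof.
have e : evFB H = evF f^`() * evF (ch_v C).
  by rewrite evFBA /= -ch_etale [LHS]rmorphM.
have nv : evF (ch_v C) != 0 by apply: contraNneq evFH_neq0 => h; rewrite e h mulr0.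
by rewrite e; field; rewrite nv etale_neq0.
Qed.

Lemma regular_etale_inv : regular (evF f^`())^-1.
Proof. by rewrite etale_inv; apply: regularM regular_Hinv; apply: regular_evF. Qed.

(* The constant term of a relation of minimal degree for [s] modulo [I]. *)
Lemma alg_constant_term (I : A -> Prop) (J : B -> Prop) (s : A) : is_prime_ideal I ->
  is_ideal J -> (forall b, J b -> I (evB b)) -> ~ I s ->
  (exists p, I (hmorph evB s p) /\ ~ coef_in J p) ->
  exists c s', ~ J c /\ I (evB c - s * s').
Proof.
move=> pI iJ JI nIs [p0 [Ip0 np0]]; have [iI _] := pI.
have [|m [[p [Ip np sp]] hm]] := @nat_min (fun m => exists p : {poly B},
    [/\ I (hmorph evB s p), ~ coef_in J p & size p = m]); first by exists (size p0), p0.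
pose p1 := \poly_(i < (size p).-1) p`_i.+1.
have ep : p = p1 * 'X + (p`_0)%:P.
  apply/polyP => -[|i]; rewrite coefD coefMX coefC /= ?add0r // addr0 coef_poly.
  by case: ltnP => // h; rewrite nth_default //; case: (size p) h.
have e : hmorph evB s p = hmorph evB s p1 * s + evB p`_0.
  by rewrite {1}ep rmorphD rmorphM hmorphX hmorphC.
exists p`_0, (- hmorph evB s p1); split; last first.
  by rewrite mulrN opprK addrC mulrC -e.
move=> Jc; have Ip1 : I (hmorph evB s p1).
  have : I (hmorph evB s p1 * s) by apply: idealDr iI (JI _ Jc) _; rewrite -e.
  by case/(primeM pI).
have np1 : ~ coef_in J p1.
  move=> h; apply: np; rewrite ep => i; rewrite coefD coefMX coefC.
  case: i => [|i] /=; first by rewrite add0r.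
  by rewrite addr0; apply: h.
have p_neq0 : p != 0.
  by apply/eqP => h; apply: np; rewrite h => i; rewrite coef0; apply: ideal0.
apply: (hm (size p1)); last by exists p1.
rewrite -sp; apply: leq_ltn_trans (size_poly _ _) _.
by rewrite ltn_predL size_poly_gt0.
Qed.

End ChartTheory.

(** * A prime of height one on a chart *)

Lemma prime_valuation (B : idomainType) (q b : B) : factorial B -> prime_elt q -> b != 0 ->
  exists j c, ~ multiple q c /\ b = q ^+ j * c.
Proof.
move=> fB pq nb; have [nq mq] := pq; have iq := proj1 mq.
have [|u [l [[v vu] pl ->]]] := fB b; first exact/eqP.
have nu : ~ multiple q u.
  by move=> h; have [_ [n1 _]] := mq; apply: n1; rewrite -vu; apply: idealMl.
elim: l pl => [|p l IH] pl; first by exists 0%N, u; rewrite big_nil expr0 mul1r mulr1.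
have [|j [c [nc e]]] := IH; first by move=> p' h; apply: pl; rewrite inE h orbT.
have pp : prime_elt p by apply: pl; rewrite mem_head.
have e' : u * \prod_(p0 <- p :: l) p0 = q ^+ j * (p * c).
  by rewrite big_cons mulrCA e mulrCA.
have [qp|nqp] := classic (multiple q p); last first.
  by exists j, (p * c); split=> // /(primeM mq)[].
have [d ed] := prime_elt_assoc pq pp qp; have [d' ed'] := qp.
exists j.+1, (d' * c); split; last by rewrite e' exprSr ed'; ring.
case/(primeM mq) => // h; have [_ [n1 _]] := mq; apply: n1.
have -> : 1 = d * d'; last exact: idealMl.
by apply: (mulIf (_ : q != 0)); [apply/eqP | rewrite mul1r -mulrA -ed'].
Qed.

Arguments ch_F {B A F}. Arguments ch_ev {B A F}. Arguments ch_f {B A F}.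
Arguments ch_H {B A F}. Arguments ch_r {B A F}.

Section PrimeOnChart.
Variables (B A : idomainType) (F : fieldType) (C : chart B A F).
Local Notation f := (ch_f C).
Local Notation r := (ch_r C).
Local Notation H := (ch_H C).
Local Notation toF := (ch_F C).
Local Notation evA := (ch_ev C).
Local Notation evB := (ch_evB C).
Local Notation evF := (ch_evF C).
Local Notation evFB := (ch_evFB C).
Local Notation regular := (regular C).

Variable P : A -> Prop.
Hypotheses (hP : is_height_one_prime P) (nPH : ~ P (evB H)).

Let pP : is_prime_ideal P := proj1 hP.
Let iP : is_ideal P := proj1 pP.

(** A nonzero element of [P] divides a nonzero element of B, the constant term of one of its
    relations; some prime factor of the latter is in [P]. *)
Lemma prime_below : exists q, prime_elt q /\ P (evB q).
Proof.
have [_ [[z [Pz nz]] _]] := hP.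
have zP : is_prime_ideal (fun a : A => a = 0).
  split; first by split=> //; split=> [a b -> ->|a b ->]; rewrite ?addr0 ?mulr0.
  split; first by apply/eqP; rewrite oner_neq0.
  by move=> a b /eqP; rewrite mulf_eq0 => /orP[]/eqP; auto.
have zJ : is_ideal (fun b : B => b = 0).
  by split=> //; split=> [a b -> ->|a b ->]; rewrite ?addr0 ?mulr0.
have [||c [s' [nc hc]]] := @alg_constant_term _ _ _ C _ _ z zP zJ _ nz.
- by move=> b ->; rewrite rmorph0.
- have [p np hp] := ch_alg C z; exists p; split=> // h.
  by case/eqP: np; apply/polyP => i; rewrite h coef0.
have Pc : P (evB c).
  by move/eqP: hc; rewrite subr_eq0 => /eqP ->; apply: idealMr.
have [u [l [[v vu] pl ec]]] := ch_fact C nc.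
have nPu : ~ P (evB u).
  move=> h; have [_ [n1 _]] := pP; apply: n1.
  by rewrite -(rmorph1 evB) -vu rmorphM; apply: idealMl.
have {Pc} : P (evB (\prod_(p <- l) p)).
  by move: Pc; rewrite ec rmorphM => /(primeM pP)[].
elim: l pl {ec} => [|p l IH] pl.
  by rewrite big_nil rmorph1; case: pP => _ [].
rewrite big_cons rmorphM => /(primeM pP)[h|]; first by exists p; split=> //; apply: pl; rewrite mem_head.
by apply: IH => p' h; apply: pl; rewrite inE h orbT.
Qed.

Variable q : B.
Hypotheses (pq : prime_elt q) (Pq : P (evB q)).

Let mq : is_prime_ideal (multiple q) := proj2 pq.
Let nq : q != 0. Proof. by apply/eqP; case: pq. Qed.
Let nqF : evFB q != 0. Proof. by rewrite evFB_eq0. Qed.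

Lemma multiple_in b : multiple q b -> P (evB b).
Proof. by move=> [c ->]; rewrite rmorphM; apply: idealMl. Qed.

Let nqH : ~ multiple q H. Proof. by move=> /multiple_in. Qed.

Lemma not_multiple_prime b j : ~ multiple q b -> ~ multiple q (b ^+ j).
Proof. by move=> nb /(primeX mq). Qed.

(* A[1/H] is free over B[1/H], so divisibility by [q] can be tested on coefficients. *)
Lemma regular_cancel b v : ~ multiple q b -> regular v -> regular (evFB b * v / evFB q) ->
  regular (v / evFB q).
Proof.
move=> nb rv rbv; have [j [p [sp ep]]] := regular_reduced rv.
have [i [p' [sp' ep']]] := regular_reduced rbv.
have sC (c : B) (p0 : {poly B}) : (size p0 <= r.+1)%N -> (size (c%:P * p0)%R <= r.+1)%N.
  by move=> s0; apply: leq_trans s0; rewrite mul_polyC size_scale_leq.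
have e : (H ^+ i * b)%:P * p = (H ^+ j * q)%:P * p'.
  apply: (@evF_min_eq _ _ _ C); rewrite ?sC //.
  by rewrite !rmorphM -!evFBE !rmorphXn -ep -ep'; field.
have hp : coef_in (multiple q) p.
  move=> l; have : multiple q (H ^+ i * b * p`_l).
    exists (H ^+ j * p'`_l); have := congr1 (fun u : {poly B} => u`_l) e.
    by rewrite /= !coefCM => ->; ring.
  case/(primeM mq) => // /(primeM mq)[/(primeX mq)|] //.
have /multiple_polyC [p'' e''] := hp; exists j, p''.
by rewrite mulrA ep e'' rmorphM -evFBE mulfK.
Qed.

Lemma regular_div_in a : regular (toF a / evFB q) -> P a.
Proof.
move=> [j [p e]]; have e' : evB H ^+ j * a = evB q * evA p.
  apply: (@toF_inj _ _ _ C); rewrite !rmorphM rmorphXn -!evFBA.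
  by rewrite -[toF (evA p)]evFE -e; field.
have : P (evB H ^+ j * a) by rewrite e'; apply: idealMr.
by case/(primeM pP) => // /(primeX pP).
Qed.

(** By [height_one_local], s b^m is in qA with s outside [P]. If [q] did not divide b, freeness over
    B[1/H] would cancel b^m, and s would be in qA[1/H], hence in [P]. *)
Lemma prime_contraction b : P (evB b) -> multiple q b.
Proof.
move=> Pb; apply: NNPP => nb.
have nq0 : evB q <> 0 by apply/eqP; rewrite -(toF_eq0 C) -evFBA.
have [s [m [nPs hs]]] := height_one_local (ch_noeth C) hP Pq nq0.
have [c e] := hs _ Pb; apply: nPs; apply: regular_div_in.
apply: (regular_cancel (@not_multiple_prime b m nb)); first exact: regular_tofrac.
have -> : evFB (b ^+ m) * toF s / evFB q = toF c; last exact: regular_tofrac.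
by rewrite evFBA rmorphXn -rmorphM mulrC [_ * s]mulrC e rmorphM -evFBA mulrC mulfK.
Qed.

(* If g has minimal degree among the polynomials vanishing modulo [P] but not modulo [q], then
   g divides f modulo [q], up to a power of its leading coefficient, and s is the cofactor: it
   is outside [P] because f'(y) is. *)
Lemma separating_element : exists s, ~ P (evA s) /\
  forall p, P (evA p) -> exists a b, s * p = a * f + b * q%:P.
Proof.
have icq := coef_in_ideal (proj1 mq).
have pcq := coef_in_prime mq.
have [_ [nq1 _]] := mq.
have [|m [[g [Pg ng sg]] hm]] := @nat_min (fun m => exists g : {poly B},
    [/\ P (evA g), ~ coef_in (multiple q) g & size g = m]).
  exists (size f), f; split=> //; first by rewrite ch_root; apply: ideal0.
  by move=> /(_ r.+1); have /monicP := ch_monic C; rewrite /lead_coef ch_size => ->.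
have small (p : {poly B}) : P (evA p) -> (size p < size g)%N -> coef_in (multiple q) p.
  by move=> Pp sp; apply: NNPP => np; apply: (hm (size p)); rewrite -?sg //; exists p.
have ng0 : g != 0 by apply/eqP => h; apply: ng; rewrite h; apply: ideal0.
set b := lead_coef g; pose d := (size g).-1.
have sgd : size g = d.+1 by rewrite /d prednK // size_poly_gt0.
have gd : g`_d = b by [].
(* Otherwise dropping the leading term of g, which lies in [P], would leave a shorter polynomial, so
   g would vanish modulo [q]. *)
have nb : ~ multiple q b.
  move=> qb; have h : coef_in (multiple q) (b%:P * 'X^d).
    by apply: (idealMr _ icq) => i; rewrite coefC; case: ifP => _ //; apply: ideal0; case: mq.
  have Pb : P (evA (b%:P * 'X^d)).
    by rewrite rmorphM; apply: (idealMr _ iP); apply: multiple_in.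
  apply: ng; rewrite -(subrK (b%:P * 'X^d) g); apply: (idealD icq) => //.
  apply: small; first by rewrite rmorphB; apply: idealB.
  rewrite sgd ltnS; apply/leq_sizeP => i; rewrite leq_eqVlt => /orP[/eqP<-|h'].
    by rewrite coefB coefCM coefXn eqxx mulr1 gd subrr.
  by rewrite coefB coefCM coefXn gtn_eqF // mulr0 subr0 nth_default // sgd.
have pdiv (p : {poly B}) : P (evA p) -> exists k a rho,
    (b ^+ k)%:P * p = a * g + rho * q%:P.
  move=> Pp; exists (Pdiv.Idomain.scalp p g), (Pdiv.Idomain.divp p g).
  have e := Pdiv.Idomain.divp_eq p g; rewrite -mul_polyC -/b in e.
  have /multiple_polyC [rho erho] : coef_in (multiple q) (Pdiv.Idomain.modp p g).
    apply: small; last by rewrite Pdiv.Idomain.ltn_modp.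
    apply: (idealDr iP) (_ : P (evA (Pdiv.Idomain.divp p g * g))) _.
      by rewrite rmorphM; apply: idealMl.
    by rewrite addrC -rmorphD -e rmorphM; apply: idealMl.
  by exists rho; rewrite -erho.
have [|k [s [rho ef]]] := pdiv f; first by rewrite ch_root; apply: ideal0.
exists s; split.
  move=> Ps; have : P (evA ((b ^+ k)%:P * f^`())).
    have -> : (b ^+ k)%:P * f^`() = s^`() * g + s * g^`() + rho^`() * q%:P.
      have := congr1 (@deriv B) ef.
      by rewrite derivD !derivM !derivC !mul0r add0r mulr0 addr0.
    rewrite !rmorphD !rmorphM; apply: (idealD iP); last exact: idealMl.
    by apply: (idealD iP); [apply: idealMl | apply: idealMr].
  rewrite rmorphM => /(primeM pP)[h|h].
    by apply: nb; apply: prime_contraction; apply: (@primeX _ _ _ k pP); rewrite -rmorphXn.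
  by apply: nPH; rewrite [evB H](esym (ch_etale C)); apply: idealMr.
move=> p /pdiv[k' [a [rho' ep]]].
have [t [al [st et es _]]] := evF_reduce C (s * p).
pose w := a * - rho + s * rho'.
have [w' [c [sw' ew' ew _]]] := evF_reduce C w.
(* Both sides are reduced modulo f, so equality of values gives equality of polynomials. As [q] does
   not divide b, it divides t, the remainder of s p. *)
have key : (b ^+ k')%:P * t = q%:P * w'.
  apply: (@evF_min_eq _ _ _ C).
  - by apply: leq_trans st; rewrite mul_polyC size_scale_leq.
  - by apply: leq_trans sw'; rewrite mul_polyC size_scale_leq.
  rewrite !rmorphM -ew' -et -[_ * evF (s * p)]rmorphM -[_ * evF w]rmorphM.
  have -> : (b ^+ k')%:P * (s * p) = (b ^+ k)%:P * a * f + q%:P * w.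
    transitivity (s * (a * g + rho' * q%:P)); first by rewrite -ep; ring.
    transitivity (a * (s * g + rho * q%:P) + q%:P * w); first by rewrite /w; ring.
    by rewrite -ef; ring.
  by rewrite rmorphD [evF (_ * f)]rmorphM evFf mulr0 add0r.
have /multiple_polyC [t' e't] : coef_in (multiple q) t.
  move=> i; have : multiple q (b ^+ k' * t`_i).
    by exists w'`_i; rewrite -coefCM key coefCM mulrC.
  by case/(primeM mq) => // /(primeX mq).
by exists al, t'; rewrite es e't.
Qed.

(** A substitute for the norm of [s] modulo [P]: the constant term of a relation for [s] that is
    nontrivial modulo [q]. Any relation becomes so after dividing by [q], at most as often as [q]
    divides its leading coefficient. *)
Lemma norm_of_unit s : ~ P s -> exists b s', ~ multiple q b /\ P (evB b - s * s').
Proof.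
move=> nPs; apply: (alg_constant_term pP (proj1 mq) multiple_in nPs).
have [p np hp] := ch_alg C s.
have [j [b [nb el]]] : exists j b, ~ multiple q b /\ lead_coef p = q ^+ j * b.
  by apply: prime_valuation (ch_fact C) pq _; rewrite lead_coef_eq0.
elim: j p {np} hp el => [|j IH] p hp el.
  exists p; split; first by rewrite hp; apply: ideal0.
  by move=> /(_ (size p).-1); rewrite -lead_coefE el mul1r.
have [h|h] := classic (coef_in (multiple q) p); last first.
  by exists p; split=> //; rewrite hp; apply: ideal0.
have /multiple_polyC [p' ep] := h; apply: (IH p'); last first.
  apply: (mulfI nq); rewrite mulrA -exprS -el ep lead_coefM lead_coefC; exact: mulrC.
have : hmorph evB s p' * evB q = 0 by rewrite -(hmorphC evB s) -rmorphM -ep.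
by move/eqP; rewrite mulf_eq0 => /orP[/eqP//|]; rewrite -(toF_eq0 C) -evFBA (negPf nqF).
Qed.

End PrimeOnChart.

(** * Vector fields on a chart *)

Section DifferentialChart.
Variables (B A : idomainType) (F : fieldType) (C : chart B A F).
Local Notation f := (ch_f C).
Local Notation r := (ch_r C).
Local Notation H := (ch_H C).
Local Notation toF := (ch_F C).
Local Notation evA := (ch_ev C).
Local Notation evB := (ch_evB C).
Local Notation evF := (ch_evF C).
Local Notation evFB := (ch_evFB C).
Local Notation regular := (regular C).

Variables (n : nat) (d : 'I_n -> B -> B).
Hypotheses (dD : forall l a b, d l (a + b) = d l a + d l b)
  (dM : forall l a b, d l (a * b) = a * d l b + b * d l a).

(** [coefwise (d l)] differentiates with Y held fixed, so [c'] is the value of [E] at y. *)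
Definition vector_field (E : F -> F) (c : 'I_n -> F) (c' : F) :=
  [/\ derivation E, forall l, regular (c l), regular c' &
   forall p, E (evF p) = \sum_l c l * evF (coefwise (d l) p) + c' * evF p^`()].

Lemma vector_fieldB E c c' b : vector_field E c c' ->
  E (evFB b) = \sum_l c l * evFB (d l b).
Proof.
case=> _ _ _ h; rewrite evFBE h derivC rmorph0 mulr0 addr0.
by apply: eq_bigr => l _; rewrite coefwiseC.
Qed.

Lemma vector_field_regular E c c' z : vector_field E c c' -> regular z -> regular (E z).
Proof.
case=> dE rc rc' h.
have rE p : regular (E (evF p)).
  rewrite h; apply: regularD; last by apply: regularM => //; apply: regular_evF.
  by apply: regular_sum => l _; apply: regularM => //; apply: regular_evF.
move=> rz; have [j [p e]] := rz.
have -> : E z = (E (evF p) - z * E (evF (H ^+ j)%:P)) * ((evFB H)^-1) ^+ j.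
  rewrite -e (derD_mul dE) -evFBE rmorphXn; have := expf_neq0 j (evFH_neq0 C).
  by rewrite exprVn; move: (evFB H ^+ j) => u nu; field.
apply: regularM; last by apply: regularX; apply: regular_Hinv.
by apply: regularB => //; apply: regularM.
Qed.

(** The relation f(y) = 0 forces the derivative of y to be minus the k-th derivative of f over
    f'(y); it is regular because f'(y) is invertible on the chart. *)
Lemma coordinate_field k : exists D c',
  vector_field D (fun l => (l == k)%:R) c'.
Proof.
pose c := - (evF (coefwise (d k) f) / evF f^`()).
pose E p := evF (coefwise (d k) p) + c * evF p^`().
have nf := etale_neq0 C.
have [||p|D [dD' hD]] := @derivation_extension _ _ evF (evF_fraction C) E.
- by move=> p q; rewrite /E (coefwiseD (dD k)) derivD !rmorphD; ring.
- move=> p q; rewrite /E (coefwiseM (dD k) (dM k)) derivM !rmorphD !rmorphM; ring.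
- move=> /evF_ker [a ->]; rewrite /E (coefwiseM (dD k) (dM k)) derivM !rmorphD !rmorphM evFf /c.
  by field.
exists D, c; split=> //.
- by move=> l; rewrite -(rmorph_nat evF); apply: regular_evF.
- by apply: regularN; apply: regularM; [apply: regular_evF | apply: regular_etale_inv].
- move=> p; rewrite hD; congr (_ + _).
  rewrite (bigD1 k) //= eqxx mul1r big1 ?addr0 // => l /negPf->.
  by rewrite mul0r.
Qed.

Lemma derivation_field (d0 : A -> A) (a : 'I_n -> A) : (forall u v, d0 (u + v) = d0 u + d0 v) ->
  (forall u v, d0 (u * v) = u * d0 v + v * d0 u) ->
  (forall b, d0 (evB b) = \sum_l a l * evB (d l b)) ->
  exists E, vector_field E (fun l => toF (a l)) (toF (d0 (evA 'X))) /\
    forall u, E (toF u) = toF (d0 u).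
Proof.
move=> d0D d0M hB.
have [|||E [dE hE]] := @derivation_extension _ _ toF (ch_frac C) (fun u => toF (d0 u)).
- by move=> u v; rewrite d0D rmorphD.
- by move=> u v; rewrite d0M rmorphD !rmorphM.
- by move=> u /ch_F0 ->; rewrite (leibniz0 d0D) rmorph0.
exists E; split=> //; split=> //; try by move=> *; apply: regular_tofrac.
have EC b : E (evF b%:P) = \sum_l toF (a l) * evFB (d l b).
  rewrite -evFBE evFBA hE hB rmorph_sum; apply: eq_bigr => l _.
  by rewrite rmorphM evFBA.
have EX : E (evF 'X) = toF (d0 (evA 'X)) by rewrite evFE hE.
elim/poly_ind => [|p b IH].
  rewrite rmorph0 (derD0 dE) derivC rmorph0 mulr0 addr0 big1 // => l _.
  by rewrite -[0 : {poly B}]/(0%:P) coefwiseC // leibniz0 // polyC0 rmorph0 mulr0.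
rewrite rmorphD rmorphM (derD_add dE) (derD_mul dE) EC EX IH.
have -> : (p * 'X + b%:P)^`() = p^`() * 'X + p by rewrite derivD derivM derivX derivC mulr1 addr0.
have e l : evF (coefwise (d l) (p * 'X + b%:P)) =
    evF 'X * evF (coefwise (d l) p) + evFB (d l b).
  by rewrite (coefwiseD (dD l)) (coefwiseM (dD l) (dM l)) coefwiseX // mulr0 add0r
    coefwiseC // rmorphD rmorphM.
under [X in _ = X + _]eq_bigr => l _ do rewrite e mulrDr.
rewrite big_split /= rmorphD rmorphM mulrDr mulr_sumr.
under [X in _ = X + _ + _]eq_bigr => l _ do rewrite mulrCA.
by ring.
Qed.

Section Bounded.
Variables (w : filtration B) (kap h : nat).
Hypotheses (wd : forall m l b, w m b -> w m (d l b)) (w_ex : forall b, exists m : nat, w m%:Z b)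
  (wH : w h%:Z H).
Local Notation W := (poly_filt w kap%:Z).

Lemma poly_filt_ex (p : {poly B}) : exists m : nat, W m%:Z p.
Proof.
elim/poly_ind: p => [|p b [m hm]]; first by exists 0%N; apply: fw0.
have [m' hb] := w_ex b; exists (m + kap + m')%N; apply: fwD.
  by apply: fw_le (fwM hm (poly_fwX _ _)); lia.
by apply: fw_le (poly_fwC _ hb); lia.
Qed.

Lemma poly_filt_coefwise m l p : W m p -> W m (coefwise (d l) p).
Proof. by move=> hp i; rewrite coefwiseE //; apply: wd. Qed.

Lemma poly_filt_deriv m p : W m p -> W m p^`().
Proof.
move=> hp i; rewrite coef_deriv -mulr_natr; have := hp i.+1.
have : w 0 (i.+1%:R).
  by elim: (i.+1) => [|k IH]; [apply: fw0 | rewrite -natr1; apply: fwD => //; apply: fw1].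
by move=> h1 h2; apply: fw_le (fwM h2 h1); lia.
Qed.

(* The pole order [K] along [H] is paid for by [h + 1 > deg H] units of degree each, so that
   bounds stay additive and every regular element is of degree 0 for a suitable [K]. *)
Definition bounded (m : int) (K : nat) (z : F) :=
  exists p, evFB H ^+ K * z = evF p /\ W (m + (h.+1 * K)%:Z) p.

Lemma poly_filt_HX j : W (h * j)%:Z (H ^+ j)%:P.
Proof. by apply: poly_fwC; rewrite PoszM; apply: fwX. Qed.

Lemma bounded_le m K K' z : (K <= K')%N -> bounded m K z -> bounded m K' z.
Proof.
move=> le [p [e hp]]; exists ((H ^+ (K' - K))%:P * p); split.
  by rewrite rmorphM -e -evFBE rmorphXn mulrA -exprD subnK.
apply: fw_le (fwM (poly_filt_HX _) hp).
have : (h * (K' - K) + h.+1 * K <= h.+1 * K')%N by nia.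
by move: (h * _)%N (_ * K)%N (_ * K')%N => u v t; lia.
Qed.

(** Multiplying by H^j costs h j in degree while the allowance grows by (h + 1) j, so j degrees are
    gained. *)
Lemma bounded_shift m (j K : nat) z : bounded (m + j%:Z) K z -> bounded m (K + j) z.
Proof.
move=> [p [e hp]]; exists ((H ^+ j)%:P * p); split.
  by rewrite rmorphM -e -evFBE rmorphXn exprD; ring.
apply: fw_le (fwM (poly_filt_HX _) hp).
have : (h * j + j + h.+1 * K = h.+1 * (K + j))%N by nia.
by move: (h * j)%N (_ * K)%N (_ * (_ + _))%N => u v t; lia.
Qed.

Lemma boundedD m K u v : bounded m K u -> bounded m K v -> bounded m K (u + v).
Proof.
move=> [p [e hp]] [p' [e' hp']]; exists (p + p'); split; last exact: fwD.
by rewrite mulrDr e e' rmorphD.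
Qed.

Lemma boundedN m K u : bounded m K u -> bounded m K (- u).
Proof.
by move=> [p [e hp]]; exists (- p); split; [rewrite mulrN e rmorphN | apply: fwN].
Qed.

Lemma bounded0 m K : bounded m K 0.
Proof. by exists 0; rewrite mulr0 rmorph0; split=> //; apply: fw0. Qed.

Lemma bounded_sum m K (T : Type) (s : seq T) (Q : pred T) (G : T -> F) :
  (forall i, Q i -> bounded m K (G i)) -> bounded m K (\sum_(i <- s | Q i) G i).
Proof.
by move=> hG; apply: big_ind => //; [apply: bounded0 | move=> *; apply: boundedD].
Qed.

Lemma boundedM m K m' K' u v : bounded m K u -> bounded m' K' v ->
  bounded (m + m') (K + K') (u * v).
Proof.
move=> [p [e hp]] [p' [e' hp']]; exists (p * p'); split.
  by rewrite rmorphM -e -e' exprD; ring.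
by apply: fw_le (fwM hp hp'); rewrite mulnDr PoszD; move: (h.+1 * K)%N (h.+1 * K')%N => x y; lia.
Qed.

Lemma bounded_evF m p : W m p -> bounded m 0 (evF p).
Proof. by move=> hp; exists p; rewrite expr0 mul1r muln0 addr0. Qed.

Lemma regular_bounded z : regular z -> exists K, bounded 0 K z.
Proof.
move=> [j [p e]]; have [m hm] := poly_filt_ex p.
exists (j + m)%N, ((H ^+ m)%:P * p); split.
  by rewrite rmorphM -e -evFBE rmorphXn exprD; ring.
apply: fw_le (fwM (poly_filt_HX _) hm).
have : (h * m + m <= h.+1 * (j + m))%N by nia.
by move: (h * m)%N (_ * _)%N => u v; lia.
Qed.

Lemma regular_bounded_family (T : finType) (z : T -> F) : (forall i, regular (z i)) ->
  exists K, forall i, bounded 0 K (z i).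
Proof.
move=> rz; have h1 i := constructive_indefinite_description _ (regular_bounded (rz i)).
exists (\max_i sval (h1 i)) => i; apply: bounded_le (svalP (h1 i)).
exact: (leq_bigmax i).
Qed.

Lemma bounded_vector_field E c c' : vector_field E c c' ->
  exists K', forall m K z, bounded m K z -> bounded m (K + K') (E z).
Proof.
move=> vE; have [dE rc rc' hE] := vE.
have [K0 hc] := regular_bounded_family rc.
have [K1 hc'] := regular_bounded rc'.
have [|K2 hH] := @regular_bounded (E (evFB H) / evFB H).
  apply: regularM; last exact: regular_Hinv.
  by apply: vector_field_regular vE _; apply: regular_evFB.
have nH := evFH_neq0 C.
exists (K0 + K1 + K2)%N => m K z bz; have [p [e hp]] := bz.
(* The denominator H^K enters only through the regular quotient E(H)/H, so the increase of the pole
   order does not depend on [K]. *)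
have -> : E z = E (evF p) / evFB H ^+ K - (z * (E (evFB H) / evFB H)) *+ K.
  rewrite -e (derD_mul dE); case: K {bz e hp} => [|K].
    by rewrite expr0 (derD1 dE) invr1 mulr1 mul1r mulr0 addr0 mulr0n subr0.
  rewrite (derDX dE) -mulr_natl !exprS; have := expf_neq0 K nH.
  by move: (evFB H ^+ K) => u nu; field; rewrite nu nH.
apply: boundedD; last first.
  apply: boundedN; elim: (X in _ *+ X) => [|N IH]; first by rewrite mulr0n; apply: bounded0.
  rewrite mulrS; apply: boundedD => //; rewrite -[m]addr0.
  by apply: bounded_le (boundedM bz hH); lia.
have : bounded (m + (h.+1 * K)%:Z) (K0 + K1) (E (evF p)).
  rewrite hE; apply: boundedD.
    apply: bounded_sum => l _; rewrite -[_ + _]add0r.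
    apply: (@bounded_le _ (K0 + 0)); first by rewrite addn0 leq_addr.
    by apply: boundedM (hc l) (bounded_evF (poly_filt_coefwise l hp)).
  rewrite -[_ + _]add0r; apply: (@bounded_le _ (K1 + 0)); first by rewrite addn0 leq_addl.
  by apply: boundedM hc' (bounded_evF (poly_filt_deriv hp)).
move=> [p' [e' hp']]; apply: (@bounded_le _ (K + (K0 + K1))); first by lia.
exists p'; split.
  by rewrite -e' exprD; have := expf_neq0 K nH; move: (evFB H ^+ K) => u nu; field.
by apply: fw_le hp'; rewrite [X in _ <= _ + Posz X]mulnDr; move: (h.+1 * K)%N (h.+1 * _)%N => x y; lia.
Qed.

End Bounded.
End DifferentialChart.

(** * Lie derivatives of logarithmic forms *)

Section LogForms.
Variables (B A : idomainType) (F : fieldType) (C : chart B A F).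
Local Notation f := (ch_f C).
Local Notation r := (ch_r C).
Local Notation H := (ch_H C).
Local Notation toF := (ch_F C).
Local Notation evA := (ch_ev C).
Local Notation evB := (ch_evB C).
Local Notation evF := (ch_evF C).
Local Notation evFB := (ch_evFB C).
Local Notation regular := (regular C).

Variables (n : nat) (d : 'I_n -> B -> B).
Hypotheses (dD : forall l a b, d l (a + b) = d l a + d l b)
  (dC : forall l k b, d l (d k b) = d k (d l b)).

Variables (delta : F -> F) (a : 'I_n -> F) (a' : F) (D : 'I_n -> F -> F) (D' : 'I_n -> F).
Hypotheses (vdelta : vector_field C d delta a a')
  (vD : forall k, vector_field C d (D k) (fun l => (l == k)%:R) (D' k)).

Let ddelta : derivation delta. Proof. by case: vdelta. Qed.
Let dDk k : derivation (D k). Proof. by case: (vD k). Qed.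
Let ra l : regular (a l). Proof. by case: vdelta. Qed.

(* Components of the Lie derivative along [delta] of the 1-form \sum_l omega_l dx_l. *)
Definition lie (omega : 'I_n -> F) (k : 'I_n) : F :=
  delta (omega k) + \sum_l omega l * D k (a l).

Lemma lie_add u v k : lie (fun l => u l + v l) k = lie u k + lie v k.
Proof.
rewrite /lie (derD_add ddelta); under eq_bigr => l _ do rewrite mulrDl.
by rewrite big_split /=; ring.
Qed.

Lemma D_evFB k b : D k (evFB b) = evFB (d k b).
Proof.
rewrite (vector_fieldB dD _ (vD k)) (bigD1 k) //= eqxx mul1r big1 ?addr0 // => l /negPf->.
by rewrite mul0r.
Qed.

(** Cartan's formula for a closed form: the Lie derivative of dq/q is the differential of
    delta(q)/q. It rests on the partial derivatives commuting. *)
Lemma lie_dlog q k : q != 0 ->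
  lie (fun l => evFB (d l q) / evFB q) k = D k (delta (evFB q) / evFB q).
Proof.
rewrite -(evFB_eq0 C) => nq; have hd b := vector_fieldB dD b vdelta.
rewrite /lie (derD_div ddelta) // (derD_div (dDk k)) // D_evFB.
have -> : D k (delta (evFB q)) =
    delta (evFB (d k q)) + \sum_l evFB (d l q) * D k (a l).
  rewrite !hd (derD_sum (dDk k)) -big_split; apply: eq_bigr => l _ /=.
  by rewrite (derD_mul (dDk k)) D_evFB dC.
have -> : \sum_l evFB (d l q) / evFB q * D k (a l) =
    (\sum_l evFB (d l q) * D k (a l)) / evFB q.
  by rewrite mulr_suml; apply: eq_bigr => l _; rewrite mulrAC.
by field.
Qed.

(** Differentiating raises the pole order by one, hence the square of [tau]. *)
Lemma lie_regular omega tau k : regular tau -> (forall l, regular (tau * omega l)) ->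
  regular (tau ^+ 2 * lie omega k).
Proof.
move=> rt rto; have rd z : regular z -> regular (delta z) := vector_field_regular vdelta.
have -> : tau ^+ 2 * lie omega k = tau * delta (tau * omega k) - delta tau * (tau * omega k)
    + tau * \sum_l (tau * omega l) * D k (a l).
  rewrite /lie (derD_mul ddelta) mulrDr [in RHS]mulr_sumr mulr_sumr.
  under [X in _ = _ + X]eq_bigr => l _ do rewrite !mulrA -expr2 -mulrA.
  ring.
apply: regularD.
  by apply: regularB; apply: regularM => //; apply: rd.
apply: regularM => //; apply: regular_sum => l _; apply: regularM => //.
exact: vector_field_regular (vD k) _.
Qed.

Section AtPrime.
Variables (P : A -> Prop) (q : B) (s : {poly B}) (U : 'I_n -> {poly B}).
Hypotheses (hP : is_height_one_prime P) (nPH : ~ P (evB H)) (pq : prime_elt q) (Pq : P (evB q)).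
Hypotheses (nPs : ~ P (evA s))
  (sP : forall p, P (evA p) -> exists b c, s * p = b * f + c * q%:P)
  (UP : forall k p, P (evA p) -> exists b c, U k * p = b * f + c * q%:P)
  (Uq : forall k, P (evA (U k) - evA f^`() * evB (d k q))).
Hypothesis dP : exists2 u, P u & delta (evFB q) = toF u.

Let nq : q != 0. Proof. by apply/eqP; case: pq. Qed.
Let nqF : evFB q != 0. Proof. by rewrite evFB_eq0. Qed.
Let nf : evF f^`() != 0 := etale_neq0 C.

Definition log_form (k : 'I_n) : F := evF (U k) / evF f^`() / evFB q.
Local Notation omega := log_form.

Lemma conductor_regular t u : (forall p, P (evA p) -> exists b c, t * p = b * f + c * q%:P) ->
  P u -> regular (evF t * toF u / evFB q).
Proof.
move=> tP Pu; have [j [p e]] := tofrac_gen C u.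
have Pp : P (evA p).
  have -> : evA p = evB H ^+ j * u.
    by apply: (@toF_inj _ _ _ C); rewrite rmorphM rmorphXn e.
  by apply: idealMl; case: (proj1 hP).
have [b [c ebc]] := tP _ Pp; exists j, c.
have : evF t * evF p = evF c * evFB q by rewrite -rmorphM ebc rmorphD !rmorphM evFf mulr0 add0r.
by rewrite -e => e'; apply: (mulIf nqF); rewrite -e'; field.
Qed.

Lemma in_prime_log_form u k : P u -> regular (toF u * omega k).
Proof.
move=> Pu; have -> : toF u * omega k = (evF f^`())^-1 * (evF (U k) * toF u / evFB q).
  by rewrite /omega; field; rewrite ?nqF ?nf.
by apply: regularM; [apply: regular_etale_inv | apply: conductor_regular (@UP k) Pu].
Qed.

(** The form is dq/q plus [zeta], and [s] clears the pole of [zeta]. Stability of [P] enters here: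
    delta(q) is in [P], so [s] also clears the pole of delta(q)/q, whose differential is the Lie
    derivative of dq/q. *)
Lemma separating_lie k : regular (evF s ^+ 2 * lie omega k).
Proof.
pose zeta l := toF (evA (U l) - evA f^`() * evB (d l q)) / evF f^`() / evFB q.
have -> : lie omega k = lie (fun l => evFB (d l q) / evFB q + zeta l) k.
  rewrite /lie; have e l : omega l = evFB (d l q) / evFB q + zeta l.
    by rewrite /zeta /omega rmorphB rmorphM -evFBA -!evFE; field; rewrite ?nqF ?nf.
  by rewrite e; congr (_ + _); apply: eq_bigr => l _; rewrite e.
rewrite lie_add mulrDr; apply: regularD; last first.
  apply: lie_regular; first exact: regular_evF.
  move=> l; rewrite (_ : _ * _ = (evF f^`())^-1 *
    (evF s * toF (evA (U l) - evA f^`() * evB (d l q)) / evFB q)).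
    by apply: regularM; [apply: regular_etale_inv | apply: conductor_regular sP (Uq l)].
  by rewrite /zeta; field; rewrite ?nqF ?nf.
rewrite lie_dlog //; have [u Pu ->] := dP.
have rs := conductor_regular sP Pu.
have -> : evF s ^+ 2 * D k (toF u / evFB q) =
    evF s * D k (evF s * toF u / evFB q) - D k (evF s) * (evF s * toF u / evFB q).
  by rewrite -mulrA (derD_mul (dDk k) (evF s)); ring.
have rD z : regular z -> regular (D k z) := vector_field_regular (vD k).
by apply: regularB; apply: regularM => //; [apply: regular_evF | apply: rD | apply: rD; apply: regular_evF].
Qed.

Lemma square_lie k : regular (evFB q ^+ 2 * lie omega k).
Proof.
apply: lie_regular; first exact: regular_evFB.
move=> l; rewrite (_ : _ * _ = evF (U l) / evF f^`()); last by rewrite /omega; field; rewrite ?nqF ?nf.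
by apply: regularM; [apply: regular_evF | apply: regular_etale_inv].
Qed.

(* [s] and any element z of [P] clear the pole of the form, hence s^2 and z^2 clear that of its
   Lie derivative; if b = s s' + z, then b^3 is in the ideal (s^2, z^2). *)
Theorem lie_log_form_regular k : regular (lie omega k).
Proof.
have iP := proj1 (proj1 hP).
have [b [s' [nb hb]]] := norm_of_unit (C := C) hP pq Pq nPs.
set z := evB b - _ in hb; have rz := in_prime_log_form _ hb.
have hz := lie_regular k (regular_tofrac C z) (fun l => in_prime_log_form l hb).
have eb : evFB b = evF s * toF s' + toF z.
  by rewrite /z rmorphB rmorphM -evFBA -evFE; ring.
have hb3 : regular (evFB (b ^+ 3) * lie omega k).
  rewrite rmorphXn.
  have -> : evFB b ^+ 3 * lie omega k =
      (evF s * toF s' ^+ 3 + 3%:R * toF s' ^+ 2 * toF z) * (evF s ^+ 2 * lie omega k)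
      + (3%:R * evF s * toF s' + toF z) * (toF z ^+ 2 * lie omega k).
    by rewrite eb; ring.
  have r3 : regular 3%:R by rewrite -(rmorph_nat evF); apply: regular_evF.
  have rs := regular_evF C s; have rs' := regular_tofrac C s'; have rtz := regular_tofrac C z.
  have sl := separating_lie k.
  by repeat (assumption || apply: regularX || apply: regularD || apply: regularM).
have cancel v : regular v -> regular (evFB (b ^+ 3) * v / evFB q) -> regular (v / evFB q).
  by apply: (regular_cancel hP nPH pq Pq); apply: not_multiple_prime.
have h2 := square_lie k; have rq := regular_evFB C q.
have -> : lie omega k = evFB q ^+ 2 * lie omega k / evFB q / evFB q by field; rewrite ?nqF ?nf.
have h1 : regular (evFB q ^+ 2 * lie omega k / evFB q).
  apply: cancel => //.
  rewrite (_ : _ / _ = evFB q * (evFB (b ^+ 3) * lie omega k)); first exact: regularM.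
  by field; rewrite ?nqF ?nf.
apply: cancel => //; rewrite (_ : _ / _ = evFB (b ^+ 3) * lie omega k) //.
by field; rewrite ?nqF ?nf.
Qed.

(** Were b omega_k regular, U_k would lie in [P], hence so would f' times the k-th derivative of
    [q]; but f' is outside [P], and [P] meets B in (q). *)
Lemma log_form_pole k b : ~ multiple q (d k q) -> ~ multiple q b -> ~ regular (evFB b * omega k).
Proof.
move=> nd nb rb; apply: nd; apply: (prime_contraction hP nPH pq Pq).
have [iP _] := proj1 hP.
have : regular (evF (U k) / evF f^`() / evFB q).
  apply: (regular_cancel hP nPH pq Pq nb); last by rewrite -mulrA.
  by apply: regularM; [apply: regular_evF | apply: regular_etale_inv].
move=> /(regularM (regular_evF C f^`())).
rewrite (_ : _ * _ = toF (evA (U k)) / evFB q); last first.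
  by rewrite -evFE; field; rewrite ?nqF ?nf.
move=> /(regular_div_in hP nPH pq)-/(_ Pq) PU; have := Uq k.
rewrite -opprB => /(idealN iP); rewrite opprK => hk.
have : P (evA f^`() * evB (d k q)) by exact: (idealDr iP (idealN iP PU) hk).
case/(primeM (proj1 hP)) => // hf; case: nPH.
by rewrite [evB H](esym (ch_etale C)); apply: idealMr.
Qed.

End AtPrime.
End LogForms.

Section BoundedLie.
Variables (B A : idomainType) (F : fieldType) (C : chart B A F).
Local Notation f := (ch_f C).
Local Notation r := (ch_r C).
Local Notation H := (ch_H C).
Local Notation toF := (ch_F C).
Local Notation evA := (ch_ev C).
Local Notation evB := (ch_evB C).
Local Notation evF := (ch_evF C).
Local Notation evFB := (ch_evFB C).
Local Notation regular := (regular C).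

Variables (n : nat) (d : 'I_n -> B -> B).
Hypotheses (dD : forall l a b, d l (a + b) = d l a + d l b)
  (dC : forall l k b, d l (d k b) = d k (d l b)).
Variables (w : filtration B) (kap h : nat).
Hypotheses (ws : strict w) (wd : forall m l b, w m b -> w m (d l b)) (wH : w h%:Z H)
  (wf : poly_filt w kap%:Z (kap%:Z * r.+1%:Z) f).
Local Notation W := (poly_filt w kap%:Z).
Local Notation bounded := (bounded C w kap h).

Variables (delta : F -> F) (a : 'I_n -> F) (a' : F) (D : 'I_n -> F -> F) (D' : 'I_n -> F).
Hypotheses (vdelta : vector_field C d delta a a')
  (vD : forall k, vector_field C d (D k) (fun l => (l == k)%:R) (D' k)).

Let w_ex b : exists m : nat, w m%:Z b. Proof. by case: ws. Qed.
Let ddelta : derivation delta. Proof. by case: vdelta. Qed.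

(** [K] is fixed before [q]: only 1/f', delta and the derivatives of the [a l] contribute to it. The
    excess kap r of U over deg q is converted into powers of H by [bounded_shift]. *)
Lemma square_lie_bounded : exists K, forall (q : B) (U : 'I_n -> {poly B}) (dq : nat),
  q != 0 -> w dq%:Z q -> (forall k, W (kap%:Z * r%:Z + dq%:Z) (U k)) ->
  forall k, bounded (dq%:Z + dq%:Z) K (evFB q ^+ 2 * lie delta a D (log_form C q U) k).
Proof.
have [Kf hf] := regular_bounded kap w_ex wH (regular_etale_inv C).
have [Kd hd] := bounded_vector_field dD kap wd w_ex wH vdelta.
have rDa (lk : 'I_n * 'I_n) : regular (D lk.2 (a lk.1)).
  by apply: vector_field_regular (vD _) _; case: vdelta.
have [Ka ha] := regular_bounded_family kap w_ex wH rDa.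
pose Ku := (kap * r + Kf)%N; exists (Ku + Kd + Ka)%N => q U dq nq wq wU k.
have nqF : evFB q != 0 by rewrite evFB_eq0.
pose u l := evF (U l) / evF f^`().
have bu l : bounded dq%:Z Ku (u l).
  rewrite -[dq%:Z]addr0; apply: boundedM hf => //.
  rewrite -[(kap * r)%N]add0n; apply: bounded_shift => //; apply: bounded_evF.
  by rewrite PoszM addrC.
have bq : bounded dq%:Z 0 (evFB q) by apply: bounded_evF; apply: poly_fwC.
have -> : evFB q ^+ 2 * lie delta a D (log_form C q U) k =
    evFB q * delta (u k) - u k * delta (evFB q) + \sum_l evFB q * u l * D k (a l).
  rewrite /lie /log_form -/(u _) (derD_div ddelta) // mulrDr; congr (_ + _).
    by rewrite mulrC divfK // expf_neq0.
  by rewrite mulr_sumr; apply: eq_bigr => l _; rewrite -/(u l); field.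
apply: boundedD; last first.
  apply: bounded_sum => l _; rewrite -[_ + _]addr0.
  apply: (@bounded_le _ _ _ C w kap h wH _ (0 + Ku + Ka)); first by lia.
  by apply: boundedM (ha (l, k)); apply: boundedM.
apply: boundedD.
  by apply: (@bounded_le _ _ _ C w kap h wH _ (0 + (Ku + Kd))); [lia | apply: boundedM => //; apply: hd].
apply: boundedN; apply: (@bounded_le _ _ _ C w kap h wH _ (Ku + (0 + Kd))); first by lia.
by apply: boundedM => //; apply: hd.
Qed.

Lemma filt_cancel q (dq : nat) m b : ~ w (dq%:Z - 1) q -> w (dq%:Z + m) (q * b) -> w m b.
Proof.
move=> nw hb; apply: NNPP => nb; have [_ _ h3] := ws.
by apply: (h3 _ _ _ _ nw nb); rewrite (_ : _ + 1 = dq%:Z + m) //; ring.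
Qed.

(* The bound for the numerator over q^2 exceeds a constant by 2 deg q only, and the Lie derivative
   being regular, this numerator is divisible by q^2. *)
Theorem lie_log_form_bounded : exists K, forall P q s U (dq : nat),
  is_height_one_prime P -> ~ P (evB H) -> prime_elt q -> P (evB q) -> ~ P (evA s) ->
  (forall p, P (evA p) -> exists b c, s * p = b * f + c * q%:P) ->
  (forall k p, P (evA p) -> exists b c, U k * p = b * f + c * q%:P) ->
  (forall k, P (evA (U k) - evA f^`() * evB (d k q))) ->
  (exists2 u, P u & delta (evFB q) = toF u) ->
  w dq%:Z q -> ~ w (dq%:Z - 1) q -> (forall k, W (kap%:Z * r%:Z + dq%:Z) (U k)) ->
  forall k, exists g : {poly B}, [/\ (size g <= r.+1)%N,
    evFB H ^+ K * lie delta a D (log_form C q U) k = evF g &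
    forall i, w (h.+1 * K)%:Z g`_i].
Proof.
have [K hK] := square_lie_bounded; exists K.
move=> P q s U dq hP nPH pq Pq nPs sP UP Uq dP wq nwq wU k.
have [/eqP nq mq] := pq; have nqF : evFB q != 0 by rewrite evFB_eq0.
have [p0 [e0 h0]] := hK q U dq nq wq wU k.
have [p [b [sp ep _ hp]]] := evF_reduce C p0; rewrite ep in e0.
have {}hp := hp w kap%:Z _ wf h0.
have rth := lie_log_form_regular dD dC vdelta vD hP nPH pq Pq nPs sP UP Uq dP k.
move: (lie _ _ _ _ _) e0 rth => th e0 /regular_reduced[j [p' [sp' e']]].
(* Both sides are reduced modulo f, so this holds coefficientwise; [q] does not divide H and hence
   divides [p] twice. *)
have e : (H ^+ j)%:P * p = (q * (q * H ^+ K))%:P * p'.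
  apply: (@evF_min_eq _ _ _ C).
  - by apply: leq_trans sp; rewrite mul_polyC size_scale_leq.
  - by apply: leq_trans sp'; rewrite mul_polyC size_scale_leq.
  by rewrite !rmorphM -!evFBE !rmorphXn -e0 -e'; ring.
have nqH : ~ multiple q (H ^+ j).
  by move=> /(primeX mq) /(multiple_in hP Pq).
have /multiple_polyC [t et] : coef_in (multiple q) p.
  move=> i; have : multiple q (H ^+ j * p`_i).
    exists (q * H ^+ K * p'`_i); have := congr1 (fun u : {poly B} => u`_i) e.
    by rewrite /= !coefCM => ->; ring.
  by case/(primeM mq).
have et' : (H ^+ j)%:P * t = (q * H ^+ K)%:P * p'.
  apply: (mulfI (_ : q%:P != 0)); first by rewrite polyC_eq0.
  by rewrite mulrCA [q%:P * t]mulrC -et e rmorphM mulrA.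
have /multiple_polyC [g eg] : coef_in (multiple q) t.
  move=> i; have : multiple q (H ^+ j * t`_i).
    exists (H ^+ K * p'`_i); have := congr1 (fun u : {poly B} => u`_i) et'.
    by rewrite /= !coefCM => ->; ring.
  by case/(primeM mq).
exists g; split.
- apply: leq_trans sp; rewrite et eg.
  by rewrite ![_ * q%:P]mulrC !size_Cmul.
- apply: (mulfI nqF); apply: (mulfI nqF); transitivity (evF p); first by rewrite -e0; ring.
  by rewrite et eg !rmorphM -!evFBE; ring.
- move=> i; apply: (filt_cancel nwq); apply: (filt_cancel nwq).
  have := hp i; rewrite et eg !coefMC => hi.
  by rewrite [q * (q * _)]mulrA [q * q * _]mulrC mulrA; apply: fw_le hi; lia.
Qed.

End BoundedLie.

(** * Flat sections *)

Section Connection.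
Variables (k F : fieldType) (phi : {rmorphism k -> F}) (m n : nat).
Variables (delta : 'I_m -> F -> F) (M : 'I_m -> 'M[F]_n).
Hypotheses (ddelta : forall i, derivation (delta i)) (delta_phi : forall i c, delta i (phi c) = 0).

(** Rows are 1-forms. When entry (l', l) of [M i] is D_l(a_l'), this is the Lie derivative [lie] on
    each row. *)
Definition connection i (N : nat) (Om : 'M[F]_(N, n)) : 'M[F]_(N, n) :=
  map_mx (delta i) Om + Om *m M i.

Lemma delta_mulmx i (N N' p : nat) (c : 'M[F]_(N', N)) (Om : 'M[F]_(N, p)) :
  map_mx (delta i) (c *m Om) = map_mx (delta i) c *m Om + c *m map_mx (delta i) Om.
Proof.
apply/matrixP => a b; rewrite !mxE (derD_sum (ddelta i)) -big_split; apply: eq_bigr => j _ /=.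
by rewrite !mxE (derD_mul (ddelta i)) addrC mulrC [X in _ + X]mulrC [X in X + _]mulrC.
Qed.

Lemma connection_mulmx i (N N' : nat) (c : 'M[F]_(N', N)) (Om : 'M[F]_(N, n)) :
  connection i (c *m Om) = map_mx (delta i) c *m Om + c *m connection i Om.
Proof. by rewrite /connection delta_mulmx mulmxDr mulmxA addrA. Qed.

Lemma connection_const i (N N' : nat) (c : 'M[k]_(N', N)) (Om : 'M[F]_(N, n)) :
  connection i (map_mx phi c *m Om) = map_mx phi c *m connection i Om.
Proof.
rewrite connection_mulmx [map_mx (delta i) _](_ : _ = 0) ?mul0mx ?add0r //.
by apply/matrixP => a b; rewrite !mxE delta_phi.
Qed.

Definition const_free (N : nat) (Om : 'M[F]_(N, n)) :=
  forall mu : 'rV[k]_N, map_mx phi mu *m Om = 0 -> mu = 0.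

(* The coefficients of an F-linear relation of minimal support between horizontal vectors,
   normalized to have one coefficient 1, are constants. *)
Lemma flat_dependence (N : nat) (Om : 'M[F]_(N, n)) : (n < N)%N ->
  (forall i, connection i Om = 0) -> const_free Om ->
  exists z, (forall c, z <> phi c) /\ forall i, delta i z = 0.
Proof.
move=> ltnN flat free.
pose sup (c : 'rV[F]_N) := #|[set j | c 0 j != 0]|.
have [|l [[c [nc hc sc]] hl]] := @nat_min (fun l => exists c : 'rV[F]_N,
    [/\ c != 0, c *m Om = 0 & sup c = l]).
  have : kermx Om != 0.
    by rewrite -mxrank_eq0 mxrank_ker subn_eq0 -ltnNge (leq_ltn_trans (rank_leq_col _)).
  case/rowV0Pn => c /sub_kermxP hc nc; by exists (sup c), c.
have [j0 nj0] : exists j, c 0 j != 0.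
  apply/existsP; apply: contraNT nc; rewrite negb_exists => /forallP h.
  by apply/eqP/rowP => j; rewrite mxE; have := h j; rewrite negbK => /eqP.
pose c1 := (c 0 j0)^-1 *: c.
have c1j : c1 0 j0 = 1 by rewrite mxE mulVf.
have hc1 : c1 *m Om = 0 by rewrite -scalemxAl hc scaler0.
have sc1 : sup c1 = l.
  rewrite -sc /sup; apply: eq_card => j; rewrite !inE mxE mulf_eq0 invr_eq0 (negPf nj0) //.
(* Applying the connection to the relation shows that the derivatives of the coefficients form
   another one; its support is smaller, since the coefficient 1 has derivative 0. *)
have cst i : map_mx (delta i) c1 = 0.
  apply: NNPP => /eqP ne; apply: (hl (sup (map_mx (delta i) c1))).
    rewrite -sc1; apply: proper_card; apply/properP; split.
      apply/subsetP => j; rewrite !inE mxE; apply: contraNneq => ->.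
      by rewrite derD0.
    by exists j0; rewrite !inE ?c1j ?oner_neq0 // mxE c1j derD1 // eqxx.
  exists (map_mx (delta i) c1); split=> //.
  have := connection_mulmx i c1 Om; rewrite hc1 flat mulmx0 addr0 => <-.
  rewrite /connection mul0mx addr0; apply/matrixP => a b; rewrite !mxE.
  exact: derD0.
have [h|h] := classic (forall j, exists b, c1 0 j = phi b).
  have [v hv] : exists v : 'I_N -> k, forall j, c1 0 j = phi (v j).
    exists (fun j => sval (constructive_indefinite_description _ (h j))) => j.
    exact: svalP (constructive_indefinite_description _ (h j)).
  pose mu := \row_j v j.
  have ec : c1 = map_mx phi mu by apply/rowP => j; rewrite hv !mxE.
  have /free mu0 : map_mx phi mu *m Om = 0 by rewrite -ec.
  by move: c1j; rewrite ec mu0 map_mx0 mxE => /eqP; rewrite eq_sym oner_eq0.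
have [j hj] := not_all_ex_not _ _ h.
exists (c1 0 j); split=> [b e|i]; first by apply: hj; exists b.
by have := congr1 (fun A : 'rV_N => A 0 j) (cst i); rewrite !mxE.
Qed.

(** The matrices [T i] side by side have m t columns, so their common left kernel over k has
    dimension at least N - m t > n. Its basis gives horizontal combinations, still free over k, to
    which [flat_dependence] applies. *)
Theorem constant_from_finiteness (N t : nat) (Om : 'M[F]_(N, n)) (T : 'I_m -> 'M[k]_(N, t))
  (E : 'I_m -> 'M[F]_(t, n)) : (m * t + n < N)%N -> const_free Om ->
  (forall i, connection i Om = map_mx phi (T i) *m E i) ->
  exists z, (forall c, z <> phi c) /\ forall i, delta i z = 0.
Proof.
move=> ltN free eT.
pose J := ('I_m * 'I_t)%type.
pose TT := \matrix_(j < N, p < #|{: J}|) T (enum_val p).1 j (enum_val p).2.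
pose La := row_base (kermx TT).
have LT i : La *m T i = 0.
  have : La *m TT = 0 by apply/sub_kermxP; rewrite eq_row_base.
  move=> h; apply/matrixP => x y; rewrite [RHS]mxE.
  have := congr1 (fun A : 'M_(_, _) => A x (enum_rank ((i, y) : J))) h.
  by rewrite !mxE => e; rewrite -[RHS]e; apply: eq_bigr => j _; rewrite [X in _ = _ * X]mxE enum_rankK.
apply: (@flat_dependence _ (map_mx phi La *m Om)).
- rewrite mxrank_ker; apply: (@leq_trans (N - #|{: J}|)); last by rewrite leq_sub2l // rank_leq_col.
  by rewrite card_prod !card_ord ltn_subRL.
- by move=> i; rewrite connection_const eT mulmxA -map_mxM LT map_mx0 mul0mx.
- move=> mu; rewrite mulmxA -map_mxM => /free h.
  by apply: (row_free_inj (row_base_free (kermx TT))); rewrite mul0mx.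
Qed.

End Connection.

(** Each new prime is chosen not to divide the product of the earlier ones; between primes
    divisibility is symmetric, so one direction is enough. *)
Lemma prime_family (B : idomainType) (T : Type) (Q : B -> T -> Prop) :
  (forall c, c != 0 -> exists q x, [/\ prime_elt q, Q q x & ~ multiple q c]) ->
  forall N, exists (q : 'I_N -> B) (x : 'I_N -> T), (forall i, prime_elt (q i) /\ Q (q i) (x i)) /\
    forall i j, i != j -> ~ multiple (q j) (q i).
Proof.
move=> h; elim=> [|N [q [x [hq nq]]]].
  have [q [x _]] := h _ (oner_neq0 B).
  by exists (fun=> q), (fun=> x); split=> -[].
have nz : \prod_i q i != 0 by apply/prodf_neq0 => i _; apply/eqP; have [[]] := hq i.
have [q' [x' [pq' hx' nq']]] := h _ nz.
pose qq i := if unlift ord_max i is Some j then q j else q'.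
pose xx i := if unlift ord_max i is Some j then x j else x'.
have nq'' j : ~ multiple q' (q j).
  by move=> [c e]; apply: nq'; exists (c * \prod_(i | i != j) q i); rewrite (bigD1 j) //= e; ring.
exists qq, xx; split=> [i|i j]; first by rewrite /qq /xx; case: unliftP => [j _|_] //; split.
rewrite /qq; case: unliftP => [j' ->|->]; case: unliftP => [i' ->|->].
- by rewrite (inj_eq lift_inj); apply: nq.
- by move=> _ hm; apply: (nq'' j'); apply: prime_elt_assoc hm => //; case: (hq j').
- by move=> _; apply: nq''.
- by rewrite eqxx.
Qed.

Section LogPoles.
Variables (B A : idomainType) (F : fieldType) (C : chart B A F) (n : nat).
Local Notation evFB := (ch_evFB C).
Local Notation regular := (regular C).

Definition log_pole (q : B) (omega : 'I_n -> F) :=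
  (forall k, regular (evFB q * omega k)) /\
  exists k, forall b, ~ multiple q b -> ~ regular (evFB b * omega k).

(** Multiplying a relation by the product of all q_i other than q_j clears every pole except that of
    the j-th form, whose coefficient must then be 0. *)
Lemma log_pole_free (k : fieldType) (phi : {rmorphism k -> F}) (N : nat)
  (q : 'I_N -> B) (omega : 'I_N -> 'I_n -> F) :
  (forall c, regular (phi c)) -> (forall j, prime_elt (q j) /\ log_pole (q j) (omega j)) ->
  (forall i j, i != j -> ~ multiple (q j) (q i)) ->
  const_free phi (\matrix_(j, l) omega j l).
Proof.
move=> rphi hq nq mu hmu; apply/rowP => j; rewrite mxE; apply: NNPP => /eqP nmu.
have [pq [_ [l hl]]] := hq j; have [_ mq] := pq.
pose b := \prod_(i | i != j) q i.
have nb : ~ multiple (q j) b.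
  rewrite /b; elim/big_rec: _ => [|i c nij nc]; first by case: mq => _ [].
  by case/(primeM mq) => //; apply: nq.
apply: (hl b nb); have := congr1 (fun M : 'rV_n => M 0 l) hmu; rewrite !mxE.
rewrite (bigD1 j) //= !mxE => /eqP; rewrite addr_eq0 => /eqP e.
have -> : evFB b * omega j l = - (phi (mu 0 j)^-1 * (evFB b * \sum_(i | i != j) phi (mu 0 i) * omega i l)).
  rewrite -mulrN [evFB b * _]mulrC [X in _ = _ * X](_ : _ = (phi (mu 0 j) * omega j l) * evFB b).
    by rewrite fmorphV; field; rewrite fmorph_eq0.
  rewrite e mulrC mulNr -mulrN mulrN; congr (- (_ * _)).
  by apply: eq_bigr => i _; rewrite !mxE.
apply: regularN; apply: regularM => //; rewrite mulr_sumr; apply: regular_sum => i nij.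
rewrite mulrCA; apply: regularM => //.
have -> : evFB b = evFB (\prod_(i0 | (i0 != j) && (i0 != i)) q i0) * evFB (q i).
  by rewrite -rmorphM mulrC /b (bigD1 i).
rewrite -mulrA; apply: regularM; first exact: regular_evFB.
by have [_ []] := hq i.
Qed.

End LogPoles.

(** * Counting logarithmic forms against a finite-dimensional space *)

Section Finiteness.
Variables (B A : idomainType) (F : fieldType) (C : chart B A F).
Local Notation f := (ch_f C).
Local Notation r := (ch_r C).
Local Notation H := (ch_H C).
Local Notation toF := (ch_F C).
Local Notation evA := (ch_ev C).
Local Notation evB := (ch_evB C).
Local Notation evF := (ch_evF C).
Local Notation evFB := (ch_evFB C).
Local Notation regular := (regular C).

Variables (k : fieldType) (iota : {rmorphism k -> B}) (n : nat) (d : 'I_n -> B -> B).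
Hypotheses (dD : forall l a b, d l (a + b) = d l a + d l b)
  (dM : forall l a b, d l (a * b) = a * d l b + b * d l a)
  (dC : forall l i b, d l (d i b) = d i (d l b)) (dk : forall l c, d l (iota c) = 0).
Variables (w : filtration B) (kap h : nat).
Hypotheses (ws : strict w) (wd : forall m l b, w m b -> w m (d l b)) (wH : w h%:Z H)
  (wf : poly_filt w kap%:Z (kap%:Z * r.+1%:Z) f)
  (w_fin : forall m : nat, exists (t : nat) (e : 'I_t -> B), forall b, w m%:Z b ->
    exists c : 'I_t -> k, b = \sum_i iota (c i) * e i).

Variables (m : nat) (delta : 'I_m -> A -> A) (a : 'I_m -> 'I_n -> A).
Hypotheses (deltaD : forall i u v, delta i (u + v) = delta i u + delta i v)
  (deltaM : forall i u v, delta i (u * v) = u * delta i v + v * delta i u)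
  (delta_evB : forall i b, delta i (evB b) = \sum_l a i l * evB (d l b)).

Hypothesis primes : forall c, c != 0 -> exists P,
  [/\ is_height_one_prime P, forall i u, P u -> P (delta i u) & ~ P (evB c)].
Hypothesis log_numerators : forall P q s, is_height_one_prime P -> prime_elt q -> P (evB q) ->
  (forall b, P (evB b) -> multiple q b) -> ~ P (evA s) ->
  (forall p, P (evA p) -> exists b c, s * p = b * f + c * q%:P) ->
  exists (U : 'I_n -> {poly B}) (dq : nat), [/\ w dq%:Z q, ~ w (dq%:Z - 1) q &
    forall l, [/\ poly_filt w kap%:Z (kap%:Z * r%:Z + dq%:Z) (U l),
      P (evA (U l) - evA f^`() * evB (d l q)) &
      forall p, P (evA p) -> exists b c, U l * p = b * f + c * q%:P]].
Hypothesis nonconstant : forall q, prime_elt q -> exists l, ~ multiple q (d l q).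

Theorem constant_exists : exists (z : F) (E : 'I_m -> F -> F),
  [/\ forall i, derivation (E i), forall i u, E i (toF u) = toF (delta i u),
    forall c, z <> evFB (iota c) & forall i, E i z = 0].
Proof.
have [E hE] : exists E : 'I_m -> F -> F, forall i, vector_field C d (E i) (fun l => toF (a i l))
    (toF (delta i (evA 'X))) /\ forall u, E i (toF u) = toF (delta i u).
  have h1 i := derivation_field (C := C) dD dM (deltaD i) (deltaM i) (delta_evB i).
  exists (fun i => sval (constructive_indefinite_description _ (h1 i))) => i.
  exact: svalP (constructive_indefinite_description _ (h1 i)).
have [D [D' hD]] : exists D D', forall l, vector_field C d (D l) (fun i => (i == l)%:R) (D' l).
  have h1 l := constructive_indefinite_description _ (coordinate_field C dD dM l).
  have h2 l := constructive_indefinite_description _ (svalP (h1 l)).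
  by exists (fun l => sval (h1 l)), (fun l => sval (h2 l)) => l; apply: svalP (h2 l).
have dE i : derivation (E i) by have [[]] := hE i.
have [K hK] : exists K : 'I_m -> nat, forall i P q s U (dq : nat),
    is_height_one_prime P -> ~ P (evB H) -> prime_elt q -> P (evB q) -> ~ P (evA s) ->
    (forall p, P (evA p) -> exists b c, s * p = b * f + c * q%:P) ->
    (forall k p, P (evA p) -> exists b c, U k * p = b * f + c * q%:P) ->
    (forall k, P (evA (U k) - evA f^`() * evB (d k q))) ->
    (exists2 u, P u & E i (evFB q) = toF u) ->
    w dq%:Z q -> ~ w (dq%:Z - 1) q -> (forall k, poly_filt w kap%:Z (kap%:Z * r%:Z + dq%:Z) (U k)) ->
    forall k, exists g : {poly B}, [/\ (size g <= r.+1)%N,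
      evFB H ^+ K i * lie (E i) (fun l => toF (a i l)) D (log_form C q U) k = evF g &
      forall j, w (h.+1 * K i)%:Z g`_j].
  have h1 i := lie_log_form_bounded dD dC ws wd wH wf (proj1 (hE i)) hD.
  exists (fun i => sval (constructive_indefinite_description _ (h1 i))) => i.
  exact: svalP (constructive_indefinite_description _ (h1 i)).
pose small i (z : F) := exists g : {poly B}, [/\ (size g <= r.+1)%N, evFB H ^+ K i * z = evF g &
      forall j, w (h.+1 * K i)%:Z g`_j].
pose good q omega := log_pole C q omega /\
  forall i l, small i (lie (E i) (fun l => toF (a i l)) D omega l).
have good_ex c : c != 0 -> exists q omega, [/\ prime_elt q, good q omega & ~ multiple q c].
  (* Avoiding c H avoids both factors: the prime is visible on the chart, and the q found below it
     does not divide c. *)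
  move=> nc; have [|P [hP dP nP]] := primes (c := c * H); first by rewrite mulf_neq0 ?ch_H0.
  have iP := proj1 (proj1 hP).
  have nPH : ~ P (evB H) by move=> h1; apply: nP; rewrite rmorphM; apply: idealMl.
  have nPc : ~ P (evB c) by move=> h1; apply: nP; rewrite rmorphM; apply: idealMr.
  have [q [pq Pq]] := prime_below C hP.
  have [s [nPs sP]] := separating_element hP nPH pq Pq.
  have PBq b := @prime_contraction _ _ _ C _ hP nPH q pq Pq b.
  have [U [dq [wq nwq hU]]] := log_numerators hP pq Pq PBq nPs sP.
  have wU l : poly_filt w kap%:Z (kap%:Z * r%:Z + dq%:Z) (U l) by have [] := hU l.
  have Uq l : P (evA (U l) - evA f^`() * evB (d l q)) by have [] := hU l.
  have UP l p : P (evA p) -> exists b c, U l * p = b * f + c * q%:P by have [_ _] := hU l; apply.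
  have nqF : evFB q != 0 by rewrite evFB_eq0; apply/eqP; case: pq.
  exists q, (log_form C q U); split=> //; last by move/(multiple_in hP Pq).
  split; [split|].
  - move=> l; rewrite /log_form mulrC divfK //.
    by apply: regularM; [apply: regular_evF | apply: regular_etale_inv].
  - have [l hl] := nonconstant pq; exists l => b nb.
    exact: (@log_form_pole _ _ _ C n d P q U hP nPH pq Pq Uq l b hl nb).
  move=> i l; apply: (hK i P q s U dq) => //.
  exists (delta i (evB q)); first exact: dP.
  by rewrite evFBA; have [_ ->] := hE i.
have [t [e he]] := w_fin (\max_i h.+1 * K i)%N.
pose phi : {rmorphism k -> F} := evFB \o iota.
have rphi c : regular (phi c) by apply: regular_evFB.
pose J := ('I_r.+1 * 'I_t * 'I_n)%type.
(* [J] indexes the forms e_y y^x / H^K dx_l, which span all the Lie derivatives over k; [N] is the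
   least number of forms that exceeds the count required by [constant_from_finiteness]. *)
pose N := (m * #|{: J}| + n).+1.
have [q [omega [hq nq]]] := prime_family good_ex N.
pose Om : 'M[F]_(N, n) := \matrix_(j, l) omega j l.
pose M i : 'M[F]_n := \matrix_(l, l') (D l' (toF (a i l))).
pose Eb i : 'M[F]_(#|{: J}|, n) := \matrix_(p, l)
  (let x : J := enum_val p in
   (x.2 == l)%:R * (evFB (e x.1.2) * evF 'X ^+ x.1.1 / evFB H ^+ K i)).
have eOm i j l : connection E M i Om j l =
    lie (E i) (fun l => toF (a i l)) D (omega j) l.
  by rewrite !mxE; congr (_ + _); apply: eq_bigr => l' _; rewrite !mxE.
have expand i z : small i z -> exists c : 'I_r.+1 * 'I_t -> k,
    z = \sum_x phi (c x) * (evFB (e x.2) * evF 'X ^+ x.1 / evFB H ^+ K i).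
  move=> [g [sg eg wg]].
  have hg (x : 'I_r.+1) : exists c : 'I_t -> k, g`_x = \sum_y iota (c y) * e y.
    apply: he; apply: fw_le (wg x); rewrite lez_nat.
    exact: (leq_bigmax_cond (F := fun i => (h.+1 * K i)%N)).
  have {}hg x := constructive_indefinite_description _ (hg x).
  exists (fun x => sval (hg x.1) x.2).
  have nHK := expf_neq0 (K i) (evFH_neq0 C).
  apply: (mulfI nHK); rewrite eg mulr_sumr.
  rewrite -(pair_bigA _ (fun x y => evFB H ^+ K i * (phi (sval (hg x) y) *
    (evFB (e y) * evF 'X ^+ x / evFB H ^+ K i)))); cbv beta.
  have -> : evF g = \sum_(x < r.+1) evFB g`_x * evF 'X ^+ x.
    have eg' : g = \poly_(x < r.+1) g`_x.
      apply/polyP => x; rewrite coef_poly; case: ltnP => // le.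
      by rewrite nth_default // (leq_trans sg).
    rewrite {1}eg' poly_def rmorph_sum; apply: eq_bigr => x _.
    by rewrite -mul_polyC rmorphM rmorphXn.
  apply: eq_bigr => x _; rewrite {1}(svalP (hg x)) rmorph_sum mulr_suml.
  by apply: eq_bigr => y _; rewrite rmorphM -[evFB (iota _)]/(phi _); field.
have {}expand i j l : exists c : 'I_r.+1 * 'I_t -> k, connection E M i Om j l =
    \sum_x phi (c x) * (evFB (e x.2) * evF 'X ^+ x.1 / evFB H ^+ K i).
  by rewrite eOm; apply: expand; have [_ [_]] := hq j.
have [cc hcc] : exists cc : 'I_m -> 'I_N -> 'I_n -> 'I_r.+1 * 'I_t -> k, forall i j l,
    connection E M i Om j l = \sum_x phi (cc i j l x) * (evFB (e x.2) * evF 'X ^+ x.1 / evFB H ^+ K i).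
  exists (fun i j l => sval (constructive_indefinite_description _ (expand i j l))) => i j l.
  exact: svalP (constructive_indefinite_description _ (expand i j l)).
pose T i : 'M[k]_(N, #|{: J}|) :=
  \matrix_(j, p) (let x : J := enum_val p in cc i j x.2 x.1).
have [|||z [hz hz']] := @constant_from_finiteness _ _ phi m n E M dE _ N _ Om T Eb (leqnn _).
- move=> i c; rewrite (vector_fieldB dD _ (proj1 (hE i))) big1 // => l _.
  by rewrite dk rmorph0 mulr0.
- exact: log_pole_free rphi (fun j => conj (proj1 (hq j)) (proj1 (proj2 (hq j)))) nq.
- move=> i; apply/matrixP => j l; rewrite hcc !mxE.
  pose G (x : 'I_r.+1 * 'I_t) l' := phi (cc i j l' x) *
    ((l' == l)%:R * (evFB (e x.2) * evF 'X ^+ x.1 / evFB H ^+ K i)).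
  transitivity (\sum_(x : J) G x.1 x.2).
    rewrite -(pair_bigA _ G); apply: eq_bigr => x _; rewrite (bigD1 l) // /G eqxx mul1r big1; last first.
      by move=> l' /negPf->; rewrite mul0r mulr0.
    exact: (esym (addr0 _)).
  rewrite (eq_bigl (fun x => x \in {: J})) // (big_enum_val (fun x : J => G x.1 x.2)).
  by apply: eq_bigr => p _; rewrite !mxE.
by exists z, E; split=> // i u; have [_ ->] := hE i.
Qed.

End Finiteness.

(** * The chart of an affine algebra *)

Section PolynomialChart.
Variables (k : fieldType) (n : nat).
Hypothesis char0 : [pchar k] =i pred0.
Local Notation B := {mpoly k[n]}.

(** The partial derivative is the coefficient of T in the translate along the l-th axis, where T has
    weight 1. *)
Lemma deg_filt_mderiv m l (b : B) : deg_filt k n m b -> deg_filt k n (m - 1) b^`M(l).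
Proof.
pose w (j : 'I_n) : k := (j == l)%:R; move=> hb; have := @translate_filt k n w m b hb 1%N.
rewrite mulr1 translate_coef1 (bigD1 l) //= {1}/w eqxx scale1r big1 ?addr0 //.
by move=> j /negPf; rewrite /w => ->; rewrite scale0r.
Qed.

Lemma mderiv_eq0 (b : B) : (forall l, b^`M(l) = 0) -> b = (b@_0%MM)%:MP.
Proof.
move=> h; apply/mpolyP => m; rewrite mcoeffC.
have [->|nm] := eqVneq 0%MM m; first by rewrite mulr1.
rewrite mulr0; have [l nl] : exists l, m l != 0%N.
  apply/existsP; apply: contraNT nm; rewrite negb_exists => /forallP h0.
  by apply/eqP/mnmP => l; rewrite mnm0E; have := h0 l; rewrite negbK => /eqP.
have := congr1 (mcoeff (m - U_(l))%MM) (h l); rewrite mcoeff_deriv mcoeff0 submK; last first.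
  by rewrite lep1mP.
move/eqP; rewrite -mulr_natr mulf_eq0 => /orP[/eqP//|].
by rewrite (proj1 (pcharf0P _) char0).
Qed.

(** A derivative divisible by [q] vanishes for degree reasons; if all vanished, [q] would be a
    constant in characteristic 0, hence a unit. *)
Lemma prime_elt_mderiv (q : B) : prime_elt q -> exists l, ~ multiple q q^`M(l).
Proof.
move=> pq; have [/eqP nq mq] := pq; apply: NNPP => h; apply: (prime_elt_Nunit pq).
have e l : q^`M(l) = 0.
  have [c ec] : multiple q q^`M(l) by apply: NNPP => h'; apply: h; exists l.
  have [c0|nc] := eqVneq c 0; first by rewrite ec c0 mul0r.
  have gq := msz_gt0 nq; have gc := msz_gt0 nc.
  have hq : deg_filt k n ((msz q).-1%:Z) q by move=> _; lia.
  have := deg_filt_mderiv hq (l := l); rewrite ec => h1.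
  have /h1 : c * q <> 0 by apply/eqP; rewrite mulf_neq0.
  by rewrite mszM //; lia.
have nq0 : q@_0%MM != 0.
  by apply: contraNneq nq => q0; rewrite (mderiv_eq0 e) q0 mpolyC0.
exists ((q@_0%MM)^-1)%:MP; rewrite {2}(mderiv_eq0 e) -mpolyCM mulVf //.
Qed.

Lemma deg_filt_fin (m : nat) : exists (t : nat) (e : 'I_t -> B), forall b, deg_filt k n m%:Z b ->
  exists c : 'I_t -> k, b = \sum_i mpolyC n (c i) * e i.
Proof.
pose mon (i : 'I_#|{: 'X_{1..n < m.+1}}|) : 'X_{1..n < m.+1} := enum_val i.
exists #|{: 'X_{1..n < m.+1}}|, (fun i => 'X_[mon i]) => b hb; exists (fun i => b@_(mon i)).
have sb : (msize b <= m.+1)%N.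
  have [->|/eqP nb] := eqVneq b 0; first by rewrite msize0.
  have h : (msz b)%:Z <= m%:Z + 1 := hb nb.
  have : (msz b <= m.+1)%N by lia.
  exact.
rewrite {1}(mpolywE sb) (eq_bigl (fun x => x \in {: 'X_{1..n < m.+1}})) //.
rewrite (big_enum_val (fun x : 'X_{1..n < m.+1} => b@_x *: 'X_[x])).
by apply: eq_bigr => i _; rewrite mul_mpolyC.
Qed.

End PolynomialChart.

Lemma hmorph_eq (S T : comNzRingType) (phi psi : {rmorphism S -> T}) (u : T) :
  phi =1 psi -> hmorph phi u =1 hmorph psi u.
Proof. by move=> e; apply: poly_mor_eq => [c|]; rewrite ?hmorphC ?hmorphX. Qed.

Section FractionChart.
Variables (B A : idomainType) (ev : {rmorphism B -> A}) (y : A).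
Variables (f : {poly B}) (r : nat) (H : B) (v : {poly B}).
Hypotheses (inj : injective ev) (mf : f \is monic) (sf : size f = r.+2) (fy : hmorph ev y f = 0)
  (fmin : forall p : {poly B}, (size p <= r.+1)%N -> hmorph ev y p = 0 -> p = 0) (nH : H != 0)
  (gen : forall a, exists j p, ev H ^+ j * a = hmorph ev y p) (alg : forall a, alg_over ev a)
  (etale : hmorph ev y f^`() * hmorph ev y v = ev H)
  (fact : factorial B) (noeth : noetherian A).

Let F0 (a : A) : @FracField.tofrac A a = 0 -> a = 0.
Proof. by move/eqP; rewrite tofrac_eq0 => /eqP. Qed.

Let Ffrac (z : {fraction A}) : exists a b : A,
  @FracField.tofrac A b != 0 /\ z = @FracField.tofrac A a / @FracField.tofrac A b.
Proof.
exists \n_(repr z), \d_(repr z); rewrite tofrac_eq0 denom_ratioP; split=> //.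
exact: frac_repr.
Qed.

Let evC b : hmorph ev y b%:P = ev b := hmorphC ev y b.

Let injC b : hmorph ev y b%:P = 0 -> b = 0.
Proof. by rewrite evC -(rmorph0 ev) => /inj. Qed.

Let genC a : exists j p, hmorph ev y (H ^+ j)%:P * a = hmorph ev y p.
Proof. by have [j [p e]] := gen a; exists j, p; rewrite evC rmorphXn. Qed.

Let algC a : alg_over (hmorph ev y \o polyC) a.
Proof. by have [p np hp] := alg a; exists p => //; rewrite -[RHS]hp; apply: hmorph_eq. Qed.

Let etC : hmorph ev y f^`() * hmorph ev y v = hmorph ev y H%:P.
Proof. by rewrite evC. Qed.

Definition frac_chart : chart B A {fraction A} :=
  Chart F0 Ffrac injC mf sf fy fmin nH genC algC etC fact noeth.

End FractionChart.

Section Conclusion.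
Variables (A : idomainType) (iota : {rmorphism CC -> A}) (m : nat) (delta : 'I_m -> A -> A).
Hypotheses (Hfg : finitely_generated iota) (Hder : forall i, is_C_derivation iota (delta i))
  (Hinf : inf_many_h1_prime_diff_ideals delta).

Let noethA := finitely_generated_noetherian Hfg.

Lemma der_add i u v : delta i (u + v) = delta i u + delta i v.
Proof. by case: (Hder i). Qed.

Lemma der_mul i u v : delta i (u * v) = u * delta i v + v * delta i u.
Proof. by have [_ [_ ->]] := Hder i; rewrite [_ * v]mulrC. Qed.

Lemma der_const i c : delta i (iota c) = 0.
Proof.
by have [_ [h _]] := Hder i; rewrite -[iota c]mulr1 h (leibniz1 (der_mul i)) mulr0.
Qed.

(** The primes of height one containing [a] form a finite list, which the infinite supply of
    differential primes escapes. *)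
Lemma avoiding_prime a : a != 0 -> exists P, [/\ is_height_one_prime P,
  forall i u, P u -> P (delta i u) & ~ P a].
Proof.
move=> na; have [L hL] := height_one_finite noethA (a := a) (elimN eqP na).
have [P [hP [dP nL]]] := Hinf L; exists P; split=> // Pa.
by have [J [inJ sJ]] := hL P hP Pa; apply: (nL J inJ).
Qed.

Lemma chain_rule i n (x : 'I_n -> A) (b : {mpoly CC[n]}) :
  delta i (ev_coord iota x b) = \sum_l delta i (x l) * ev_coord iota x b^`M(l).
Proof.
elim/mpoly_gen_ind: b => [c|j|p q hp hq|p q hp hq].
- rewrite ev_coordC der_const big1 // => l _; by rewrite mderivC rmorph0 mulr0.
- rewrite ev_coordX (bigD1 j) //= big1 ?addr0 => [|l nlj].
    have e0 : (U_(j) - U_(j))%MM = 0%MM :> 'X_{1..n}.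
      by apply/mnmP => l; rewrite mnmBE subnn mnm0E.
    by rewrite mderivX mnm1E eqxx scale1r e0 mpolyX0 rmorph1 mulr1.
  by rewrite mderivX mnm1E eq_sym (negPf nlj) scale0r rmorph0 mulr0.
- rewrite rmorphD der_add hp hq -big_split; apply: eq_bigr => l _ /=.
  by rewrite mderivD rmorphD mulrDr.
- rewrite rmorphM der_mul hp hq !mulr_sumr -big_split; apply: eq_bigr => l _ /=.
  rewrite mderivM rmorphD [ev_coord _ _ (p^`M(l) * q)]rmorphM [ev_coord _ _ (p * _)]rmorphM.
  have e (a b c u v : A) : a * (b * c) + u * (b * v) = b * (v * u + a * c) by ring.
  exact: e.
Qed.

End Conclusion.

Arguments nf_x {A iota}. Arguments nf_y {A iota}. Arguments nf_f {A iota}. Arguments nf_r {A iota}. Arguments nf_kap {A iota}.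
Arguments nf_inj {A iota}. Arguments nf_min {A iota}. Arguments nf_gen {A iota}. Arguments nf_alg {A iota}.

Section Main.
Variables (A : idomainType) (iota : {rmorphism CC -> A}) (m : nat) (delta : 'I_m -> A -> A).
Hypotheses (Hfg : finitely_generated iota) (Hder : forall i, is_C_derivation iota (delta i))
  (Hinf : inf_many_h1_prime_diff_ideals delta) (N : normal_form iota).

Let n := nf_n N.
Let B : idomainType := {mpoly CC[n]}.
Let ev : {rmorphism B -> A} := ev_coord iota (nf_x N).
Let C := frac_chart (ev := ev) (@nf_inj A iota N) (nf_monic N) (nf_size N) (nf_root N) (@nf_min A iota N)
  (nf_H0 N) (nf_gen N) (nf_alg N) (nf_etale N) (@factorial_mpoly CC n)
  (finitely_generated_noetherian Hfg).

Let evBE b : ch_evB C b = ev b. Proof. exact: hmorphC. Qed.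

Lemma chart_log_numerators P q s : is_height_one_prime P -> prime_elt q -> P (ch_evB C q) ->
  (forall b, P (ch_evB C b) -> multiple q b) -> ~ P (ch_ev C s) ->
  (forall p, P (ch_ev C p) -> exists b c, s * p = b * ch_f C + c * q%:P) ->
  exists (U : 'I_n -> {poly B}) (dq : nat), [/\ deg_filt CC n dq%:Z q, ~ deg_filt CC n (dq%:Z - 1) q &
    forall l, [/\ poly_filt (deg_filt CC n) (nf_kap N)%:Z ((nf_kap N)%:Z * (ch_r C)%:Z + dq%:Z) (U l),
      P (ch_ev C (U l) - ch_ev C (ch_f C)^`() * ch_evB C (q^`M(l))) &
      forall p, P (ch_ev C p) -> exists b c, U l * p = b * ch_f C + c * q%:P]].
Proof.
move=> [pP _] [/eqP nq mq]; rewrite evBE => Pq PB nPs sP.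
have PBq b : P (ev b) -> multiple q b by rewrite -evBE; apply: PB.
have hU l := @log_numerator CC A iota n char0_CC (nf_x N) (nf_y N) P q (nf_f N) (nf_r N) s (nf_kap N)%:Z
  pP Pq nq PBq (nf_monic N) (nf_size N) (nf_root N) (@nf_weight A iota N) nPs sP l.
have sq : (1 < @msz CC n q)%N := @prime_gen_nonconst CC A iota n (nf_x N) P q pP Pq nq.
have {}hU l := constructive_indefinite_description _ (hU l).
exists (fun l => sval (hU l)), (@msz CC n q).-1; split.
- move=> _; have : (@msz CC n q)%:Z <= (@msz CC n q).-1%:Z + 1.
    by move: (@msz CC n q) sq => u; lia.
  exact.
- move=> h; have {h} : (@msz CC n q)%:Z <= (@msz CC n q).-1%:Z - 1 + 1 := h (elimN eqP nq).
  by move: (@msz CC n q) sq => u; lia.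
move=> l; have [h1 h2 h3] := svalP (hU l); split=> //.
(* The numerator has one degree to spare: its bound uses deg q - 1, relaxed to the exact degree [dq]
   of [q]. *)
- apply: fw_le h1; rewrite lerD2l lez_nat.
  have : (@msz CC n q - 2 <= (@msz CC n q).-1)%N by lia.
  exact.
- by rewrite evBE.
Qed.

Lemma deg_filt_mderiv_le i l (b : B) : deg_filt CC n i b -> deg_filt CC n i b^`M(l).
Proof. by move=> hb; apply: fw_le (deg_filt_mderiv (l := l) hb); rewrite gerDl. Qed.

Lemma chart_primes (c : B) : c != 0 -> exists P,
  [/\ is_height_one_prime P, forall i u, P u -> P (delta i u) & ~ P (ch_evB C c)].
Proof.
move=> nc; rewrite evBE; apply: (avoiding_prime Hfg Hinf).
by apply: contraNneq nc => h; apply/eqP/(@nf_inj A iota N); rewrite [LHS]h rmorph0.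
Qed.

Lemma chart_chain_rule i b : delta i (ch_evB C b) =
  \sum_l delta i (nf_x N l) * ch_evB C b^`M(l).
Proof.
rewrite evBE; apply: etrans (chain_rule Hder i _ b) _; apply: eq_bigr => l _.
by congr (_ * _); rewrite evBE.
Qed.

Lemma mderiv_leibniz l (b c : B) : (b * c)^`M(l) = b * c^`M(l) + c * b^`M(l).
Proof. by rewrite mderivM addrC [c * _]mulrC. Qed.

Lemma H_filt : deg_filt CC n (msz (nf_H N))%:Z (nf_H N).
Proof. by move=> _; rewrite lerDl. Qed.

(** Any derivation extending [delta i] obeys the quotient rule on the chosen representative, so it
    agrees with [frac_deriv]. *)
Lemma frac_deriv_eq0 i (E : {fraction A} -> {fraction A}) z : derivation E ->
  (forall u, E (@FracField.tofrac A u) = @FracField.tofrac A (delta i u)) -> E z = 0 ->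
  frac_deriv (delta i) z = 0.
Proof.
move=> dE hE; rewrite {1}(frac_repr z) (derD_div dE) ?tofrac_eq0 ?denom_ratioP // !hE => <-.
rewrite /frac_deriv /= tofracXn; congr (_ / _).
by rewrite tofracB !tofracM mulrC.
Qed.

Lemma constant_of_normal_form : exists z : {fraction A},
  (forall c : CC, z <> @FracField.tofrac A (iota c)) /\ forall i, frac_deriv (delta i) z = 0.
Proof.
have [z [E [dE hE nz Ez]]] := @constant_exists B A {fraction A} C CC (@mpolyC n CC) n
  (fun l b => b^`M(l)) (fun l => mderivD l) mderiv_leibniz (fun l i b => mderiv_comm i l b)
  (fun l c => mderivC l c) (deg_filt CC n) (nf_kap N) (msz (nf_H N)) (@deg_filt_strict CC n)
  (fun i l b => @deg_filt_mderiv_le i l b) H_filt (@nf_weight A iota N) (@deg_filt_fin CC n) m delta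
  (fun i l => delta i (nf_x N l)) (der_add Hder) (der_mul Hder) chart_chain_rule chart_primes
  chart_log_numerators (prime_elt_mderiv char0_CC).
exists z; split=> [c e|i]; last exact: frac_deriv_eq0 (dE i) (hE i) (Ez i).
apply: (nz c); rewrite e evFBA evBE; congr (_ _).
exact: (esym (ev_coordC _ _ _)).
Qed.

End Main.

Theorem theorem6p1 (A : idomainType) (iota : {rmorphism CC -> A})
  (Hfg : finitely_generated iota)
  (m : nat) (delta : 'I_m -> A -> A)
  (Hder : forall i, is_C_derivation iota (delta i))
  (Hinf : inf_many_h1_prime_diff_ideals delta) :
  exists f : {fraction A},
    (forall c : CC, f <> tofrac (iota c)) /\
    (forall i, frac_deriv (delta i) f = 0).
Proof.
have [N] := normal_form_exists Hfg.
exact: constant_of_normal_form Hfg Hder Hinf N.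
Qed.
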